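(* Let $p$ be a prime and $(S,\mathcal F,\mathcal L)$ a $p$-local compact group. There is a bijective correspondence between the set of subgroups $H\le\Gamma_{p'}(\mathcal F)=\operatorname{Out}_{\mathcal F}(S)/\operatorname{Out}^0_{\mathcal F}(S)$ and the set of saturated fusion subsystems $\mathcal F_H\subseteq\mathcal F$ of index prime to $p$. The correspondence is given by associating to $H$ the fusion system over $S$ generated by $\widehat\theta^{-1}(\mathcal B(H))$, where $\widehat\theta:\mathcal F^c\to\mathcal B(\operatorname{Out}_{\mathcal F}(S)/\operatorname{Out}^0_{\mathcal F}(S))$ is the functor described in the context.
   Context: **Fusion systems.** $\mathbb{Z}/p^\infty=\bigcup_n\mathbb{Z}/p^n$. A discrete $p$-toral group is a group $S$ with a normal subgroup $T\cong(\mathbb{Z}/p^\infty)^r$ of finite $p$-power index; $|S|=(r,|S/T|)$, ordered lexicographically. A fusion system $\mathcal F$ over $S$ is a category whose objects are all subgroups of $S$, with $\operatorname{Hom}_S(P,Q)\subseteq\operatorname{Hom}_{\mathcal F}(P,Q)\subseteq\operatorname{Inj}(P,Q)$ ($\operatorname{Hom}_S$: homomorphisms induced by conjugation in $S$), such that each morphism is an $\mathcal F$-isomorphism followed by an inclusion. $P^{\mathcal F}$ is the set of subgroups isomorphic in $\mathcal F$ to $P$; $\operatorname{Out}_{\mathcal F}(P)=\operatorname{Aut}_{\mathcal F}(P)/\operatorname{Inn}(P)$. $P$ is fully centralized (fully normalized) if $|C_S(P)|\ge|C_S(P')|$ (resp. $|N_S(P)|\ge|N_S(P')|$) for all $P'\in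 P^{\mathcal F}$. $\mathcal F$ is saturated if: (I) each fully normalized $P$ is fully centralized, $\operatorname{Out}_{\mathcal F}(P)$ is finite and $\operatorname{Out}_S(P)\in\operatorname{Syl}_p(\operatorname{Out}_{\mathcal F}(P))$; (II) if $\varphi\in\operatorname{Hom}_{\mathcal F}(P,S)$ and $\varphi(P)$ is fully centralized, then $\varphi$ extends to a morphism of $\mathcal F$ on $N_\varphi=\{g\in N_S(P):\varphi c_g\varphi^{-1}\in\operatorname{Aut}_S(\varphi(P))\}$; (III) if $P_1\le P_2\le\cdots$ and $P_\infty=\bigcup P_n$, any $\varphi\in\operatorname{Hom}(P_\infty,S)$ with all $\varphi|_{P_n}\in\operatorname{Hom}_{\mathcal F}(P_n,S)$ is in $\operatorname{Hom}_{\mathcal F}(P_\infty,S)$. $P$ is $\mathcal F$-centric if $C_S(Q)=Z(Q)$ for all $Q\in P^{\mathcal F}$; $\mathcal F^c$ is the full subcategory on these. **Linking systems.** A centric linking system associated to $\mathcal F$ is a category $\mathcal L$ whose objects are the $\mathcal F$-centric subgroups, with a functor $\pi:\mathcal L\to\mathcal F^c$ and monomorphisms $\delta_P:P\to\operatorname{Aut}_{\mathcal L}(P)$ such that: $\pi$ is the identity on objects, $Z(P)$ acts freely on $\operatorname{Mor}_{\mathcal L}(P,Q)$ via $\delta_P$ and $\pi$ induces a bijection $\operatorname{Mor}_{\mathcal L}(P,Q)/Z(P)\to\operatorname{Hom}_{\mathcal F}(P,Q)$; $\pi(\delta_P(g))=c_g$; $f\circ\delta_P(g)=\delta_Q(\pi(f)(g))\circ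 f$ for $f\in\operatorname{Mor}_{\mathcal L}(P,Q)$, $g\in P$. A $p$-local compact group is a triple $(S,\mathcal F,\mathcal L)$ with $\mathcal F$ saturated over the discrete $p$-toral group $S$ and $\mathcal L$ a centric linking system associated to $\mathcal F$. **Index prime to $p$.** For a group $G$, $O^{p'}(G)$ is the intersection of all normal subgroups of $G$ of finite index prime to $p$. A saturated subsystem $(S',\mathcal F')\subseteq(S,\mathcal F)$ has index prime to $p$ if $S'=S$ and $\operatorname{Aut}_{\mathcal F'}(P)\ge O^{p'}(\operatorname{Aut}_{\mathcal F}(P))$ for all $P\le S$. $O^{p'}_*(\mathcal F)\subseteq\mathcal F$ is the smallest fusion subsystem over $S$ (not necessarily saturated) whose morphism set contains $O^{p'}(\operatorname{Aut}_{\mathcal F}(P))$ for all $P\le S$. $\operatorname{Out}^0_{\mathcal F}(S)\le\operatorname{Out}_{\mathcal F}(S)$ is the subgroup generated by the classes $[f]$ of $f\in\operatorname{Aut}_{\mathcal F}(S)$ such that $f|_P\in\operatorname{Mor}_{O^{p'}_*(\mathcal F)}(P,S)$ for some $\mathcal F$-centric $P$; it is normal. $\Gamma_{p'}(\mathcal F)=\pi_1(|\mathcal L|)/O^{p'}(\pi_1(|\mathcal L|))$, identified with $\operatorname{Out}_{\mathcal F}(S)/\operatorname{Out}^0_{\mathcal F}(S)$ (the two are naturally isomorphic). **The functor.** $\mathcal B(\Gamma)$ is the category with one object whose automorphism group is $\Gamma$. $\widehat\theta:\mathcal F^c\to\mathcal B(\operatorname{Out}_{\mathcal F}(S)/\operatorname{Out}^0_{\mathcal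 F}(S))$ is the unique functor with $\widehat\theta(f)=[f]$ for $f\in\operatorname{Aut}_{\mathcal F}(S)$ and $\widehat\theta(f)=[\operatorname{Id}]$ for every morphism $f$ of $O^{p'}_*(\mathcal F)$ between $\mathcal F$-centric subgroups. The fusion system generated by $\widehat\theta^{-1}(\mathcal B(H))$ is the smallest fusion system over $S$ containing all morphisms $f$ of $\mathcal F^c$ with $\widehat\theta(f)\in H$. *)

(* Defs.v *)
From HB Require Import structures.
From mathcomp Require Import all_boot all_order all_algebra algC.
From mathcomp Require Import boolp classical_sets functions cardinality.

Set Implicit Arguments.
Unset Strict Implicit.
Unset Printing Implicit Defensive.

Local Open Scope classical_set_scope.
Local Open Scope card_scope.
Local Open Scope group_scope.

Section Groups.
Variable G : groupType.
Implicit Types (A H N P : set G) (g x : G).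

(* c_g(x) = g x g^-1; the library's x ^ g is g^-1 x g. *)
Definition cj g x : G := g * x * g^-1.

Definition subgroup H : Prop := group_closed (mem H).

Definition gen A : set G :=
  \bigcap_(H in [set H : set G | subgroup H /\ A `<=` H]) H.

Definition normaliser P : set G := [set g | cj g @` P = P].

Definition centraliser P : set G :=
  [set g | forall x, P x -> commute g x].

Definition center P : set G := P `&` centraliser P.

Definition normal_in N A : Prop :=
  [/\ subgroup N, N `<=` A & A `<=` normaliser N].

Definition lcoset x N : set G := [set x * y | y in N].

Definition has_index A N (n : nat) : Prop :=
  [set lcoset x N | x in A] #= `I_n.

(* O^{p'}(A): here p is prime and A is a subgroup. An index is at least 1, so
   "prime to p" is non-divisibility by p. *)
Definition Opprime (p : nat) A : set G :=
  \bigcap_(N in [set N : set G | normal_in N A /\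
     exists2 n, has_index A N n & ~~ (p %| n)%N]) N.

Definition Sylow (p : nat) A H : Prop :=
  [/\ subgroup H, H `<=` A &
      exists k m, [/\ H #= `I_(p ^ k), A #= `I_(p ^ k * m) & ~~ (p %| m)%N]].

End Groups.

(* As for finite groups in the library, the type of cosets of N is the group
   N_G(<<N>>) / <<N>>, so that it is a group for every set N. *)
Section Quotients.
Variable G : groupType.
Implicit Types (A H N : set G) (x y : G).

Record coset_type N := Coset {
  coset_set :> set G;
  coset_setP : exists2 x, normaliser (gen N) x & coset_set = lcoset x (gen N) }.

HB.instance Definition _ N := gen_eqMixin (coset_type N).
HB.instance Definition _ N := gen_choiceMixin (coset_type N).

Lemma subgroup_gen N : subgroup (gen N).
Proof.
split; first by rewrite inE => H [[H1 _] _]; move: H1; rewrite inE.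
move=> x y; rewrite !inE => gx gy H sH.
have [[_ HD] _] := sH.
by have := HD x y; rewrite !inE; apply; [apply: gx | apply: gy].
Qed.

Lemma subgroup1 H : subgroup H -> H 1.
Proof. by case; rewrite inE. Qed.

Lemma subgroupF H x y : subgroup H -> H x -> H y -> H (x / y).
Proof. by case=> _ /(_ x y); rewrite !inE => h Hx Hy; apply: h. Qed.

Lemma subgroupV H x : subgroup H -> H x -> H x^-1.
Proof.
by move=> sH Hx; rewrite -[x^-1]mul1g; apply: subgroupF => //; apply: subgroup1.
Qed.

Lemma subgroupM H x y : subgroup H -> H x -> H y -> H (x * y).
Proof.
by move=> sH Hx Hy; rewrite -[y]invgK; apply: subgroupF => //; apply: subgroupV.
Qed.

Lemma cjM x y z : cj (x * y) z = cj x (cj y z).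
Proof. by rewrite /cj invgM !mulgA. Qed.

Lemma normaliser1 H : normaliser H 1.
Proof.
rewrite /normaliser /=; apply/seteqP; split => [z [x Hx <-]|z Hz].
  by rewrite /cj mul1g invg1 mulg1.
by exists z => //; rewrite /cj mul1g invg1 mulg1.
Qed.

Lemma normaliserM H x y :
  normaliser H x -> normaliser H y -> normaliser H (x * y).
Proof.
rewrite /normaliser /= => Hx Hy; rewrite -[in RHS]Hx -[in RHS]Hy.
apply/seteqP; split => [z [u Hu <-]|z [_ [u Hu <-] <-]].
  by exists (cj y u); [exists u | rewrite cjM].
by exists u => //; rewrite cjM.
Qed.

Lemma normaliserV H x : normaliser H x -> normaliser H x^-1.
Proof.
rewrite /normaliser /= => Hx; rewrite -[in LHS]Hx.
apply/seteqP; split => [z [_ [u Hu <-] <-]|u Hu].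
  by rewrite -cjM mulVg /cj mul1g invg1 mulg1.
exists (cj x u); first by exists u.
by rewrite -cjM mulVg /cj mul1g invg1 mulg1.
Qed.

Definition mul_set A H : set G := [set x * y | x in A & y in H].
Definition inv_set A : set G := [set x^-1 | x in A].

Lemma mul_lcoset H x y : subgroup H -> normaliser H y ->
  mul_set (lcoset x H) (lcoset y H) = lcoset (x * y) H.
Proof.
move=> sH Ny; apply/seteqP; split.
  move=> _ [_ [a Ha <-] [_ [b Hb <-] <-]].
  have [c Hc ac] : (cj y @` H) a by rewrite Ny.
  exists (c * b); first exact: subgroupM.
  by rewrite -ac /cj !mulgA mulgVK.
move=> _ [b Hb <-].
exists (x * 1); first by exists 1 => //; apply: subgroup1.
by exists (y * b); [exists b | rewrite mulg1 mulgA].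
Qed.

Lemma inv_lcoset H x : subgroup H -> normaliser H x ->
  inv_set (lcoset x H) = lcoset x^-1 H.
Proof.
move=> sH Nx; apply/seteqP; split.
  move=> _ [_ [a Ha <-] <-]; exists (cj x a^-1).
    by rewrite -Nx; exists a^-1 => //; apply: subgroupV.
  by rewrite /cj invgM !mulgA mulVg mul1g.
move=> _ [b Hb <-].
have [c Hc cb] : (cj x @` H) b by rewrite Nx.
exists (x * c^-1); first by exists c^-1 => //; apply: subgroupV.
by rewrite invgM invgK -cb /cj !mulgA mulVg mul1g.
Qed.

Lemma quot_inj N : injective (@coset_set N).
Proof.
by move=> [A hA] [B hB] /= AB; case: _ / AB hB => hB; congr Coset;
   apply: Prop_irrelevance.
Qed.

Definition quot_one N : coset_type N :=
  Coset (ex_intro2 _ _ 1 (normaliser1 (gen N)) erefl).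

Lemma quot_mulP N (C D : coset_type N) :
  exists2 x, normaliser (gen N) x & mul_set C D = lcoset x (gen N).
Proof.
have [x Nx ->] := coset_setP C; have [y Ny ->] := coset_setP D.
exists (x * y); first exact: normaliserM.
by apply: mul_lcoset => //; apply: subgroup_gen.
Qed.

Lemma quot_invP N (C : coset_type N) :
  exists2 x, normaliser (gen N) x & inv_set C = lcoset x (gen N).
Proof.
have [x Nx ->] := coset_setP C; exists x^-1; first exact: normaliserV.
by apply: inv_lcoset => //; apply: subgroup_gen.
Qed.

Definition quot_mul N (C D : coset_type N) : coset_type N := Coset (quot_mulP C D).
Definition quot_inv N (C : coset_type N) : coset_type N := Coset (quot_invP C).

Lemma quot_mulA N : associative (@quot_mul N).
Proof.
move=> C D E; apply: quot_inj => /=; have [x Nx eC] := coset_setP C.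
have [y Ny eD] := coset_setP D; have [z Nz eE] := coset_setP E.
have sN := subgroup_gen N; have Nyz := normaliserM Ny Nz.
by rewrite eC eD eE !mul_lcoset // mulgA.
Qed.

Lemma quot_mul1 N : left_id (quot_one N) (@quot_mul N).
Proof.
move=> C; have [x Nx eC] := coset_setP C; apply: quot_inj => /=.
by rewrite eC mul_lcoset ?mul1g //; apply: subgroup_gen.
Qed.

Lemma quot_mulr1 N : right_id (quot_one N) (@quot_mul N).
Proof.
move=> C; have [x Nx eC] := coset_setP C; apply: quot_inj => /=.
rewrite eC mul_lcoset ?mulg1 //; first exact: subgroup_gen.
exact: normaliser1.
Qed.

Lemma quot_mulV N : left_inverse (quot_one N) (@quot_inv N) (@quot_mul N).
Proof.
move=> C; have [x Nx eC] := coset_setP C; apply: quot_inj => /=; have sN := subgroup_gen N.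
by rewrite eC inv_lcoset // mul_lcoset // mulVg.
Qed.

Lemma quot_mulrV N : right_inverse (quot_one N) (@quot_inv N) (@quot_mul N).
Proof.
move=> C; have [x Nx eC] := coset_setP C; apply: quot_inj => /=; have sN := subgroup_gen N.
by rewrite eC inv_lcoset // mul_lcoset ?mulgV //; apply: normaliserV.
Qed.

HB.instance Definition _ N := isGroup.Build (coset_type N)
  (@quot_mulA N) (@quot_mul1 N) (@quot_mulr1 N) (@quot_mulV N) (@quot_mulrV N).

(* The class x <<N>>, with the junk value 1 outside the normaliser. *)
Definition coset_class N x : coset_type N :=
  match pselect (normaliser (gen N) x) with
  | left Nx => Coset (ex_intro2 _ _ x Nx erefl)
  | right _ => 1
  end.

Definition quotient A N : set (coset_type N) :=
  coset_class N @` (A `&` normaliser (gen N)).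

End Quotients.

Arguments quotient {G} A N.
Arguments coset_class {G} N x.

(* The group of all bijections of T, with product a * b = a \o b. *)
Section Symmetric.
Variable T : Type.

Record sym := Sym { sym_fun :> T -> T; sym_bij : bijective sym_fun }.

HB.instance Definition _ := gen_eqMixin sym.
HB.instance Definition _ := gen_choiceMixin sym.

Lemma sym_inj (a b : sym) : a =1 b -> a = b.
Proof.
case: a b => [f bf] [g bg] /= /funext fg; case: _ / fg bg => bg.
by congr Sym; apply: Prop_irrelevance.
Qed.

Lemma sym_inv_ex (a : sym) : exists b : sym, cancel a b /\ cancel b a.
Proof. by case: a => f [g fK gK]; exists (Sym (Bijective gK fK)). Qed.

Definition sym_one : sym := Sym (Bijective (frefl id) (frefl id)).
Definition sym_mul (a b : sym) : sym := Sym (bij_comp (sym_bij a) (sym_bij b)).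
Definition sym_inv (a : sym) : sym := projT1 (cid (sym_inv_ex a)).

Lemma sym_mulA : associative sym_mul.
Proof. by move=> a b c; apply: sym_inj. Qed.
Lemma sym_mul1 : left_id sym_one sym_mul.
Proof. by move=> a; apply: sym_inj. Qed.
Lemma sym_mulr1 : right_id sym_one sym_mul.
Proof. by move=> a; apply: sym_inj. Qed.
Lemma sym_mulV : left_inverse sym_one sym_inv sym_mul.
Proof.
by move=> a; apply: sym_inj => x; rewrite /sym_inv; case: cid => b [aK bK] /=.
Qed.
Lemma sym_mulrV : right_inverse sym_one sym_inv sym_mul.
Proof.
by move=> a; apply: sym_inj => x; rewrite /sym_inv; case: cid => b [aK bK] /=.
Qed.

HB.instance Definition _ :=
  isGroup.Build sym sym_mulA sym_mul1 sym_mulr1 sym_mulV sym_mulrV.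

End Symmetric.

(* (Z/p^oo)^r, the group Z/p^oo being realised as the union over n of the
   groups of p^n-th roots of unity; the group law is the product of algC. *)
Definition prufer_pow (p r : nat) : set ('I_r -> algC) :=
  [set v | forall i, exists n, ((p ^ n)%N.-unity_root (v i))%R].

Section DiscretePToral.
Variable S : groupType.
Implicit Types (P Q T : set S).

Definition is_torus (p r : nat) T : Prop :=
  subgroup T /\
  exists2 f : S -> 'I_r -> algC, set_bij T (prufer_pow p (r := r)) f &
    forall x y, T x -> T y -> forall i, f (x * y) i = (f x i * f y i)%R.

(* The pair (r, m) is |P|, i.e. P has a normal subgroup T isomorphic to
   (Z/p^oo)^r such that |P/T| = m is a power of p. *)
Definition ptoral_order (p : nat) P (rm : nat * nat) : Prop :=
  exists T, [/\ normal_in T P, is_torus p rm.1 T, has_index P T rm.2 &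
                exists k, rm.2 = (p ^ k)%N].

Definition discrete_p_toral (p : nat) P : Prop :=
  subgroup P /\ exists rm, ptoral_order p P rm.

Definition pt_order (p : nat) P : nat * nat :=
  xget (0%N, 0%N) [set rm | ptoral_order p P rm].

Definition order_le (p : nat) P Q : Prop :=
  (pt_order p P <= pt_order p Q :> (nat *l nat)%type)%O.

End DiscretePToral.

(* A morphism from P to Q is represented by a function on S whose values
   outside P are irrelevant: two functions that agree on P are the same
   morphism, every set of morphisms is closed under agreement on P, and the
   restriction to a subgroup of P is given by the same function.
   The sets of morphisms are empty unless P and Q are subgroups of S. *)
Definition homsets (S : groupType) := set S -> set S -> set (S -> S).

Section Fusion.
Variable S : groupType.
Implicit Types (P Q R : set S) (f g : S -> S) (F E : homsets S).

Definition agree P f g : Prop := forall x, P x -> f x = g x.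

Definition hom : homsets S := fun P Q => [set f |
  [/\ subgroup P, subgroup Q, set_fun P Q f &
      forall x y, P x -> P y -> f (x * y) = f x * f y]].

Definition inj_hom : homsets S := fun P Q => [set f |
  hom P Q f /\ forall x y, P x -> P y -> f x = f y -> x = y].

Definition homS : homsets S := fun P Q => [set f |
  [/\ subgroup P, subgroup Q &
      exists2 s, set_fun P Q (cj s) & agree P f (cj s)]].

Definition iso F : homsets S := fun P Q => [set f | F P Q f /\
  exists2 g, F Q P g & agree P (g \o f) id /\ agree Q (f \o g) id].

Record fusion_system F : Prop := FusionSystem {
  fusion_inj : forall P Q, F P Q `<=` inj_hom P Q;
  fusion_agree : forall P Q f g, agree P f g -> F P Q f -> F P Q g;
  fusion_comp : forall P Q R f g, F P Q f -> F Q R g -> F P R (g \o f);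
  fusion_homS : forall P Q, homS P Q `<=` F P Q;
  fusion_factor : forall P Q f, F P Q f -> exists2 R, R `<=` Q & iso F P R f }.

Definition subsystem E F : Prop := forall P Q, E P Q `<=` F P Q.

(* The smallest fusion system over S containing the morphisms in E; it exists
   whenever E only consists of injective homomorphisms between subgroups. *)
Definition fusion_gen E : homsets S := fun P Q =>
  \bigcap_(F in [set F | fusion_system F /\ subsystem E F]) F P Q.

Definition isoclass F P : set (set S) := [set Q | exists f, iso F P Q f].

(* Automorphisms of P are extended by the identity outside P, so that all the
   groups Aut_F(P) are subgroups of the symmetric group of S. *)
Definition Aut F P : set (sym S) :=
  [set a : sym S | agree (~` P) a id /\ iso F P P a].

Definition Inn P : set (sym S) :=
  [set a : sym S | agree (~` P) a id /\ exists2 s, P s & agree P a (cj s)].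

Definition Out F P : set (coset_type (Inn P)) := quotient (Aut F P) (Inn P).
Arguments Out F P : clear implicits.

Definition fully_centralized (p : nat) F P : Prop :=
  forall Q, isoclass F P Q -> order_le p (centraliser Q) (centraliser P).

Definition fully_normalized (p : nat) F P : Prop :=
  forall Q, isoclass F P Q -> order_le p (normaliser Q) (normaliser P).

(* N_f = {s in N_S(P) | f c_s f^-1 in Aut_S(f(P))} *)
Definition extender P f : set S := [set s | normaliser P s /\
  exists2 a : sym S, Aut homS (f @` P) a & agree P (a \o f) (f \o cj s)].

Record saturated (p : nat) F : Prop := Saturated {
  saturated_fusion : fusion_system F;
  saturated_sylow : forall P, subgroup P -> fully_normalized p F P ->
    [/\ fully_centralized p F P, finite_set (Out F P) &
        Sylow p (Out F P) (Out homS P)];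
  saturated_extend : forall P f, F P [set: S] f ->
    fully_centralized p F (f @` P) ->
    exists2 g, F (extender P f) [set: S] g & agree P g f;
  saturated_union : forall (P_ : nat -> set S) f,
    (forall n, subgroup (P_ n)) -> (forall n, P_ n `<=` P_ n.+1) ->
    hom (\bigcup_n P_ n) [set: S] f -> (forall n, F (P_ n) [set: S] f) ->
    F (\bigcup_n P_ n) [set: S] f }.

Definition centric F P : Prop :=
  subgroup P /\ forall Q, isoclass F P Q -> centraliser Q = center Q.

End Fusion.

Arguments Out {S} F P.

Section Linking.
Variables (S : groupType) (F : homsets S).

Record centric_subgroup := CentricSubgroup {
  centric_set :> set S;
  centric_setP : centric F centric_set }.

Implicit Types (P Q R U : centric_subgroup) (x y z : S).

(* The functor pi : L -> F^c is the identity on objects, hence lpi only gives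
   its action on morphisms; delta P is only meaningful on P, where it takes
   its values in the invertible endomorphisms by deltaM and delta1. *)
Record linking_system := LinkingSystem {
  mor : centric_subgroup -> centric_subgroup -> Type;
  idm : forall P, mor P P;
  compm : forall {P Q R}, mor Q R -> mor P Q -> mor P R;
  lpi : forall {P Q}, mor P Q -> S -> S;
  delta : forall P, S -> mor P P;
  comp1m : forall P Q (f : mor P Q), compm (idm Q) f = f;
  compm1 : forall P Q (f : mor P Q), compm f (idm P) = f;
  compmA : forall P Q R U (f : mor P Q) (g : mor Q R) (h : mor R U),
    compm h (compm g f) = compm (compm h g) f;
  lpi_hom : forall P Q (f : mor P Q), F P Q (lpi f);
  lpi_id : forall P, agree P (lpi (idm P)) id;
  lpi_comp : forall P Q R (f : mor P Q) (g : mor Q R),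
    agree P (lpi (compm g f)) (lpi g \o lpi f);
  delta1 : forall P, delta P 1 = idm P;
  deltaM : forall P x y, centric_set P x -> centric_set P y ->
    delta P (x * y) = compm (delta P x) (delta P y);
  delta_inj : forall P x y, centric_set P x -> centric_set P y ->
    delta P x = delta P y -> x = y;
  center_free : forall P Q (f : mor P Q) z, center P z ->
    compm f (delta P z) = f -> z = 1;
  lpi_surj : forall P Q (f : S -> S), F P Q f ->
    exists f' : mor P Q, agree P (lpi f') f;
  lpi_center : forall P Q (f g : mor P Q),
    agree P (lpi f) (lpi g) <-> exists2 z, center P z & g = compm f (delta P z);
  lpi_delta : forall P x, centric_set P x -> agree P (lpi (delta P x)) (cj x);
  comp_delta : forall P Q (f : mor P Q) x, centric_set P x ->
    compm f (delta P x) = compm (delta Q (lpi f x)) f }.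

Definition p_local_compact_group (p : nat) (L : linking_system) : Prop :=
  discrete_p_toral p [set: S] /\ saturated p F.

End Linking.

Section IndexPrimeToP.
Variables (p : nat) (S : groupType) (F : homsets S).
Implicit Types (P Q R : set S) (f g : S -> S) (E : homsets S).

Definition index_prime_to_p E : Prop :=
  [/\ saturated p E, subsystem E F &
      forall P, subgroup P -> Opprime p (Aut F P) `<=` Aut E P].

(* O^{p'}_*(F) *)
Definition Opstar : homsets S :=
  fusion_gen (fun P Q => [set f : S -> S | [/\ subgroup P, Q = P &
    exists2 a : sym S, Opprime p (Aut F P) a & f = a :> (S -> S)]]).

(* Out^0_F(S) *)
Definition Out0 : set (coset_type (Inn [set: S])) :=
  gen [set coset_class (Inn [set: S]) a | a in [set a : sym S |
    Aut F [set: S] a /\ exists2 P, centric F P & Opstar P [set: S] a]].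

(* Gamma_{p'}(F), identified with Out_F(S) / Out^0_F(S); as Out^0_F(S) is
   normal in Out_F(S), quotient and coset_class take no junk value here. *)
Definition Gamma : set (coset_type Out0) := quotient (Out F [set: S]) Out0.

(* th P Q f is the image of f in Mor_{F^c}(P, Q), irrelevant for other triples;
   composition in B(Gamma) is the product of Gamma. *)
Record theta_hat (th : set S -> set S -> (S -> S) -> coset_type Out0) : Prop :=
  ThetaHat {
  theta_Gamma : forall P Q f, centric F P -> centric F Q -> F P Q f ->
    Gamma (th P Q f);
  theta_agree : forall P Q f g, centric F P -> centric F Q -> F P Q f ->
    agree P f g -> th P Q f = th P Q g;
  theta_id : forall P, centric F P -> th P P id = 1;
  theta_comp : forall P Q R f g, centric F P -> centric F Q -> centric F R ->
    F P Q f -> F Q R g -> th P R (g \o f) = th Q R g * th P Q f;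
  theta_Aut : forall a : sym S, Aut F [set: S] a ->
    th [set: S] [set: S] a = coset_class Out0 (coset_class (Inn [set: S]) a);
  theta_Opstar : forall P Q f, centric F P -> centric F Q -> Opstar P Q f ->
    th P Q f = 1 }.

Definition fusion_of (th : set S -> set S -> (S -> S) -> coset_type Out0)
    (H : set (coset_type Out0)) : homsets S :=
  fusion_gen (fun P Q => [set f |
    [/\ centric F P, centric F Q, F P Q f & H (th P Q f)]]).

End IndexPrimeToP.

Arguments Gamma p {S} F.

(* Main.v *)
(** The functor theta is only defined on morphisms between centric subgroups.  By
    Alperin's fusion theorem every morphism of F is a composite [a \o k] with [a] in
    Aut_F(S) and [k] in the fusion system [E1] generated by the centric morphisms of
    class 1, and it is said to be labelled by c when [a] can be chosen of class c.
    Labels restrict, compose and invert, they are unique and equal to theta on centric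
    subgroups, and F_H consists of the morphisms that have a label in H.

    The main point in the saturation of F_H is that a morphism f: Q -> S with f(Q) fully
    centralized extends to N_f with the same label.  This goes by induction on an
    F-invariant natural number that drops from Q to every larger subgroup not contained
    in the closure [bullet Q], to which all morphisms from Q extend uniquely.  For P
    fully normalized and not centric, the labels of the automorphisms of P C_S(P) that
    are trivial on P form a group K.  By induction K contains every label of a morphism
    M -> S that is trivial on P, where P < M <= N_S(P); hence every labelled isomorphism
    in the class of P is realised on P C_S(P) with its label, and the label of an
    arbitrary extension to N_f can be corrected by an element of K.  A Frattini argument
    realises this element on N_S(f(Q)).  Axiom (III) holds because the union of an
    increasing sequence P_n is contained in [bullet P_n] for some n.

    Conversely let E have index prime to p.  Then E contains O^{p'}_*(F), and an
    a in Aut_F(S) that restricts to a morphism of E on a centric subgroup Q is in E: an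
    extension of a|_Q to N_S(Q) in E differs from a by an automorphism trivial on Q, which
    has p-power order and thus lies in O^{p'}.  So E contains every a with theta(a) = 1,
    and is F_H for H = theta(Aut_E(S)). *)
From HB Require Import structures.
From mathcomp Require Import all_boot all_order all_fingroup cyclic pgroup nilpotent sylow.
From mathcomp Require Import algC ssralg ssrnum poly zify.
From mathcomp Require Import boolp classical_sets functions cardinality.
Require Import Defs.

Set Implicit Arguments.
Unset Strict Implicit.
Unset Printing Implicit Defensive.

Local Open Scope classical_set_scope.
Local Open Scope card_scope.
Local Open Scope group_scope.

(** * Subgroups and indices prime to p *)

(** Three obstacles shape the proof. Subgroups of S are infinite and so may be Aut_F(P): there are
    neither orders to induct on nor Sylow subgroups to conjugate. Sylow's theorem is used for
    subgroups of finite index prime to p, through the action on cosets, and the order of a subgroup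
    is replaced by a measure attached to its closure. The axioms do not provide fully normalized
    conjugates. They exist because morphisms on P fall into finitely many classes up to conjugacy in
    S: up to finitely many choices a morphism is determined on a divisible subgroup of finite index,
    where only the finite group Aut_F(T) acts, and the rest is controlled by averaging a cocycle.
    Off the centric subgroups a label is not a function of the morphism, and K measures the
    ambiguity. Axiom (II) for F yields an extension of unknown label, while F_H needs the given one.
    Corrections come from Frattini arguments: elements of the normal closure of Aut_S(P) have label
    1, because the label of the conjugating element cancels, and the other factor conjugates
    Aut_S(P) into itself and therefore extends. *)

Section GroupBasics.
Variable G : groupType.
Implicit Types (A B C D H N : set G) (x y z : G).

Lemma cjE x y : cj x y = x * y * x^-1. Proof. by []. Qed.

Lemma cjMr x y z : cj x (y * z) = cj x y * cj x z.
Proof. by rewrite /cj !mulgA mulgVK. Qed.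

Lemma cj1g y : cj 1 y = y.
Proof. by rewrite /cj mul1g invg1 mulg1. Qed.

Lemma cjg1 x : cj x 1 = 1.
Proof. by rewrite /cj mulg1 mulgV. Qed.

Lemma cjK x : cancel (cj x) (cj x^-1).
Proof. by move=> y; rewrite -cjM mulVg cj1g. Qed.

Lemma cjKV x : cancel (cj x^-1) (cj x).
Proof. by move=> y; rewrite -cjM mulgV cj1g. Qed.

Lemma cj_inj x : injective (cj x).
Proof. exact: can_inj (cjK x). Qed.

Lemma cjV x y : cj x y^-1 = (cj x y)^-1.
Proof. by rewrite /cj !invgM invgK mulgA. Qed.

Lemma subgroupX H x n : subgroup H -> H x -> H (x ^+ n).
Proof.
move=> sH Hx; elim: n => [|n IH]; first exact: subgroup1.
by rewrite expgS; apply: subgroupM.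
Qed.

Lemma mk_subgroup H : H 1 -> (forall x y, H x -> H y -> H (x * y)) ->
  (forall x, H x -> H x^-1) -> subgroup H.
Proof.
move=> H1 HM HV; split; first by rewrite inE.
by move=> x y; rewrite !inE => Hx Hy; apply: HM => //; apply: HV.
Qed.

Lemma subgroupT : subgroup [set: G].
Proof. exact: mk_subgroup. Qed.

Lemma subgroupI H N : subgroup H -> subgroup N -> subgroup (H `&` N).
Proof.
move=> sH sN; apply: mk_subgroup.
- by split; apply: subgroup1.
- by move=> x y [Hx Nx] [Hy Ny]; split; apply: subgroupM.
- by move=> x [Hx Nx]; split; apply: subgroupV.
Qed.

Lemma subgroup_set1 : subgroup [set (1 : G)].
Proof.
by apply: mk_subgroup => //= [_ _ -> ->|_ ->]; rewrite ?mulg1 ?invg1.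
Qed.

Lemma subgroup_divl H x y : subgroup H -> H x -> H (x * y) -> H y.
Proof.
move=> sH Hx Hxy; rewrite -(mulKg x y); apply: (subgroupM sH) => //.
exact: subgroupV.
Qed.

Lemma subgroupVE H x : subgroup H -> H x^-1 -> H x.
Proof. by move=> sH /(subgroupV sH); rewrite invgK. Qed.

Lemma subgroup_cj H x y : subgroup H -> H x -> H y -> H (cj x y).
Proof.
move=> sH Hx Hy; rewrite /cj; apply: (subgroupM sH); first exact: subgroupM.
exact: subgroupV.
Qed.

Lemma normaliserP H x :
  normaliser H x <-> (forall y, H y -> H (cj x y)) /\ (forall y, H y -> H (cj x^-1 y)).
Proof.
split=> [Nx|[h1 h2]].
  split=> y Hy; first by rewrite -Nx; exists y.
  by rewrite -(normaliserV Nx); exists y.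
apply/seteqP; split=> [_ [y Hy <-]|y Hy]; first exact: h1.
by exists (cj x^-1 y); [exact: h2 | rewrite cjKV].
Qed.

Lemma normaliser_cj H x y : normaliser H x -> H y -> H (cj x y).
Proof. by move=> /normaliserP[h _]; apply: h. Qed.

Lemma subgroup_normaliser H : subgroup (normaliser H).
Proof.
apply: mk_subgroup; first exact: normaliser1.
- exact: normaliserM.
- exact: normaliserV.
Qed.

Lemma sub_normaliser H : subgroup H -> H `<=` normaliser H.
Proof.
move=> sH x Hx; apply/normaliserP; split=> y Hy; apply: subgroup_cj => //.
exact: subgroupV.
Qed.

Lemma commute_cj x y : commute x y <-> cj x y = y.
Proof.
rewrite /commute /cj; split=> [->|h]; first by rewrite mulgK.
by rewrite -{2}h mulgVK.
Qed.

Lemma centraliserP H x : centraliser H x <-> forall y, H y -> cj x y = y.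
Proof.
by split=> h y Hy; [apply/commute_cj|apply/commute_cj]; apply: h.
Qed.

Lemma subgroup_centraliser H : subgroup (centraliser H).
Proof.
apply: mk_subgroup.
- by move=> y _; rewrite /commute mul1g mulg1.
- move=> x y hx hy z Hz; apply/commute_sym/commuteM; apply/commute_sym.
    exact: hx.
  exact: hy.
- move=> x hx z Hz; apply/commute_sym/commuteV/commute_sym; exact: hx.
Qed.

Lemma centraliser_normaliser H : centraliser H `<=` normaliser H.
Proof.
move=> x cx; have cV := subgroupV (subgroup_centraliser H) cx.
apply/normaliserP; split=> y Hy.
  by rewrite (centraliserP H x).1.
by rewrite (centraliserP H x^-1).1.
Qed.

Lemma centraliserS H N : H `<=` N -> centraliser N `<=` centraliser H.
Proof. by move=> HN x cx y Hy; apply/cx/HN. Qed.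

Lemma sub_gen H : H `<=` gen H.
Proof. by move=> x Hx N [sN]; apply. Qed.

Lemma gen_subset H N : subgroup N -> H `<=` N -> gen H `<=` N.
Proof. by move=> sN HN x; apply. Qed.

Lemma gen_id H : subgroup H -> gen H = H.
Proof.
by move=> sH; apply/seteqP; split; [apply: gen_subset|apply: sub_gen].
Qed.

Lemma lcoset_eq x y N : subgroup N -> lcoset x N = lcoset y N <-> N (x^-1 * y).
Proof.
move=> sN; split=> [e|h].
  have : lcoset x N y by rewrite e; exists 1; [exact: subgroup1|rewrite mulg1].
  by case=> z Nz <-; rewrite mulKg.
apply/seteqP; split=> [_ [z Nz <-]|_ [z Nz <-]].
  exists ((x^-1 * y)^-1 * z); last by rewrite invgM invgK !mulgA mulgV mul1g.
  by apply: subgroupM => //; apply: subgroupV.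
exists (x^-1 * y * z); last by rewrite !mulgA mulgV mul1g.
exact: subgroupM.
Qed.

Lemma subgroup_mul H N : subgroup H -> subgroup N -> H `<=` normaliser N ->
  subgroup (mul_set H N).
Proof.
move=> sH sN HN; apply: mk_subgroup.
- by exists 1; [exact: subgroup1|exists 1; [exact: subgroup1|rewrite mulg1]].
- move=> _ _ [x Hx [a Na <-]] [y Hy [b Nb <-]].
  exists (x * y); first exact: subgroupM.
  exists (cj y^-1 a * b).
    by apply: subgroupM => //; apply: normaliser_cj => //; apply/normaliserV/HN.
  by rewrite /cj invgK !mulgA mulgK.
- move=> _ [x Hx [a Na <-]]; exists x^-1; first exact: subgroupV.
  exists (cj x a^-1); last by rewrite /cj invgM !mulgA mulVg mul1g.
  by apply: normaliser_cj; [exact: HN|exact: subgroupV].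
Qed.

Lemma mul_setl H N : subgroup N -> H `<=` mul_set H N.
Proof.
by move=> sN x Hx; exists x => //; exists 1; [exact: subgroup1|rewrite mulg1].
Qed.

Lemma mul_setr H N : subgroup H -> N `<=` mul_set H N.
Proof.
by move=> sN x Hx; exists 1; [exact: subgroup1|exists x => //; rewrite mul1g].
Qed.

Lemma expg_mod_idx x n : x ^+ n = 1 -> forall m, x ^+ (m %% n) = x ^+ m.
Proof.
by move=> xn m; rewrite {2}(divn_eq m n) expgnDr mulnC expgnA xn expg1n mul1g.
Qed.

Lemma cjX x y n : cj x (y ^+ n) = cj x y ^+ n.
Proof. by elim: n => [|n IH]; rewrite ?cjg1 // !expgS cjMr IH. Qed.

End GroupBasics.

(** The substitute for containing a Sylow subgroup: [Aut F P] may be infinite, but for P fully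
    normalized Aut_S(P) has finite index prime to p in it. *)
Definition pidx (p : nat) (G : groupType) (A B : set G) : Prop :=
  exists2 n, has_index A B n & ~~ (p %| n)%N.

Definition ptorsion (p : nat) (G : groupType) (C : set G) : Prop :=
  forall x, C x -> exists k, x ^+ (p ^ k) = 1.

Section Cardinals.

Lemma card_IP (T : Type) (X : set T) n : X #= `I_n <->
  exists c : 'I_n -> T, [/\ forall i, X (c i), injective c &
    forall x, X x -> exists i, c i = x].
Proof.
split=> [/card_set_bijP [f [fX fI fS]]|[c [cX cI cS]]].
  have ex (i : 'I_n) : exists x, X x /\ f x = i.
    by have [x Xx <-] := fS i (ltn_ord i); exists x.
  have [c hc] := choice ex; exists c; split.
  - by move=> i; case: (hc i).
  - by move=> i j cij; apply/val_inj; rewrite /= -(hc i).2 -(hc j).2 cij.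
  - move=> x Xx; exists (Ordinal (fX x Xx)).
    by apply: fI; rewrite ?inE //; case: (hc (Ordinal (fX x Xx))).
apply: card_esym; apply: card_eq_trans (card_II) _.
have [f] : $|{bij [set: 'I_n] >-> X}|.
  by apply/bijPex; exists c; split=> [i _|i j _ _ /cI|x /cS[i <-]] //; exists i.
exact: pcard_eq f.
Qed.

End Cardinals.

(** * Coset actions and Sylow arguments for subgroups of index prime to p *)

Section Index.
Variable G : groupType.
Implicit Types (A B C D H N : set G) (x y z : G).

Lemma has_index_uniq A B m n : has_index A B m -> has_index A B n -> m = n.
Proof.
move=> h1 h2; apply/card_eq_II; apply: card_eq_trans h2.
by rewrite card_eq_sym.
Qed.

Lemma has_index_reps A B n : subgroup B -> has_index A B n <->
  exists c : 'I_n -> G, [/\ forall i, A (c i),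
    forall x, A x -> exists i, B ((c i)^-1 * x) &
    forall i j, B ((c i)^-1 * c j) -> i = j].
Proof.
move=> sB; rewrite /has_index card_IP; split=> [[c [cX cI cS]]|[c [cA cS cI]]].
  have ex (i : 'I_n) : exists x, A x /\ lcoset x B = c i.
    by have [x Ax <-] := cX i; exists x.
  have [d hd] := choice ex; exists d; split.
  - by move=> i; case: (hd i).
  - move=> x Ax; have [i ci] := cS (lcoset x B) (imageP _ Ax).
    by exists i; apply/lcoset_eq => //; rewrite (hd i).2.
  - by move=> i j /lcoset_eq -/(_ sB); rewrite (hd i).2 (hd j).2 => /cI.
exists (fun i => lcoset (c i) B); split.
- by move=> i; apply: imageP.
- by move=> i j /lcoset_eq -/(_ sB); apply: cI.
- move=> _ [x Ax <-]; have [i ci] := cS x Ax.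
  by exists i; apply/lcoset_eq.
Qed.

(** A homomorphism from a subgroup is a total function on G that is multiplicative on A, so images
    of different subgroups are taken under the same [r]. *)
Definition morphic (gT : finGroupType) A (r : G -> gT) : Prop :=
  forall x y, A x -> A y -> r (x * y) = r x * r y.

Definition gim (gT : finGroupType) (r : G -> gT) D : {set gT} :=
  [set s | `[< exists2 x, D x & r x = s >]]%SET.

Lemma gimP (gT : finGroupType) (r : G -> gT) D s :
  reflect (exists2 x, D x & r x = s) (s \in gim r D).
Proof. by rewrite inE; apply: asboolP. Qed.

Lemma mem_gim (gT : finGroupType) (r : G -> gT) D x : D x -> r x \in gim r D.
Proof. by move=> Dx; apply/gimP; exists x. Qed.

Lemma gimS (gT : finGroupType) (r : G -> gT) C D :
  C `<=` D -> gim r C \subset gim r D.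
Proof.
by move=> CD; apply/fintype.subsetP => _ /gimP[x /CD Dx <-]; apply: mem_gim.
Qed.

Section Morphic.
Variables (gT : finGroupType) (A : set G) (r : G -> gT).
Hypotheses (sA : subgroup A) (rM : morphic A r).

Lemma morphic1 : r 1 = 1.
Proof.
have A1 := subgroup1 sA; apply: (mulgI (r 1)).
by rewrite -rM // !mulg1.
Qed.

Lemma morphicV x : A x -> r x^-1 = (r x)^-1.
Proof.
move=> Ax; apply: (mulgI (r x)); rewrite -rM //; last exact: subgroupV.
by rewrite !mulgV morphic1.
Qed.

Lemma morphicX x n : A x -> r (x ^+ n) = r x ^+ n.
Proof.
move=> Ax; elim: n => [|n IH]; first exact: morphic1.
by rewrite !expgS rM ?IH //; apply: subgroupX.
Qed.

Lemma group_set_gim D : subgroup D -> D `<=` A -> group_set (gim r D).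
Proof.
move=> sD DA; apply/group_setP; split.
  by rewrite -morphic1; apply: mem_gim; apply: subgroup1.
move=> _ _ /gimP[x Dx <-] /gimP[y Dy <-].
by rewrite -rM; [apply: mem_gim; exact: subgroupM|exact: DA|exact: DA].
Qed.

Definition imgroup D (sD : subgroup D) (DA : D `<=` A) : {group gT} :=
  Group (group_set_gim sD DA).

Lemma gim_mem_ker C D x : subgroup C -> C `<=` A -> D `<=` A ->
  (forall x y, D x -> C y -> r x = r y -> C x) -> D x ->
  r x \in gim r C -> C x.
Proof. by move=> sC CA DA kr Dx /gimP[y Cy /esym]; apply: kr. Qed.

(** The last hypothesis says that C is a union of fibres of [r] inside D, that is, contains the
    kernel. Cosets of C in D then correspond to cosets of the images, and the index is read off in a
    finite group. *)
Lemma has_index_gim C D (sC : subgroup C) (sD : subgroup D) (CA : C `<=` A)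
    (DA : D `<=` A) : C `<=` D ->
  (forall x y, D x -> C y -> r x = r y -> C x) ->
  has_index D C #|imgroup sD DA : imgroup sC CA|.
Proof.
move=> CD kr; apply/has_index_reps => //.
rewrite -card_lcosets; set L := lcosets _ _.
have ex (i : 'I_#|L|) : exists x, D x /\ (r x *: gim r C)%g = enum_val i.
  have /lcosetsP[_ /gimP[x Dx <-] ->] := enum_valP i.
  by exists x.
have [c hc] := choice ex; exists c; split.
- by move=> i; case: (hc i).
- move=> x Dx.
  have Lx : (r x *: gim r C)%g \in L.
    by apply/lcosetsP; exists (r x) => //; apply: mem_gim.
  exists (enum_rank_in Lx (r x *: gim r C)%g).
  set i := enum_rank_in _ _.
  have e : (r (c i) *: gim r C)%g = (r x *: gim r C)%g.
    by rewrite (hc i).2 enum_rankK_in.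
  have Dci := (hc i).1.
  have Dc : D ((c i)^-1 * x) by apply: (subgroupM sD) => //; apply: (subgroupV sD).
  apply: (gim_mem_ker sC CA DA kr Dc).
  have Aci := DA _ Dci; have Ax := DA _ Dx.
  rewrite rM ?morphicV //; last exact: subgroupV.
  by rewrite -[gim r C]/(gval (imgroup sC CA)) -mem_lcoset /= e (lcoset_refl (imgroup sC CA)).
- move=> i j Cij; apply: enum_val_inj; rewrite -(hc i).2 -(hc j).2.
  have Ci := (hc i).1; have Cj := (hc j).1.
  apply/esym/(@lcoset_eqP _ (imgroup sC CA)).
  have Ai := DA _ Ci; have Aj := DA _ Cj; have AiV := subgroupV sA Ai.
  by rewrite mem_lcoset /= -morphicV // -rM //; apply: mem_gim.
Qed.
End Morphic.

(** Action of A on the cosets of B. The second property holds because B is the stabiliser of its own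
    coset; it is the kernel hypothesis of [has_index_gim]. *)
Lemma coset_action A B n : subgroup A -> subgroup B -> B `<=` A ->
  has_index A B n -> exists r : G -> {perm 'I_n},
    morphic A r /\ forall x y, A x -> B y -> r x = r y -> B x.
Proof.
move=> sA sB BA /(has_index_reps _ _ sB) [c [cA cS cI]].
have ex x : exists i : 'I_n, A x -> B ((c i)^-1 * x).
  case: (pselect (A x)) => [Ax|nAx].
    by have [i Bi] := cS x Ax; exists i.
  by have [i _] := cS 1 (subgroup1 sA); exists i => /nAx.
have [idx hidx] := choice ex.
(* The inverse makes [r] multiplicative, since permutations compose from left to right. *)
pose f g (i : 'I_n) := idx (g^-1 * c i).
have fB g i : A g -> B ((c (f g i))^-1 * (g^-1 * c i)).
  by move=> Ag; apply: hidx; apply: (subgroupM sA) => //; apply: subgroupV.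
have fI g : A g -> injective (f g).
  move=> Ag i j fij; apply: cI; have := fB g j Ag; rewrite -fij => Bj.
  have := subgroupM sB (subgroupV sB (fB g i Ag)) Bj.
  by rewrite !invgM !invgK !mulgA !(mulgK, mulgVK).
pose r g : {perm 'I_n} :=
  if pselect (injective (f g)) is left h then perm h else 1%g.
have rE g i : A g -> r g i = f g i.
  by move=> Ag; rewrite /r; case: pselect => [h|[]]; [rewrite permE|exact: fI].
have fP g i j : A g -> B ((c j)^-1 * (g^-1 * c i)) -> f g i = j.
  move=> Ag Bj; apply: cI; have := subgroupM sB (fB g i Ag) (subgroupV sB Bj).
  by rewrite !invgM !invgK !mulgA !(mulgK, mulgVK).
exists r; split=> [x y Ax Ay|x y Ax By].
  apply/permP => i; rewrite permM !rE //; last exact: subgroupM.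
  apply: fP; first exact: subgroupM.
  have := subgroupM sB (fB y (f x i) Ay) (fB x i Ax).
  by rewrite invgM !mulgA !(mulgK, mulgVK).
have Ay := BA y By; have [i Bi] := cS 1 (subgroup1 sA).
rewrite mulg1 in Bi; have Bci := subgroupVE sB Bi.
move=> /(congr1 (fun s : {perm 'I_n} => s i)); rewrite !rE //.
rewrite (fP y i i) // => [e|]; last first.
  by apply: (subgroupM sB) => //; apply: (subgroupM sB) => //; apply: subgroupV.
have := fB x i Ax; rewrite e => Bx.
have := subgroupM sB Bci (subgroupM sB Bx Bi).
by rewrite -!mulgA mulgV mulg1 mulVKg => /(subgroupVE sB).
Qed.

Variable p : nat.
Hypothesis p_pr : prime p.

Lemma pgroup_gim (gT : finGroupType) A (r : G -> gT) (sA : subgroup A)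
    (rM : morphic A r) C (sC : subgroup C) (CA : C `<=` A) :
  ptorsion p C -> p.-group (imgroup sA rM sC CA).
Proof.
move=> tC; apply/pgroupP => q q_pr /(Cauchy q_pr) [_ /gimP[x Cx <-] ox].
have [k xk] := tC x Cx.
have : (r x ^+ (p ^ k) = 1)%g by rewrite -(morphicX sA rM) ?xk ?(morphic1 sA) //; exact: CA.
move/eqP; rewrite -order_dvdn ox Euclid_dvdX // dvdn_prime2 //.
by case/andP => /eqP-> _; rewrite inE.
Qed.

Lemma Sylow_pindex (gT : finGroupType) (A B : {group gT}) : B \subset A ->
  ~~ (p %| #|A : B|)%N -> exists2 P : {group gT}, P \subset B & p.-Sylow(A) P.
Proof.
move=> BA pAB; have [P sP] := Sylow_exists p B.
exists P; first exact: pHall_sub sP.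
rewrite pHallE (fintype.subset_trans (pHall_sub sP) BA) /= (card_Hall sP) -(Lagrange BA).
by rewrite partnM // (part_p'nat (n := #|A : B|)) ?muln1 // p'natE.
Qed.

Section IndexIn.
Variables A B : set G.
Hypotheses (sA : subgroup A) (sB : subgroup B) (BA : B `<=` A).

(** Sylow's theorem in the finite image of the action on A/B: the image of B contains a Sylow
    subgroup, the image of C is a p-group, and B is the full preimage of its image in A. *)
Lemma pidx_conj C : pidx p A B -> subgroup C -> C `<=` A -> ptorsion p C ->
  exists2 x, A x & forall y, C y -> B (cj x y).
Proof.
move=> [n iAB pn] sC CA tC; have [r [rM kr]] := coset_action sA sB BA iAB.
pose Ar := imgroup sA rM sA (fun x h => h); pose Br := imgroup sA rM sB BA.
have BAr : Br \subset Ar by apply: gimS.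
have idx := has_index_gim (r := r) sA rM sB sA BA (fun x h => h) BA kr.
rewrite (has_index_uniq iAB idx) in pn.
have [P PB sP] := Sylow_pindex BAr pn.
pose Cr := imgroup sA rM sC CA.
have [_ /gimP[x Ax <-] xC] := Sylow_Jsub sP (gimS r CA : Cr \subset Ar) (pgroup_gim sA rM sC CA tC).
have AxV := subgroupV sA Ax; exists x^-1 => // y Cy.
have Ay := CA y Cy; have Axy : A (cj x^-1 y) by apply: subgroup_cj.
apply: (gim_mem_ker sB BA (fun x h => h) kr Axy).
rewrite /cj invgK !rM ?(morphicV sA) //; last exact: subgroupM.
apply: (fintype.subsetP PB); apply: (fintype.subsetP xC).
by rewrite -mulgA -conjgE memJ_conjg; apply: mem_gim.
Qed.

(** A Sylow subgroup Q of the image of C is conjugate into a Sylow subgroup of the image of A that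
    lies in the image of B. The elements of C that are conjugated into B therefore have an image
    containing Q. *)
Lemma pidx_meet C : pidx p A B -> subgroup C -> C `<=` A ->
  exists2 x, A x & pidx p C [set y | C y /\ B (cj x y)].
Proof.
move=> [n iAB pn] sC CA; have [r [rM kr]] := coset_action sA sB BA iAB.
pose Ar := imgroup sA rM sA (fun x h => h); pose Br := imgroup sA rM sB BA.
have BAr : Br \subset Ar by apply: gimS.
have idx := has_index_gim (r := r) sA rM sB sA BA (fun x h => h) BA kr.
rewrite (has_index_uniq iAB idx) in pn.
have [P PB sP] := Sylow_pindex BAr pn.
pose Cr := imgroup sA rM sC CA.
have [Q sQ] := Sylow_exists p Cr.
have CAr : Cr \subset Ar by apply: gimS.
have [_ /gimP[x Ax <-] xQ] := Sylow_Jsub sP (fintype.subset_trans (pHall_sub sQ) CAr) (pHall_pgroup sQ).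
have AxV := subgroupV sA Ax; exists x^-1 => //.
set D := [set y | _].
have sD : subgroup D.
  apply: mk_subgroup.
  - by split; [exact: subgroup1|rewrite cjg1; exact: subgroup1].
  - by move=> y z [Cy By] [Cz Bz]; split; [exact: subgroupM|rewrite cjMr; exact: subgroupM].
  - by move=> y [Cy By]; split; [exact: subgroupV|rewrite cjV; exact: subgroupV].
have DC : D `<=` C by move=> y [].
have DA : D `<=` A by move=> y /DC/CA.
have krD y z : C y -> D z -> r y = r z -> D y.
  move=> Cy [Cz Bz] e; split=> //; apply: (kr _ _ _ Bz).
    by apply: subgroup_cj => //; exact: (CA).
  have Ay := CA _ Cy; have Az := CA _ Cz.
  by rewrite /cj !rM ?e //; apply: subgroupM || apply: subgroupV.
have := has_index_gim (r := r) sA rM sD sC DA CA DC krD.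
set m := #|_ : _| => im; exists m => //.
have QD : Q \subset imgroup sA rM sD DA.
  apply/fintype.subsetP => q Qq.
  have /gimP[y Cy ry] := fintype.subsetP (pHall_sub sQ) q Qq.
  rewrite -ry; apply: mem_gim; split=> //.
  have Ay := CA y Cy; have Axy : A (cj x^-1 y) by apply: subgroup_cj.
  apply: (gim_mem_ker sB BA (fun x h => h) kr Axy).
  rewrite /cj invgK !rM ?(morphicV sA) //; last exact: subgroupM.
  apply: (fintype.subsetP PB); apply: (fintype.subsetP xQ).
  by rewrite -mulgA -conjgE ry memJ_conjg.
have /and3P[_ _ pCQ] := sQ.
have := pnat_dvd (indexgS Cr QD) pCQ; rewrite p'natE //.
Qed.

Lemma has_index_cj a C D n : subgroup D -> has_index C D n ->
  has_index (cj a @` C) (cj a @` D) n.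
Proof.
move=> sD /(has_index_reps _ _ sD)[c [cC cS cI]].
have sD' : subgroup (cj a @` D).
  apply: mk_subgroup.
  - by exists 1; [exact: subgroup1|rewrite cjg1].
  - by move=> _ _ [x Dx <-] [y Dy <-]; exists (x * y); [exact: subgroupM|rewrite cjMr].
  - by move=> _ [x Dx <-]; exists x^-1; [exact: subgroupV|rewrite cjV].
apply/(has_index_reps _ _ sD'); exists (fun i => cj a (c i)); split.
- by move=> i; exists (c i).
- move=> _ [x Cx <-]; have [i Di] := cS x Cx; exists i.
  by exists ((c i)^-1 * x) => //; rewrite cjMr cjV.
- move=> i j [x Dx e]; apply: cI; suff <- : x = (c i)^-1 * c j by [].
  by apply: (@cj_inj _ a); rewrite e cjMr cjV.
Qed.

Lemma pidx_cj a C D : subgroup D -> pidx p C D -> pidx p (cj a @` C) (cj a @` D).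
Proof. by move=> sD [n iCD pn]; exists n => //; apply: has_index_cj. Qed.

Lemma pidx_trans C : subgroup C -> B `<=` C -> C `<=` A -> pidx p A B ->
  pidx p A C /\ pidx p C B.
Proof.
move=> sC BC CA [n iAB pn]; have [r [rM kr]] := coset_action sA sB BA iAB.
have AA : A `<=` A by [].
have idx := has_index_gim (r := r) sA rM sB sA BA AA BA kr.
rewrite (has_index_uniq iAB idx) in pn.
have krC x y : A x -> C y -> r x = r y -> C x.
  move=> Ax Cy e; have Ay := CA y Cy; have AyV := subgroupV sA Ay.
  have : B (y^-1 * x).
    apply: (kr _ 1 (subgroupM sA AyV Ax) (subgroup1 sB)).
    by rewrite rM // (morphicV sA) // e mulVg (morphic1 sA).
  by move=> /BC h; rewrite -(mulVKg y x); apply: subgroupM.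
have iAC := has_index_gim (r := r) sA rM sC sA CA AA CA krC.
have krB x y : C x -> B y -> r x = r y -> B x by move=> /CA; apply: kr.
have iCB := has_index_gim (r := r) sA rM sB sC BA CA BC krB.
split; [apply: (ex_intro2 _ _ _ iAC)|apply: (ex_intro2 _ _ _ iCB)]; apply: contra pn.
  move=> h; apply: dvdn_trans h _; apply: indexgS; exact: gimS.
by move=> h; apply: dvdn_trans h _; apply: indexSg; exact: gimS.
Qed.

End IndexIn.

Section NormalClosure.
Variables A B : set G.
Hypotheses (sA : subgroup A) (sB : subgroup B) (BA : B `<=` A).

Definition nclosure : set G := gen [set cj x b | x in A & b in B].

Lemma sub_nclosure : B `<=` nclosure.
Proof.
by move=> b Bb; apply: sub_gen; exists 1; [exact: subgroup1|exists b => //; rewrite cj1g].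
Qed.

Lemma nclosure_sub : nclosure `<=` A.
Proof.
by apply: gen_subset => // _ [x Ax [b /BA Ab <-]]; apply: subgroup_cj.
Qed.

Lemma subgroup_nclosure : subgroup nclosure.
Proof. exact: subgroup_gen. Qed.

Lemma nclosure_cj x y : A x -> nclosure y -> nclosure (cj x y).
Proof.
move=> Ax; pose N := [set z | nclosure (cj x z)].
suff : nclosure `<=` N by apply.
have sO := subgroup_nclosure.
apply: gen_subset => [|_ [z Az [b Bb <-]]].
  apply: mk_subgroup; rewrite /N /=.
  - by rewrite cjg1; apply: subgroup1 sO.
  - by move=> u v hu hv; rewrite cjMr; apply: (subgroupM sO).
  - by move=> u hu; rewrite cjV; apply: (subgroupV sO).
by apply: sub_gen; exists (x * z); [exact: subgroupM|exists b => //; rewrite cjM].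
Qed.

(** The Frattini argument: B and its conjugate by a lie in the normal closure of B, where B has
    index prime to p by [pidx_trans], so an element of the closure conjugates the second into the
    first. *)
Lemma frattini a : pidx p A B -> ptorsion p B -> A a ->
  exists u v, [/\ nclosure u, A v, a = u * v & forall b, B b -> B (cj v b)].
Proof.
move=> pAB tB Aa; have sO := subgroup_nclosure.
have [_ pOB] := pidx_trans sA sB BA sO sub_nclosure nclosure_sub pAB.
have sC : subgroup (cj a @` B).
  apply: mk_subgroup.
  - by exists 1; [exact: subgroup1|rewrite cjg1].
  - by move=> _ _ [x Bx <-] [y By <-]; exists (x * y); [exact: subgroupM|rewrite cjMr].
  - by move=> _ [x Bx <-]; exists x^-1; [exact: subgroupV|rewrite cjV].
have CO : cj a @` B `<=` nclosure.
  by move=> _ [b Bb <-]; apply: nclosure_cj => //; apply: sub_nclosure.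
have tC : ptorsion p (cj a @` B).
  by move=> _ [b /tB[k bk] <-]; exists k; rewrite -cjX bk cjg1.
have [x Ox xC] := pidx_conj sO sB sub_nclosure pOB sC CO tC.
exists x^-1, (x * a); split.
- exact: (subgroupV sO).
- by apply: (subgroupM sA) => //; apply: nclosure_sub.
- by rewrite mulKg.
- by move=> b Bb; rewrite cjM; apply: xC; exists b.
Qed.

End NormalClosure.

Lemma subgroup_powers x n : x ^+ n.+1 = 1 -> subgroup [set x ^+ i | i in [set: nat]].
Proof.
move=> xn; apply: mk_subgroup; first by exists 0%N.
- by move=> _ _ [i _ <-] [j _ <-]; exists (i + j)%N => //; rewrite expgnDr.
- move=> _ [i _ <-]; exists (n * i)%N => //; apply/esym/mulg1_eq.
  by rewrite -expgnDr -mulSn expgnA xn expg1n.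
Qed.

(** A normal subgroup of index prime to p contains a conjugate of the cyclic group generated by x,
    hence x itself. *)
Lemma Opprime_ptorsion A x k : subgroup A -> A x -> x ^+ (p ^ k) = 1 -> Opprime p A x.
Proof.
move=> sA Ax xk N [[sN NA AN] [n iN pn]].
have pk : (p ^ k = (p ^ k).-1.+1)%N by rewrite prednK // expn_gt0 prime_gt0.
have sC : subgroup [set x ^+ i | i in [set: nat]].
  by apply: (@subgroup_powers _ (p ^ k).-1); rewrite -pk.
have [y Ay yC] : exists2 y, A y & forall z, [set x ^+ i | i in [set: nat]] z -> N (cj y z).
  apply: (pidx_conj sA sN NA _ sC); first by exists n.
  - by move=> _ [i _ <-]; apply: subgroupX.
  - by move=> _ [i _ <-]; exists k; rewrite -expgnA mulnC expgnA xk expg1n.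
rewrite -(cjK y x); apply: normaliser_cj.
  exact: subgroupV (@subgroup_normaliser _ N) (AN _ Ay).
by apply: yC; exists 1%N.
Qed.

End Index.

(** * From Sylow subgroups of a quotient to indices *)

Section QuotientIndex.
Variables (G : groupType) (p : nat) (N : set G).
Hypotheses (p_pr : prime p) (sN : subgroup N).
Implicit Types (A B C D : set G) (x y : G).

Lemma coset_classE x : normaliser N x ->
  coset_set (coset_class N x) = lcoset x N.
Proof.
move=> Nx; rewrite /coset_class; case: pselect => [?|n] /=; first by rewrite gen_id.
by case: n; rewrite gen_id.
Qed.

Lemma coset_class_eq x y : normaliser N x -> normaliser N y ->
  coset_class N x = coset_class N y <-> N (x^-1 * y).
Proof.
move=> Nx Ny; rewrite -lcoset_eq // -!coset_classE //.
by split=> [->|/quot_inj].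
Qed.

Lemma coset_classM x y : normaliser N x -> normaliser N y ->
  coset_class N (x * y) = coset_class N x * coset_class N y.
Proof.
move=> Nx Ny; apply: quot_inj; rewrite coset_classE; last exact: normaliserM.
by rewrite /= !coset_classE // mul_lcoset.
Qed.

Lemma coset_class1 : coset_class N 1 = 1.
Proof.
apply: quot_inj; rewrite coset_classE; last exact: normaliser1.
by rewrite /= gen_id.
Qed.

Lemma coset_classV x : normaliser N x -> coset_class N x^-1 = (coset_class N x)^-1.
Proof.
move=> Nx; apply/esym/mulg1_eq; rewrite -coset_classM ?mulgV ?coset_class1 //.
exact: normaliserV.
Qed.

Lemma quotientE A : A `<=` normaliser N -> quotient A N = coset_class N @` A.
Proof.
by move=> AN; rewrite /quotient (gen_id sN) (setIidl AN).
Qed.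

Lemma subgroup_quotient A : subgroup A -> A `<=` normaliser N ->
  subgroup (quotient A N).
Proof.
move=> sA AN; rewrite quotientE //; apply: mk_subgroup.
- by exists 1; [exact: subgroup1|exact: coset_class1].
- move=> _ _ [x Ax <-] [y Ay <-]; exists (x * y); first exact: subgroupM.
  by rewrite coset_classM //; exact: AN.
- move=> _ [x Ax <-]; exists x^-1; first exact: subgroupV.
  by rewrite coset_classV //; exact: AN.
Qed.

Lemma quotient_index A n : A `<=` normaliser N ->
  quotient A N #= `I_n <-> has_index A N n.
Proof.
move=> AN; rewrite /has_index quotientE //.
have -> : [set lcoset x N | x in A] = (@coset_set _ N) @` (coset_class N @` A).
  apply/seteqP; split=> [_ [x Ax <-]|_ [_ [x Ax <-] <-]].
    by exists (coset_class N x); [exists x|rewrite coset_classE //; exact: AN].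
  by exists x => //; rewrite coset_classE //; exact: AN.
have e : (@coset_set _ N) @` (coset_class N @` A) #= coset_class N @` A.
  by apply: inj_card_eq => ? ? _ _; apply: quot_inj.
by split; [move=> h; apply: card_eq_trans e h|apply: card_eq_trans; apply: card_esym].
Qed.

(** Turns the Sylow condition of axiom (I), which concerns Out, into an index in Aut, and passes it
    to an intermediate group. In the applications N is [Inn P], B is Aut_S(P), and C is the
    automorphism group of P in F or in a subsystem. *)
Lemma Sylow_quotient A B C : subgroup A -> subgroup B -> subgroup C ->
  N `<=` B -> B `<=` C -> C `<=` A -> A `<=` normaliser N ->
  Sylow p (quotient A N) (quotient B N) ->
  pidx p A B /\ Sylow p (quotient C N) (quotient B N).
Proof.
move=> sA sB sC NB BC CA AN [_ _ [k [m [kB mA pm]]]].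
have BA : B `<=` A by move=> x /BC/CA.
have BN : B `<=` normaliser N by move=> x /BA/AN.
have CN : C `<=` normaliser N by move=> x /CA/AN.
have NA : N `<=` A by move=> x /NB/BA.
have NC : N `<=` C by move=> x /NB/BC.
have AA : A `<=` A by [].
move/(quotient_index _ BN) in kB; move/(quotient_index _ AN) in mA.
have [r [rM kr]] := coset_action sA sN NA mA.
have iA := has_index_gim (r := r) sA rM sN sA NA AA NA kr.
have iB := has_index_gim (r := r) sA rM sN sB NA BA NB (fun x y h => kr x y (BA _ h)).
have iC := has_index_gim (r := r) sA rM sN sC NA CA NC (fun x y h => kr x y (CA _ h)).
have krB x y : A x -> B y -> r x = r y -> B x.
  move=> Ax By e; have Ay := BA y By; have AyV := subgroupV sA Ay.
  have : N (y^-1 * x).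
    apply: (kr _ 1 (subgroupM sA AyV Ax) (subgroup1 sN)).
    by rewrite rM // (morphicV sA) // e mulVg (morphic1 sA).
  by move=> /NB h; rewrite -(mulVKg y x); apply: subgroupM.
have iAB := has_index_gim (r := r) sA rM sB sA BA AA BA krB.
set Ar := imgroup sA rM sA AA in iA iAB *.
set Br := imgroup sA rM sB BA in iB iAB *.
set Cr := imgroup sA rM sC CA in iC *; set Nr := imgroup sA rM sN NA in iA iB iC *.
have NBr : Nr \subset Br by apply: gimS.
have BCr : Br \subset Cr by apply: gimS.
have CAr : Cr \subset Ar by apply: gimS.
have eB := has_index_uniq kB iB; have eA := has_index_uniq mA iA.
have pk0 : (0 < p ^ k)%N by rewrite expn_gt0 prime_gt0.
have eAB : #|Ar : Br| = m.
  apply/eqP; rewrite -(eqn_pmul2r pk0); apply/eqP.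
  transitivity (#|Ar : Br| * #|Br : Nr|)%N; first by rewrite -eB.
  rewrite Lagrange_index -?eA 1?mulnC //; exact: fintype.subset_trans CAr.
have eCB : (#|Cr : Br| * p ^ k = #|Cr : Nr|)%N.
  by transitivity (#|Cr : Br| * #|Br : Nr|)%N; [rewrite -eB|rewrite Lagrange_index].
rewrite -eAB in pm; split; first by exists #|Ar : Br|.
split; first exact: subgroup_quotient.
  by rewrite !quotientE //; apply: image_subset.
exists k, #|Cr : Br|; split.
- exact/quotient_index.
- by apply/quotient_index => //; rewrite mulnC eCB.
- by apply: contra pm => h; apply: dvdn_trans h _; apply: indexSg.
Qed.

End QuotientIndex.

(** * Discrete p-toral groups *)

Section Finiteness.

Lemma finite_bound (U : Type) (R : set U) (k : U -> nat) : finite_set R ->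
  exists K, forall r, R r -> (k r <= K)%N.
Proof.
move=> /finite_setP[n /card_IP[c [_ _ cS]]].
exists (\max_i k (c i)) => r /cS[i <-]; exact: (leq_bigmax i).
Qed.

Lemma finite_fun (I : finType) (U : Type) (R : set U) : finite_set R ->
  finite_set [set v : I -> U | forall i, R (v i)].
Proof.
move=> /finite_setP[n /card_IP[c [_ _ cS]]].
apply: (@sub_finite_set _ _ ((fun (k : {ffun I -> 'I_n}) i => c (k i)) @` setT)).
  move=> v Rv; have [k hk] := choice (fun i => cS _ (Rv i)).
  by exists (finfun k) => //; apply: funext => i; rewrite ffunE.
exact/finite_image/finite_finset.
Qed.

Lemma finite_inj_surj (U : Type) (R : set U) (f : U -> U) : finite_set R ->
  (forall x, R x -> R (f x)) -> (forall x y, R x -> R y -> f x = f y -> x = y) ->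
  forall y, R y -> exists2 x, R x & f x = y.
Proof.
move=> /finite_setP[n /card_IP[c [cR cI cS]]] fR fI.
have [g hg] := choice (fun i => cS _ (fR _ (cR i))).
have gI : injective g.
  by move=> i j gij; apply: cI; apply: fI => //; rewrite -!hg gij.
move=> y /cS[j <-]; exists (c (invF gI j)) => //.
by rewrite -hg f_invF.
Qed.

End Finiteness.

Lemma exp_cardG_index (gT : finGroupType) (G N : {group gT}) x : (N <| G)%g ->
  x \in G -> (x ^+ #|G : N| \in N)%g.
Proof.
move=> nNG Gx; have Nx := fintype.subsetP (normal_norm nNG) x Gx.
apply: coset_idr; first exact: groupX.
by rewrite morphX // -card_quotient ?normal_norm // expg_cardG // mem_quotient.
Qed.

(* The properties of the maximal torus T of S that are used, where q = |S/T|. *)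
Record toral (p : nat) (S : groupType) (T : set S) (q : nat) : Prop := Toral {
  toral_sub : subgroup T;
  toral_comm : forall x y, T x -> T y -> commute x y;
  toral_cj : forall s x, T x -> T (cj s x);
  toral_exp : forall s, T (s ^+ q);
  toral_q : (0 < q)%N;
  toral_div : forall x n, T x -> (0 < n)%N -> exists2 y, T y & y ^+ n = x;
  toral_fin : forall n, (0 < n)%N -> finite_set [set x : S | T x /\ x ^+ n = 1];
  toral_p : forall s : S, exists k, s ^+ (p ^ k) = 1;
  toral_index : has_index [set: S] T q }.

Section Divisible.
Variables (p : nat) (S : groupType).
Hypothesis p_pr : prime p.
Implicit Types (D : set S) (x y : S).

Lemma expg_mod1 x k m : x ^+ (p ^ k) = 1 -> m = 1 %[mod p ^ k] -> x ^+ m = x.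
Proof.
move=> xk mk; rewrite -(expg_mod_idx xk m) mk.
by rewrite (expg_mod_idx xk 1).
Qed.

(** The part of n prime to p acts invertibly on elements of p-power order, so only the p-part
    requires roots. *)
Lemma pdivisible_divisible D : subgroup D ->
  (forall x, D x -> exists2 y, D y & y ^+ p = x) ->
  (forall x, D x -> exists k, x ^+ (p ^ k) = 1) ->
  forall x n, D x -> (0 < n)%N -> exists2 y, D y & y ^+ n = x.
Proof.
move=> sD Dp Dt x n Dx n0.
have Dpk k : exists2 y, D y & y ^+ (p ^ k) = x.
  elim: k => [|k [y Dy yx]]; first by exists x.
  by have [z Dz zy] := Dp y Dy; exists z => //; rewrite expnS expgnA zy.
have [k xk] := Dt x Dx; have [y Dy yx] := Dpk (logn p n).
have m0 : (0 < n`_p^')%N by rewrite part_gt0.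
have co : coprime (n`_p^') (p ^ k).
  by rewrite coprimeXr // coprime_sym prime_coprime // -p'natE // part_pnat.
have [a b eab _] := egcdnP (p ^ k) m0.
exists (y ^+ a); first exact: subgroupX.
rewrite -expgnA -(partnC p n0) p_part mulnCA expgnA yx.
apply: (expg_mod1 xk); rewrite eab (eqP co) addnC.
by rewrite -modnDm modnMl addn0 modn_mod.
Qed.

End Divisible.

Section FromPToral.
Variables (p : nat) (S : groupType).
Hypothesis p_pr : prime p.

Lemma prufer_fin r n : (0 < n)%N ->
  finite_set [set v : 'I_r -> algC | forall i, (v i ^+ n = 1)%R].
Proof.
move=> n0.
have [s hs] := closed_field_poly_normal ('X^n - 1 : {poly algC})%R.
apply: (@finite_fun _ _ [set z : algC | (z ^+ n = 1)%R]); apply: (@sub_finite_set _ _ [set` s]); last exact: finite_seq.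
move=> z /= zn; have : root ('X^n - 1)%R z.
  by rewrite /root !poly.hornerE /= zn GRing.subrr.
rewrite hs poly.rootZ ?poly.root_prod_XsubC //.
by rewrite -poly.polyC1 poly.lead_coefXnsubC ?GRing.oner_eq0.
Qed.

Lemma torus_facts r (T : set S) : is_torus p r T ->
  [/\ forall x y, T x -> T y -> commute x y,
     forall x, T x -> exists2 y, T y & y ^+ p = x,
     forall n, (0 < n)%N -> finite_set [set x : S | T x /\ x ^+ n = 1] &
     forall x, T x -> exists k, x ^+ (p ^ k) = 1].
Proof.
move=> [sT [f [fT fI fS] fM]].
have f1 i : f 1 i = 1%R.
  have := fM 1 1 (subgroup1 sT) (subgroup1 sT) i; rewrite mulg1 => h.
  have [n] := fT 1 (subgroup1 sT) i.
  rewrite poly.unity_rootE => /eqP fn.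
  have nz : (f 1%g i != 0)%R.
    apply/negP => /eqP f0; move: fn; rewrite f0 GRing.expr0n.
    by rewrite expn_eq0 -leqn0 leqNgt prime_gt0 //= => /eqP; rewrite eq_sym GRing.oner_eq0.
  by apply: (GRing.mulfI nz); rewrite -h GRing.mulr1.
have fX x n i : T x -> f (x ^+ n) i = (f x i ^+ n)%R.
  move=> Tx; elim: n => [|n IH]; first by rewrite f1 GRing.expr0.
  by rewrite expgS fM ?IH ?GRing.exprS //; apply: subgroupX.
have inj x y : T x -> T y -> (forall i, f x i = f y i) -> x = y.
  by move=> Tx Ty e; apply: fI; rewrite ?inE //; apply: funext.
have TV := subgroupV sT; have TM x y := @subgroupM _ T x y sT.
split.
- move=> x y Tx Ty; apply: inj; rewrite /=; try exact: TM.
  by move=> i; rewrite !fM // GRing.mulrC.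
- move=> x Tx; have fx := fT x Tx.
  have ex i : exists w : algC, (w ^+ p = f x i)%R.
    by exists (Num.Theory.nthroot p (f x i)); rewrite Num.Theory.rootCK ?prime_gt0.
  have [w hw] := choice ex.
  have [y Ty fy] : (f @` T) w.
    apply: fS => i; have [n] := fx i; rewrite poly.unity_rootE => /eqP xn.
    by exists n.+1; rewrite poly.unity_rootE expnS GRing.exprM hw xn.
  exists y => //; apply: inj => //; first exact: subgroupX.
  by move=> i; rewrite fX // fy hw.
- move=> n n0.
  have [g hg] : exists g : ('I_r -> algC) -> S, forall x, T x -> g (f x) = x.
    have ex v : exists x, forall y, T y -> f y = v -> x = y.
      case: (pselect (exists2 y, T y & f y = v)) => [[y Ty yv]|nv].
        by exists y => z Tz zv; apply: fI; rewrite ?inE // yv zv.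
      by exists 1 => y Ty yv; case: nv; exists y.
    by have [g hg] := choice ex; exists g => x Tx; apply: hg.
  apply: (@sub_finite_set _ _ (g @` [set v : 'I_r -> algC | forall i, (v i ^+ n = 1)%R])).
    move=> x [Tx xn]; exists (f x); last exact: hg.
    by move=> i; rewrite -fX // xn f1.
  exact/finite_image/prufer_fin.
- move=> x Tx; have ex i : exists n, (f x i ^+ (p ^ n) = 1)%R.
    by have [n] := fT x Tx i; rewrite poly.unity_rootE => /eqP; exists n.
  have [k hk] := choice ex; exists (\max_i k i).
  apply: inj; [exact: subgroupX|exact: subgroup1|move=> i].
  rewrite fX // f1 -(subnK (leq_bigmax i : (k i <= _)%N)) addnC expnD.
  by rewrite GRing.exprM hk GRing.expr1n.
Qed.

Lemma toral_of_discrete : discrete_p_toral p [set: S] ->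
  exists (T : set S) (q : nat), toral p T q.
Proof.
move=> [_ [[r m] [T [[sT _ nT] /= tT iT [k mk]]]]].
rewrite mk in iT; have [Tc Td Tf Tt] := torus_facts tT.
have Tcj s x : T x -> T (cj s x) by move=> Tx; apply: normaliser_cj => //; apply: nT.
have sS := @subgroupT S.
have [a [aM ka]] := coset_action sS sT (@subsetT _ T) iT.
have SS : [set: S] `<=` [set: S] by [].
have idx := has_index_gim (r := a) sS aM sT sS (@subsetT _ T) SS (@subsetT _ T) ka.
set A := imgroup sS aM sS SS in idx; set B := imgroup _ _ _ _ in idx.
have nBA : (B <| A)%g.
  apply/andP; split; first exact: gimS.
  apply/fintype.subsetP => _ /gimP[s _ <-]; rewrite inE.
  apply/fintype.subsetP => _ /imsetP[_ /gimP[x Tx <-] ->].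
  have -> : (a x ^ a s = a (cj s^-1 x))%g.
    by rewrite /cj invgK !aM // (morphicV sS) // conjgE mulgA.
  by apply: mem_gim; apply: Tcj.
(* The image of T is normal of index p^k in the finite image of S, so p^k-th powers map into it, and
   T is the full preimage of its image. *)
have Texp s : T (s ^+ (p ^ k)).
  rewrite (has_index_uniq iT idx).
  apply: (gim_mem_ker sT (@subsetT _ T) SS ka) => //.
  by rewrite (morphicX sS) //; apply: exp_cardG_index => //; apply: mem_gim.
exists T, (p ^ k)%N; split=> //.
- by rewrite expn_gt0 prime_gt0.
- exact: (pdivisible_divisible p_pr sT Td Tt).
- by move=> s; have [j sj] := Tt _ (Texp s); exists (k + j)%N; rewrite expnD expgnA.
Qed.

End FromPToral.

(** * Divisible parts, growth of normalisers and the co-Hopf property *)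

Section Toral.
Variables (p : nat) (S : groupType) (T : set S) (q : nat).
Hypotheses (p_pr : prime p) (tT : toral p T q).
Implicit Types (D I J P Q V Z : set S) (f : S -> S) (s t x y z : S).

Let sT := toral_sub tT.

Lemma p_gt0 k : (0 < p ^ k)%N. Proof. by rewrite expn_gt0 prime_gt0. Qed.

(** For a subgroup I of T, the largest divisible subgroup of I. The roots are only required to lie
    in I; [divpart_root] finds them in the divisible part. *)
Definition divpart I : set S :=
  [set t | I t /\ forall k, exists2 s, I s & s ^+ (p ^ k) = t].

Lemma divpart_sub I : divpart I `<=` I. Proof. by move=> t []. Qed.

Lemma divpartS I J : I `<=` J -> divpart I `<=` divpart J.
Proof.
move=> IJ t [It kt]; split=> [|k]; first exact: IJ.
by have [s /IJ Js st] := kt k; exists s.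
Qed.

Lemma subgroup_divpart I : subgroup I -> I `<=` T -> subgroup (divpart I).
Proof.
move=> sI IT; apply: mk_subgroup.
- by split=> [|k]; [|exists 1; rewrite ?expg1n //]; apply: subgroup1.
- move=> x y [Ix kx] [Iy ky]; split=> [|k]; first exact: subgroupM.
  have [s Is sx] := kx k; have [t It ty] := ky k.
  exists (s * t); first exact: subgroupM.
  by rewrite expgMn ?sx ?ty //; apply: (toral_comm tT); apply: IT.
- move=> x [Ix kx]; split=> [|k]; first exact: subgroupV.
  have [s Is sx] := kx k.
  by exists s^-1; [exact: subgroupV|rewrite expVgn sx].
Qed.

(** There are finitely many p-th roots of x in I. If each of them lacked a p^k-th root in I for some
    k, a bound K of these k would contradict the existence of a p^(K+1)-th root of x. *)
Lemma divpart_root I x : subgroup I -> I `<=` T -> divpart I x ->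
  exists2 y, divpart I y & y ^+ p = x.
Proof.
move=> sI IT Dx; have [Ix kx] := Dx; have [j xj] := toral_p tT x.
pose R := [set y : S | I y /\ y ^+ p = x].
have fR : finite_set R.
  apply: (sub_finite_set _ (toral_fin tT (p_gt0 j.+1))) => y [Iy yx].
  by split; [exact: IT|rewrite expnS expgnA yx].
apply: contrapT => h.
have ex y : exists k, R y -> forall s, I s -> s ^+ (p ^ k) <> y.
  case: (pselect (R y)) => [[Iy yx]|nR]; last by exists 0%N.
  apply: contrapT => h2; apply: h; exists y => //; split=> // k.
  apply: contrapT => h3; apply: h2; exists k => _ s Is sy; apply: h3; by exists s.
have [k hk] := choice ex; have [K hK] := finite_bound k fR.
have [s Is sx] := kx K.+1.
have Ry : R (s ^+ (p ^ K)).
  by split; [exact: subgroupX|rewrite -expgnA -expnSr sx].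
apply: (hk _ Ry (s ^+ (p ^ (K - k (s ^+ (p ^ K)))))); first exact: subgroupX.
by rewrite -expgnA -expnD subnK // hK.
Qed.

Lemma divpart_div I x n : subgroup I -> I `<=` T -> divpart I x -> (0 < n)%N ->
  exists2 y, divpart I y & y ^+ n = x.
Proof.
move=> sI IT; apply: (pdivisible_divisible p_pr (subgroup_divpart sI IT)).
  by move=> y; apply: divpart_root.
by move=> y _; apply: (toral_p tT).
Qed.

(** K is chosen on the finite p-torsion of T: an element of order p with a p^K-th root in I is in
    the divisible part. Induction on the order extends this to every p^K-th power y, because
    dividing y by a divisible element z with the same p^j-th power lowers its order. *)
Lemma divpart_exp I : subgroup I -> I `<=` T ->
  exists e, forall x, I x -> divpart I (x ^+ (p ^ e)).
Proof.
move=> sI IT; have sD := subgroup_divpart sI IT.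
have ex y : exists k, I y -> (exists2 s, I s & s ^+ (p ^ k) = y) -> divpart I y.
  case: (pselect (divpart I y)) => [Dy|nD]; first by exists 0%N.
  apply: contrapT => h; apply: nD; case: (pselect (I y)) => [Iy|nI].
    split=> // k; apply: contrapT => h2; apply: h; exists k => _ [s Is sy].
    by case: h2; exists s.
  by case: h; exists 0%N.
have [k hk] := choice ex; have [K hK] := finite_bound k (toral_fin tT (prime_gt0 p_pr)).
exists K => x Ix.
suff H j y : (exists2 s, I s & s ^+ (p ^ K) = y) -> y ^+ (p ^ j) = 1 -> divpart I y.
  have [j xj] := toral_p tT (x ^+ (p ^ K)).
  by apply: H xj; exists x.
elim: j y => [|j IH] y [s Is sy] yj; first by move: yj; rewrite expn0 expg1 => ->; apply: subgroup1.
set y1 := y ^+ (p ^ j).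
have Iy : I y by rewrite -sy; apply: subgroupX.
have Iy1 : I y1 by apply: subgroupX.
have y1p : y1 ^+ p = 1 by rewrite /y1 -expgnA -expnSr.
have D1 : divpart I y1.
  apply: (hk y1 Iy1); exists (s ^+ (p ^ (K - k y1) * p ^ j)); first exact: subgroupX.
  rewrite -expgnA mulnAC -expnD subnK; first by rewrite expgnA sy.
  by apply: hK; split; [exact: IT|].
have [z Dz zy] := divpart_div sI IT D1 (p_gt0 j).
have Iz := divpart_sub Dz.
have zT := IT _ Iz; have yT := IT _ Iy.
have czy : commute y z^-1 by apply/commuteV/(toral_comm tT).
have D2 : divpart I (y * z^-1).
  apply: IH; last by rewrite expgMn // expVgn zy mulgV.
  have [_ /(_ K) [u Iu uz]] := Dz.
  exists (s * u^-1); first by apply: (subgroupM sI) => //; apply: subgroupV.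
  rewrite expgMn; first by rewrite sy expVgn uz.
  by apply/commuteV/(toral_comm tT); apply: IT.
by rewrite -(mulgVK z y); apply: (subgroupM sD).
Qed.

(** Divisibility by q forces the image into T, which contains all q-th powers. *)
Lemma divpart_hom I f J : subgroup I -> I `<=` T ->
  (forall x n, divpart I x -> f (x ^+ n) = f x ^+ n) ->
  (forall x, divpart I x -> J (f x)) ->
  forall x, divpart I x -> divpart (J `&` T) (f x).
Proof.
move=> sI IT fX fJ.
have fT x : divpart I x -> T (f x).
  move=> Dx; have [y Dy <-] := divpart_div sI IT Dx (toral_q tT).
  by rewrite fX //; apply: (toral_exp tT).
move=> x Dx; split=> [|k]; first by split; [exact: fJ|exact: fT].
have [y Dy yx] := divpart_div sI IT Dx (p_gt0 k).
by exists (f y); [split; [exact: fJ|exact: fT]|rewrite -fX // yx].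
Qed.

Lemma divpart_split I x n : subgroup I -> I `<=` T -> T x -> (0 < n)%N ->
  divpart I (x ^+ n) ->
  exists d z, [/\ divpart I d, T z, z ^+ n = 1 & x = d * z].
Proof.
move=> sI IT Tx n0 Dxn; have [d Dd dx] := divpart_div sI IT Dxn n0.
have Td := IT _ (divpart_sub Dd).
exists d, (d^-1 * x); split=> //; last by rewrite mulVKg.
  by apply: (subgroupM sT) => //; apply: subgroupV.
rewrite expgMn ?expVgn ?dx ?mulVg //.
by apply/commute_sym/commuteV/(toral_comm tT).
Qed.

Lemma finite_cosets_divpart P : subgroup P ->
  finite_set [set lcoset x (divpart (P `&` T)) | x in P].
Proof.
move=> sP; have sPT := subgroupI sP sT; have PTT : P `&` T `<=` T by move=> x [].
have sD := subgroup_divpart sPT PTT.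
have [e he] := divpart_exp sPT PTT.
have [c [_ cS _]] := (has_index_reps _ _ sT).1 (toral_index tT).
have ex i : exists y, (exists2 x, P x & T ((c i)^-1 * x)) -> P y /\ T ((c i)^-1 * y).
  case: (pselect (exists2 x, P x & T ((c i)^-1 * x))) => [[x Px Tx]|n]; last by exists 1.
  by exists x.
have [r hr] := choice ex.
pose tor := [set z : S | T z /\ z ^+ (p ^ e) = 1].
apply: (@sub_finite_set _ _ ((fun iz => lcoset (r iz.1 * iz.2) (divpart (P `&` T))) @`
    ([set: 'I_q] `*` tor))).
  move=> _ [x Px <-]; have [i Ti] := cS x I.
  have [Pr Tr] : P (r i) /\ T ((c i)^-1 * r i) by apply: hr; exists x.
  have PTx : (P `&` T) ((r i)^-1 * x).
    split; first by apply: (subgroupM sP) => //; apply: subgroupV.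
    have := subgroupM sT (subgroupV sT Tr) Ti.
    by rewrite invgM invgK !mulgA mulgK.
  have [d [z [Dd Tz zn xdz]]] := divpart_split sPT PTT PTx.2 (p_gt0 e) (he _ PTx).
  exists (i, z) => //=; apply/lcoset_eq => //.
  have cdz := toral_comm tT (PTT _ (divpart_sub Dd)) Tz.
  by rewrite invgM -mulgA xdz cdz mulKg.
apply/finite_image/finite_setX; first exact: finite_finset.
exact: (toral_fin tT (p_gt0 e)).
Qed.

Lemma index_divpart P : subgroup P -> exists n, has_index P (divpart (P `&` T)) n.
Proof. by move=> sP; apply/finite_setP/finite_cosets_divpart. Qed.

Lemma sub_ptorsion P : ptorsion p P.
Proof. by move=> x _; apply: (toral_p tT). Qed.

Lemma normalizer_grows_fin Q Z n : subgroup Q -> subgroup Z -> Q `<=` Z ->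
  has_index Z Q n -> ~ Z `<=` Q ->
  exists y, [/\ Z y, ~ Q y & normaliser Q y].
Proof.
move=> sQ sZ QZ iQ nZ; have [a [aM ka]] := coset_action sZ sQ QZ iQ.
have ZZ : Z `<=` Z by [].
pose A := imgroup sZ aM sZ ZZ; pose B := imgroup sZ aM sQ QZ.
have pA : p.-group A by apply: pgroup_gim => //; apply: sub_ptorsion.
have BA : B \proper A.
  rewrite properE gimS //=; apply/negP => /fintype.subsetP AB.
  by apply: nZ => x Zx; apply: (gim_mem_ker sQ QZ ZZ ka Zx); apply: AB; apply: mem_gim.
have := nilpotent_proper_norm (pgroup_nil pA) BA.
case/properP=> _ [_ /setIP[/gimP[y Zy <-] Ny] nBy].
have ZyV := subgroupV sZ Zy.
have QyV u : Q u -> Q (cj y^-1 u).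
  move=> Qu; have Zu := QZ u Qu; have Zc : Z (cj y^-1 u) by apply: subgroup_cj.
  apply: (gim_mem_ker sQ QZ ZZ ka Zc).
  rewrite /cj invgK !aM ?(morphicV sZ) //; last exact: subgroupM.
  rewrite -mulgA -conjgE; change (a u ^ a y \in B)%g; rewrite memJ_norm //; exact: mem_gim.
have QyE u : Q u -> Q (cj y u).
  move=> Qu; have Zu := QZ u Qu; have Zc : Z (cj y u) by apply: subgroup_cj.
  apply: (gim_mem_ker sQ QZ ZZ ka Zc).
  rewrite /cj !aM ?(morphicV sZ) //; last exact: subgroupM.
  rewrite -[X in (X * _ * _)%g]invgK -mulgA -conjgE.
  change (a u ^ (a y)^-1 \in B)%g; rewrite memJ_norm ?groupV //; exact: mem_gim.
exists y; split=> //; last exact/normaliserP.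
by move=> Qy; move/negP: nBy; apply; apply: mem_gim.
Qed.

(** If Z meets T inside Q, then Q has finite index in Z. Otherwise an element t of Z and T outside Q
    lies in the group V of elements of Z and T of exponent p^k; V is finite and normalised by Q, so
    Q has finite index in QV. In both cases the statement for finite p-groups applies. *)
Lemma normalizer_grows Q Z : subgroup Q -> subgroup Z -> Q `<=` Z ->
  ~ Z `<=` Q -> exists y, [/\ Z y, ~ Q y & normaliser Q y].
Proof.
move=> sQ sZ QZ nZ.
case: (pselect (Z `&` T `<=` Q)) => [ZTQ|/existsNP[t /not_implyP[[Zt Tt] nQt]]].
  suff /finite_setP[n iQ] : finite_set [set lcoset x Q | x in Z].
    exact: normalizer_grows_fin iQ nZ.
  have [c [_ cS _]] := (has_index_reps _ _ sT).1 (toral_index tT).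
  have ex i : exists y, forall x, Z x -> T ((c i)^-1 * x) -> Q (y^-1 * x).
    case: (pselect (exists2 x, Z x & T ((c i)^-1 * x))) => [[y Zy Ty]|n]; last first.
      by exists 1 => x Zx Tx; case: n; exists x.
    exists y => x Zx Tx; apply: ZTQ; split.
      by apply: (subgroupM sZ) => //; apply: subgroupV.
    have := subgroupM sT (subgroupV sT Ty) Tx.
    by rewrite invgM invgK !mulgA mulgK.
  have [r hr] := choice ex.
  apply: (@sub_finite_set _ _ ((fun i => lcoset (r i) Q) @` [set: 'I_q])).
    by move=> _ [x Zx <-]; have [i Ti] := cS x I; exists i => //; apply/lcoset_eq/hr.
  exact/finite_image/finite_finset.
have [k tk] := toral_p tT t.
pose V := [set x | (Z x /\ T x) /\ x ^+ (p ^ k) = 1].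
have sV : subgroup V.
  apply: mk_subgroup.
  - by rewrite /V /= expg1n; split=> //; split; apply: subgroup1.
  - move=> x y [[Zx Tx] xk] [[Zy Ty] yk]; split; first by split; apply: subgroupM.
    by rewrite expgMn ?xk ?yk ?mulg1 //; apply: (toral_comm tT).
  - move=> x [[Zx Tx] xk]; split; first by split; apply: subgroupV.
    by rewrite expVgn xk invg1.
have VQ : Q `<=` normaliser V.
  move=> y Qy; have Zy := QZ _ Qy.
  have h z u : Z z -> V u -> V (cj z u).
    move=> Zz [[Zu Tu] uk]; split; last by rewrite -cjX uk cjg1.
    by split; [exact: subgroup_cj|exact: (toral_cj tT)].
  by apply/normaliserP; split=> u; apply: h => //; apply: subgroupV.
have sQV := subgroup_mul sQ sV VQ.
have QQV := @mul_setl _ Q V sV; have VQV := @mul_setr _ Q V sQ.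
have nQV : ~ mul_set Q V `<=` Q by move=> h; apply/nQt/h/VQV.
have QVZ : mul_set Q V `<=` Z.
  by move=> _ [x Qx [y [[Zy _] _] <-]]; apply: subgroupM => //; apply: QZ.
suff /finite_setP[n iQ] : finite_set [set lcoset x Q | x in mul_set Q V].
  have [y [QVy nQy Ny]] := normalizer_grows_fin sQ sQV QQV iQ nQV.
  by exists y; split=> //; apply: QVZ.
apply: (@sub_finite_set _ _ ((fun v => lcoset v Q) @` V)).
  move=> _ [_ [x Qx [y Vy <-]] <-]; exists (cj x y).
    by apply: normaliser_cj => //; apply: VQ.
  by apply/lcoset_eq => //; rewrite /cj !invgM !invgK !mulgA !(mulgVK, mulgK).
apply: finite_image; apply: (sub_finite_set _ (toral_fin tT (p_gt0 k))).
by move=> x [[_ Tx] xk].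
Qed.

(** On the divisible part D, f permutes the elements of exponent p^k, which are finitely many, so
    f(D) = D. Then f induces an injection, hence a permutation, of the finitely many cosets of D in
    Q. *)
Lemma coHopf Q f : subgroup Q -> (forall x, Q x -> Q (f x)) ->
  (forall x y, Q x -> Q y -> f (x * y) = f x * f y) ->
  (forall x y, Q x -> Q y -> f x = f y -> x = y) ->
  forall y, Q y -> exists2 x, Q x & f x = y.
Proof.
move=> sQ fQ fM fI; have sQT := subgroupI sQ sT.
have QTT : Q `&` T `<=` T by move=> x [].
set D := divpart (Q `&` T); have sD : subgroup D by apply: subgroup_divpart.
have f1 : f 1 = 1.
  have Q1 := subgroup1 sQ; apply: (mulgI (f 1)).
  by rewrite -fM // !mulg1.
have fX x n : Q x -> f (x ^+ n) = f x ^+ n.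
  move=> Qx; elim: n => [|n IH]; first exact: f1.
  by rewrite !expgS fM ?IH //; apply: subgroupX.
have fV x : Q x -> f x^-1 = (f x)^-1.
  move=> Qx; apply/esym/mulg1_eq; rewrite -fM ?mulgV //; exact: subgroupV.
have DQ : D `<=` Q by move=> x [[]].
have fD x : D x -> D (f x).
  move=> Dx; apply: (@divpart_hom (Q `&` T) f Q) => // [y n Dy|y Dy]; first exact/fX/DQ.
  exact/fQ/DQ.
have fDS y : D y -> exists2 x, D x & f x = y.
  move=> Dy; have [k yk] := toral_p tT y.
  pose R := [set x | D x /\ x ^+ (p ^ k) = 1].
  have [] := @finite_inj_surj _ R f _ _ _ y (conj Dy yk).
  - apply: (sub_finite_set _ (toral_fin tT (p_gt0 k))) => x [Dx xk].
    by split=> //; apply: QTT; apply: divpart_sub Dx.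
  - by move=> x [Dx xk]; split; [exact: fD|rewrite -fX ?xk //; exact: DQ].
  - by move=> x z [Dx _] [Dz _]; apply: fI; apply: DQ.
  - by move=> x [Dx _] fx; exists x.
have [n /(has_index_reps _ _ sD) [c [cQ cS cI]]] := index_divpart sQ.
have [g hg] := choice (fun i => cS _ (fQ _ (cQ i))).
have gI : injective g.
  move=> i j gij; apply: cI; have := hg j; rewrite -gij => hj.
  have := subgroupM sD (subgroupV sD (hg i)) hj.
  rewrite invgM invgK !mulgA mulgK -fV // -fM //; last exact: subgroupV.
  case/fDS => x Dx /fI <- //; first exact: DQ.
  by apply: (subgroupM sQ) => //; apply: subgroupV.
move=> y Qy; have [j Dj] := cS y Qy.
have hi := hg (invF gI j); rewrite f_invF in hi.
have := subgroupM sD (subgroupV sD hi) Dj.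
rewrite invgM invgK !mulgA mulgK => /fDS[d Dd fd].
exists (c (invF gI j) * d); first by apply: subgroupM => //; apply: DQ.
by rewrite fM ?fd ?mulVKg //; apply: DQ.
Qed.

End Toral.

(** * Morphisms of fusion systems *)

Section InvOn.
Variable S : groupType.
Implicit Types (P : set S) (f : S -> S).

Definition inv_on P f (y : S) : S := xget 1 [set x | P x /\ f x = y].

Lemma inv_on_in P f y : (f @` P) y -> P (inv_on P f y).
Proof. by case=> x Px xy; rewrite /inv_on; case: xgetP => [z -> []|/(_ x)[]]. Qed.

Lemma inv_onK P f y : (f @` P) y -> f (inv_on P f y) = y.
Proof. by case=> x Px xy; rewrite /inv_on; case: xgetP => [z -> []|/(_ x)[]]. Qed.

End InvOn.

Lemma sym_ext (T : Type) (P : set T) (f g : T -> T) :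
  (forall x, P x -> P (f x)) -> (forall x, P x -> P (g x)) ->
  (forall x, P x -> g (f x) = x) -> (forall x, P x -> f (g x) = x) ->
  exists a : sym T, (forall x, ~ P x -> a x = x) /\ (forall x, P x -> a x = f x).
Proof.
move=> fP gP gf fg.
pose e (h : T -> T) z := if pselect (P z) is left _ then h z else z.
have eE h z : P z -> e h z = h z by rewrite /e; case: pselect.
have eN h z : ~ P z -> e h z = z by rewrite /e; case: pselect.
have eK h k : (forall x, P x -> P (h x)) -> (forall x, P x -> k (h x) = x) ->
    cancel (e h) (e k).
  move=> hP kh z; case: (pselect (P z)) => Pz; last by rewrite !eN.
  by rewrite (eE h) // eE ?kh //; apply: hP.
exists (Sym (Bijective (eK _ _ fP gf) (eK _ _ gP fg))).
by split=> z hz /=; [exact: eN|exact: eE].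
Qed.

(** Only the source is recorded: by [F_mor] the morphisms to Q are the morphisms to S with image in
    Q. *)
Definition mor (S : groupType) (F : homsets S) (P : set S) (f : S -> S) : Prop :=
  F P [set: S] f.

Section InjHom.
Variables (S : groupType) (P : set S) (f : S -> S).
Hypothesis hf : inj_hom P [set: S] f.
Implicit Types (x y z : S) (Q R : set S).

Lemma hom_sub : subgroup P. Proof. by case: hf => [[]]. Qed.

Lemma homM x y : P x -> P y -> f (x * y) = f x * f y.
Proof. by case: hf => [[_ _ _ h] _]; apply: h. Qed.

Lemma hom_inj x y : P x -> P y -> f x = f y -> x = y.
Proof. by case: hf => [_]; apply. Qed.

Lemma hom1 : f 1 = 1.
Proof.
have P1 := subgroup1 hom_sub; apply: (mulgI (f 1)).
by rewrite -homM // !mulg1.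
Qed.

Lemma homV x : P x -> f x^-1 = (f x)^-1.
Proof.
move=> Px; apply/esym/mulg1_eq; rewrite -homM ?mulgV ?hom1 //.
exact: (subgroupV hom_sub).
Qed.

Lemma homX x n : P x -> f (x ^+ n) = f x ^+ n.
Proof.
move=> Px; elim: n => [|n IH]; first exact: hom1.
by rewrite !expgS homM ?IH //; apply: (subgroupX _ hom_sub).
Qed.

Lemma hom_cj x y : P x -> P y -> f (cj x y) = cj (f x) (f y).
Proof.
move=> Px Py; have PxV := subgroupV hom_sub Px.
by rewrite /cj !homM ?homV //; apply: (subgroupM hom_sub).
Qed.

Lemma hom_im_sub Q : subgroup Q -> Q `<=` P -> subgroup (f @` Q).
Proof.
move=> sQ QP; apply: mk_subgroup.
- by exists 1; [exact: subgroup1|exact: hom1].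
- move=> _ _ [x Qx <-] [y Qy <-]; exists (x * y); first exact: subgroupM.
  by rewrite homM //; apply: QP.
- move=> _ [x Qx <-]; exists x^-1; first exact: subgroupV.
  by rewrite homV //; apply: QP.
Qed.

Lemma hom_im : subgroup (f @` P).
Proof. exact: hom_im_sub hom_sub _. Qed.

Lemma inv_on_f x : P x -> inv_on P f (f x) = x.
Proof.
move=> Px; have fx : (f @` P) (f x) by exists x.
by apply: hom_inj => //; [exact: inv_on_in|exact: inv_onK].
Qed.

Lemma im_inv_on Q : Q `<=` P -> inv_on P f @` (f @` Q) = Q.
Proof.
move=> QP; apply/seteqP; split=> [_ [_ [x Qx <-] <-]|x Qx].
  by rewrite inv_on_f //; apply: QP.
by exists (f x); [exists x|rewrite inv_on_f //; apply: QP].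
Qed.

Lemma inj_hom_sub Q : subgroup Q -> Q `<=` P -> inj_hom Q [set: S] f.
Proof.
move=> sQ QP; split; first split=> //; first exact: subgroupT.
  by move=> x y /QP Px /QP Py; apply: homM.
by move=> x y /QP Px /QP Py; apply: hom_inj.
Qed.

Lemma inj_hom_inv : inj_hom (f @` P) [set: S] (inv_on P f).
Proof.
split.
  split=> //; [exact: hom_im|exact: subgroupT|].
  move=> _ _ [x Px <-] [y Py <-].
  by rewrite -homM // !inv_on_f //; apply: (subgroupM hom_sub).
by move=> _ _ [x Px <-] [y Py <-]; rewrite !inv_on_f // => ->.
Qed.

Lemma hom_centraliser x : P x -> centraliser P x -> centraliser (f @` P) (f x).
Proof.
by move=> Px cx _ [y Py <-]; rewrite /commute -!homM // (cx y Py).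
Qed.

End InjHom.

Section MkFusion.
Variable S : groupType.
Implicit Types (P Q R : set S) (f g : S -> S).

Lemma inj_hom_cj P s : subgroup P -> inj_hom P [set: S] (cj s).
Proof.
move=> sP; split; first by split=> //; [exact: subgroupT|move=> x y _ _; exact: cjMr].
by move=> x y _ _ /cj_inj.
Qed.

Variable M : set S -> set (S -> S).

Definition of_mor : homsets S := fun P Q =>
  [set f | [/\ M P f, subgroup Q & f @` P `<=` Q]].

Hypotheses (Minj : forall P f, M P f -> inj_hom P [set: S] f)
  (Magree : forall P f g, agree P f g -> M P f -> M P g)
  (Mcomp : forall P Q f g, M P f -> M Q g -> (forall x, P x -> Q (f x)) ->
     M P (g \o f))
  (Mcj : forall P s, subgroup P -> M P (cj s))
  (Minv : forall P f, M P f -> M (f @` P) (inv_on P f)).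

(** Together with [fusion_gen_min], the induction principle for generated fusion systems: a property
    of morphisms with these closure properties holds in [fusion_gen X] as soon as it holds on X. *)
Lemma mk_fusion : fusion_system of_mor.
Proof.
split.
- move=> P Q f [Mf sQ fPQ]; have [[sP _ _ fM] fI] := Minj Mf.
  by split=> //; split=> // x Px; apply: fPQ; exists x.
- move=> P Q f g fg [Mf sQ fPQ]; split=> //; first exact: Magree Mf.
  by move=> _ [x Px <-]; rewrite -fg //; apply: fPQ; exists x.
- move=> P Q R f g [Mf sQ fPQ] [Mg sR gQR]; split=> //.
    by apply: Mcomp Mf Mg _ => x Px; apply: fPQ; exists x.
  by move=> _ [x Px <-]; apply: gQR; exists (f x) => //; apply: fPQ; exists x.
- move=> P Q f [sP sQ [s sPQ fs]]; split=> //.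
    by apply: Magree (Mcj s sP) => x Px; rewrite fs.
  by move=> _ [x Px <-]; rewrite fs //; apply: sPQ.
- move=> P Q f [Mf sQ fPQ]; exists (f @` P) => //.
  have sfP := hom_im (Minj Mf); have sP := hom_sub (Minj Mf).
  split; first by split.
  exists (inv_on P f).
    split=> //; first exact: Minv.
    by move=> _ [y fPy <-]; apply: inv_on_in.
  split=> [x Px|y fPy] /=; last exact: inv_onK.
  exact: (inv_on_f (Minj Mf)).
Qed.

End MkFusion.

Section Fusion.
Variables (S : groupType) (F : homsets S).
Hypothesis fF : fusion_system F.
Implicit Types (P Q R : set S) (f g : S -> S) (s x y : S).

Lemma mor_inj_hom P f : mor F P f -> inj_hom P [set: S] f.
Proof. exact: (fusion_inj fF). Qed.

Lemma mor_subgroup P f : mor F P f -> subgroup P.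
Proof. by move/mor_inj_hom/hom_sub. Qed.

Lemma mor_agree P f g : agree P f g -> mor F P f -> mor F P g.
Proof. exact: (fusion_agree fF). Qed.

Lemma F_incl P Q : subgroup P -> subgroup Q -> P `<=` Q -> F P Q id.
Proof.
move=> sP sQ PQ; apply: (fusion_homS fF); split=> //.
by exists 1 => x Px; rewrite cj1g //; apply: PQ.
Qed.

Lemma mor_id P : subgroup P -> mor F P id.
Proof. by move=> sP; apply: F_incl => //; apply: subgroupT. Qed.

Lemma F_subl P Q R f : subgroup P -> P `<=` Q -> F Q R f -> F P R f.
Proof.
move=> sP PQ Ff; have [[sQ _ _ _] _] := fusion_inj fF Ff.
exact: (fusion_comp fF (F_incl sP sQ PQ) Ff).
Qed.

Lemma mor_sub P Q f : subgroup P -> P `<=` Q -> mor F Q f -> mor F P f.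
Proof. exact: F_subl. Qed.

Lemma F_mor P Q f : F P Q f <-> [/\ mor F P f, subgroup Q & f @` P `<=` Q].
Proof.
split=> [Ff|[Ff sQ fPQ]].
  have [[sP sQ fPQ _] _] := fusion_inj fF Ff; split=> //.
    exact: (fusion_comp fF Ff (mor_id sQ)).
  by move=> _ [x Px <-]; apply: fPQ.
have [R _ [FPR [g FRP [gf fg]]]] := fusion_factor fF Ff.
have [[_ sR fPR _] _] := fusion_inj fF FPR.
have RQ : R `<=` Q.
  move=> y Ry; apply: fPQ; exists (g y); last exact: fg.
  by have [[_ _ gRP _] _] := fusion_inj fF FRP; apply: gRP.
exact: (fusion_comp fF FPR (F_incl sR sQ RQ)).
Qed.

Lemma mor_comp P Q f g : mor F P f -> mor F Q g -> (forall x, P x -> Q (f x)) ->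
  mor F P (g \o f).
Proof.
move=> Ff Fg fPQ; apply: (fusion_comp fF _ Fg); apply/F_mor; split=> //.
  exact: mor_subgroup Fg.
by move=> _ [x Px <-]; apply: fPQ.
Qed.

Lemma mor_cj P s : subgroup P -> mor F P (cj s).
Proof.
move=> sP; apply: (fusion_homS fF); split=> //; first exact: subgroupT.
by exists s.
Qed.

Lemma mor_inv P f : mor F P f -> mor F (f @` P) (inv_on P f).
Proof.
move=> Ff; have [R _ [FPR [g FRP [gf fg]]]] := fusion_factor fF Ff.
have [[_ _ fPR _] _] := fusion_inj fF FPR.
have [[_ _ gRP _] _] := fusion_inj fF FRP.
have RE : R = f @` P.
  apply/seteqP; split=> [y Ry|_ [x Px <-]]; last exact: fPR.
  by exists (g y); [exact: gRP|exact: fg].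
have /F_mor[Fg _ _] := FRP; rewrite -RE.
apply: mor_agree Fg => y Ry; have Pgy := gRP y Ry.
by rewrite -[in RHS](fg y Ry) /= (inv_on_f (mor_inj_hom Ff)).
Qed.

Lemma iso_mor P Q f : iso F P Q f <-> mor F P f /\ f @` P = Q.
Proof.
split=> [[Ff [g Fg [gf fg]]]|[Ff <-]].
  have /F_mor[Mf _ fPQ] := Ff; have /F_mor[Mg _ gQP] := Fg; split=> //.
  apply/seteqP; split=> // y Qy; exists (g y); last exact: fg.
  by apply: gQP; exists y.
have hf := mor_inj_hom Ff; split.
  by apply/F_mor; split=> //; apply: hom_im hf.
exists (inv_on P f).
  apply/F_mor; split; [exact: mor_inv|exact: hom_sub hf|].
  by move=> _ [y fPy <-]; apply: inv_on_in.
by split=> [x Px|y fPy] /=; [exact: (inv_on_f hf)|exact: inv_onK].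
Qed.

Lemma isoclassP P Q : isoclass F P Q <-> exists2 f, mor F P f & f @` P = Q.
Proof.
by split=> [[f /iso_mor[]]|[f Ff fP]]; exists f => //; apply/iso_mor.
Qed.

Lemma isoclass_im P f : mor F P f -> isoclass F P (f @` P).
Proof. by move=> Ff; apply/isoclassP; exists f. Qed.

Lemma isoclass_refl P : subgroup P -> isoclass F P P.
Proof.
by move=> sP; apply/isoclassP; exists id; [exact: mor_id|exact: image_id].
Qed.

Lemma isoclass_sym P Q : isoclass F P Q -> isoclass F Q P.
Proof.
case/isoclassP => f Ff <-; apply/isoclassP; exists (inv_on P f).
  exact: mor_inv.
exact: im_inv_on (mor_inj_hom Ff) _ _.
Qed.

Lemma isoclass_trans P Q R : isoclass F P Q -> isoclass F Q R -> isoclass F P R.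
Proof.
case/isoclassP => f Ff <-; case/isoclassP => g Fg <-; apply/isoclassP.
exists (g \o f); last by rewrite image_comp.
by apply: mor_comp Ff Fg _ => x Px; exists x.
Qed.

Lemma isoclass_subgroup P Q : isoclass F P Q -> subgroup P /\ subgroup Q.
Proof.
by case/isoclassP => f /mor_inj_hom hf <-; split; [exact: hom_sub hf|exact: hom_im hf].
Qed.

(** By [extenderP], N_f consists of the liftable elements of the normaliser of P. *)
Definition liftable P f s := exists t, forall x, P x -> f (cj s x) = cj t (f x).

Lemma extenderP P f s : mor F P f ->
  extender P f s <-> normaliser P s /\ liftable P f s.
Proof.
move=> Ff; have hf := mor_inj_hom Ff; have sfP := hom_im hf; split.
  case=> Ns [a [_ [[_ _ [t tP at_]] _]] af]; split=> //; exists t => x Px.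
  have := af x Px; rewrite /= => <-; rewrite at_ //; by exists x.
case=> Ns [t ft]; split=> //.
have tfP : normaliser (f @` P) t.
  apply/seteqP; split=> [_ [_ [x Px <-] <-]|_ [x Px <-]].
    by rewrite -ft //; exists (cj s x) => //; apply: normaliser_cj.
  have Px' : P (cj s^-1 x) by apply: normaliser_cj => //; apply: normaliserV.
  exists (f (cj s^-1 x)); first by exists (cj s^-1 x).
  by rewrite -ft // cjKV.
have tK := normaliser_cj tfP; have tVK := normaliser_cj (normaliserV tfP).
have [a [aN aE]] := sym_ext tK tVK (fun x _ => cjK t x) (fun x _ => cjKV t x).
exists a; last by move=> x Px; rewrite /= aE ?ft //; exists x.
split=> //; split; first by split=> //; exists t.
exists (cj t^-1); first by split=> //; exists t^-1.
by split=> z h /=; rewrite aE ?cjK ?cjKV //; apply: tVK.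
Qed.

Lemma sub_extender P f x : mor F P f -> P x -> extender P f x.
Proof.
move=> Ff Px; have hf := mor_inj_hom Ff; apply/extenderP => //; split.
  by apply: sub_normaliser => //; apply: hom_sub hf.
by exists (f x) => y Py; rewrite (hom_cj hf).
Qed.

End Fusion.

Lemma fusion_gen_min (S : groupType) (X F : homsets S) : fusion_system F ->
  subsystem X F -> subsystem (fusion_gen X) F.
Proof. by move=> fF XF P Q f; apply. Qed.

Lemma fusion_gen_sub (S : groupType) (X : homsets S) : subsystem X (fusion_gen X).
Proof. by move=> P Q f Xf F [fF XF]; apply: XF. Qed.

(** [F0] makes the intersected family nonempty; it supplies injectivity and the image through which
    a morphism factors in every member. *)
Lemma fusion_gen_fusion (S : groupType) (X F0 : homsets S) : fusion_system F0 ->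
  subsystem X F0 -> fusion_system (fusion_gen X).
Proof.
move=> f0 X0; split.
- by move=> P Q f /(_ F0 (conj f0 X0)); apply: (fusion_inj f0).
- by move=> P Q f g fg Xf F hF; apply: (fusion_agree hF.1 fg); apply: Xf.
- by move=> P Q R f g Xf Xg F hF; apply: (fusion_comp hF.1); [apply: Xf|apply: Xg].
- by move=> P Q f hf F hF; apply: (fusion_homS hF.1).
- move=> P Q f Xf; have Ff := Xf F0 (conj f0 X0).
  have /(F_mor f0)[Mf sQ fPQ] := Ff.
  have hf := mor_inj_hom f0 Mf; exists (f @` P) => //; split.
    move=> F hF; have /(F_mor hF.1)[MF _ _] := Xf F hF.
    by apply/(F_mor hF.1); split=> //; apply: hom_im hf.
  exists (inv_on P f).
    move=> F hF; have /(F_mor hF.1)[MF _ _] := Xf F hF.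
    apply/(F_mor hF.1); split; [exact: (mor_inv hF.1)|exact: hom_sub hf|].
    by move=> _ [y fPy <-]; apply: inv_on_in.
  by split=> [x Px|y fPy] /=; [exact: (inv_on_f hf)|exact: inv_onK].
Qed.

(** * Finiteness of conjugacy classes *)

(** Finitely many R-classes, expressed by an invariant in a finite type whose equality implies R. *)
Definition finitely_many (U : Type) (X : set U) (R : U -> U -> Prop) : Prop :=
  exists (K : finType) (k : U -> K), forall x y, X x -> X y -> k x = k y -> R x y.

Section Averaging.
Variables (p : nat) (S : groupType) (T : set S) (q : nat).
Hypotheses (p_pr : prime p) (tT : toral p T q).
Implicit Types (A P : set S) (f g : S -> S) (s : seq S) (u x y z : S).

Let sT := toral_sub tT.

Lemma prod_inT s : (forall x, x \in s -> T x) -> T (\prod_(x <- s) x).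
Proof.
elim: s => [|x s IH] h; first by rewrite big_nil; apply: subgroup1.
rewrite big_cons; apply: (subgroupM sT); first by apply: h; rewrite inE eqxx.
by apply: IH => y ys; apply: h; rewrite inE ys orbT.
Qed.

(** The factors lie in the commutative group T but the product is taken in S, so reordering proceeds
    by exchanging blocks. *)
Lemma prod_permT s1 s2 : perm_eq s1 s2 -> (forall x, x \in s1 -> T x) ->
  \prod_(x <- s1) x = \prod_(x <- s2) x.
Proof.
move=> e; pose Pr s := (forall x, x \in s -> T x) -> \prod_(x <- s1) x = \prod_(x <- s) x.
move=> h; suff : Pr s2 by apply => x xs; apply: h; rewrite (perm_mem e).
apply: (catCA_perm_ind (P := Pr)) e _ => // a b c IH hx.
rewrite IH => [|x]; last by rewrite mem_cat mem_cat orbCA -!mem_cat; apply: hx.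
rewrite !big_cat /= !mulgA; congr (_ * _).
by apply: (toral_comm tT); apply: prod_inT => x xs; apply: hx;
   rewrite !mem_cat xs ?orbT.
Qed.

Lemma prod_twist s y (g : S) : T y -> (forall x, x \in s -> T x) ->
  \prod_(z <- s) (y * cj g z) = y ^+ size s * cj g (\prod_(z <- s) z).
Proof.
move=> Ty; elim: s => [|x s IH] h; first by rewrite !big_nil cjg1 mulg1.
rewrite !big_cons IH => [|z zs]; last by apply: h; rewrite inE zs orbT.
have Tx : T x by apply: h; rewrite inE eqxx.
have cyx : commute (cj g x) (y ^+ size s).
  by apply/commuteX/(toral_comm tT) => //; apply: (toral_cj tT).
rewrite cjMr /= expgS; move: (cj g x) (cj g (\prod_(z <- s) z)) cyx => a b cyx.
by rewrite -!mulgA (mulgA a) cyx !mulgA.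
Qed.

Section Pair.
Variables (P A : set S) (n : nat) (c : 'I_n -> S) (f f' : S -> S).
Hypotheses (sA : subgroup A) (AP : A `<=` P) (hf : inj_hom P [set: S] f)
  (hf' : inj_hom P [set: S] f') (cP : forall i, P (c i))
  (cS : forall x, P x -> exists i, A ((c i)^-1 * x))
  (cI : forall i j, A ((c i)^-1 * c j) -> i = j)
  (ffA : agree A f f')
  (fc : forall i, T (f' (c i) * (f (c i))^-1)).

Let t x := f' x * (f x)^-1.
Let sP := hom_sub hf.

Lemma pair_coset x a : P x -> A a -> t (x * a) = t x.
Proof.
move=> Px Aa; rewrite /t (homM hf) ?(homM hf') //; try exact: AP.
by rewrite (ffA Aa) invgM !mulgA mulgK.
Qed.

Lemma pairT x : P x -> T (t x).
Proof.
move=> Px; have [i Ai] := cS Px.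
by rewrite -(mulVKg (c i) x) pair_coset //; apply: fc.
Qed.

Lemma pairM x y : P x -> P y -> t (x * y) = t x * cj (f x) (t y).
Proof.
by move=> Px Py; rewrite /t /cj (homM hf) ?(homM hf') // invgM !mulgA mulgVK.
Qed.

(** The map t is a 1-cocycle of P in T, constant on the cosets xA. If N is the product of t over
    these cosets, then t(x)^n c_{f(x)}(N) = N. Conjugating f' by an n-th root u of N therefore
    leaves a cocycle with values in the n-torsion of T. *)
Lemma pair_average : exists2 u, T u & forall x, P x ->
  T (cj u^-1 (f' x) * (f x)^-1) /\ (cj u^-1 (f' x) * (f x)^-1) ^+ n = 1.
Proof.
pose s := [seq t (c i) | i <- enum 'I_n].
have sTs x : x \in s -> T x by case/mapP => i _ ->; apply: pairT.
have n0 : (0 < n)%N by have [[j jn] _] := cS (subgroup1 sP); apply: leq_ltn_trans jn.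
pose N := \prod_(z <- s) z; have TN : T N by apply: prod_inT.
have [u Tu uN] := toral_div tT TN n0.
exists u => // x Px; have Ttx := pairT Px.
have e : t x ^+ n * cj (f x) N = N.
  have [si hsi] := choice (fun i => cS (subgroupM sP Px (cP i))).
  have siI : injective si.
    move=> i j sij; apply: cI; have := hsi j; rewrite -sij => hj.
    have := subgroupM sA (subgroupV sA (hsi i)) hj.
    by rewrite !invgM !invgK !mulgA mulgK mulgVK.
  have -> : n = size s by rewrite size_map size_enum_ord.
  rewrite -prod_twist // [RHS](_ : _ = \prod_(z <- [seq t (c (si i)) | i <- enum 'I_n]) z).
    rewrite !big_map; apply: eq_bigr => i _; rewrite -pairM //.
    by rewrite -(mulVKg (c (si i)) (x * c i)) pair_coset.
  apply: prod_permT => //; rewrite /s (map_comp (fun i => t (c i)) si).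
  apply: perm_map; rewrite perm_sym; apply: uniq_perm.
  - by rewrite map_inj_uniq // enum_uniq.
  - exact: enum_uniq.
  - move=> i; rewrite mem_enum; apply/mapP; exists (invF siI i); rewrite ?mem_enum //.
    by rewrite f_invF.
have -> : cj u^-1 (f' x) * (f x)^-1 = u^-1 * (t x * cj (f x) u).
  by rewrite /cj /t invgK !mulgA mulgVK.
have Tcu : T (cj (f x) u) by apply: (toral_cj tT).
have TuV := subgroupV sT Tu; have Ttc := subgroupM sT Ttx Tcu.
split; first exact: subgroupM.
rewrite expgMn; last exact: (toral_comm tT).
rewrite expgMn; last exact: (toral_comm tT).
by rewrite expVgn -cjX uN e mulVg.
Qed.
End Pair.

(** Up to conjugacy a map is determined by finite data: its class on A, the cosets of T containing
    its values on representatives of P/A, and the n-torsion elements left by averaging it against a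
    fixed map [b] with the same first two data. *)
Lemma finite_conj_classes P A n (X : set (S -> S)) : subgroup A -> A `<=` P ->
  has_index P A n -> (forall f, X f -> inj_hom P [set: S] f) ->
  (forall f x, X f -> A x -> T (f x)) -> finitely_many X (agree A) ->
  finitely_many X (fun f g => exists u, agree P g (cj u \o f)).
Proof.
move=> sA AP iA Xh XA [K [k hk]].
have [c [cP cS cI]] := (has_index_reps _ _ sA).1 iA.
have [d [_ dS _]] := (has_index_reps _ _ sT).1 (toral_index tT).
have [cl hcl] := choice (fun x => dS x Logic.I).
pose k1 f := (k f, [ffun i : 'I_n => cl (f (c i))]).
have ex (z : K * {ffun 'I_n -> 'I_q}) : exists f, forall g, X g -> k1 g = z ->
    X f /\ k1 f = z.
  case: (pselect (exists2 g, X g & k1 g = z)) => [[g Xg gz]|h]; first by exists g.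
  by exists id => g Xg gz; case: h; exists g.
have [b hb] := choice ex.
case: (posnP n) => [n0|n0].
  exists unit, (fun=> tt) => f g Xf _ _.
  have [[i ltin] _] := cS 1 (subgroup1 (hom_sub (Xh f Xf))).
  by exfalso; move: ltin; rewrite n0.
have /finite_setP[m /card_IP[e [_ _ eS]]] := toral_fin tT n0.
have [j0 _] : exists j0, e j0 = 1.
  by apply: eS; rewrite /= expg1n; split=> //; apply: subgroup1.
have ex2 f : exists uz : S * {ffun 'I_n -> 'I_m}, X f -> T uz.1 /\
    forall i, cj uz.1^-1 (f (c i)) = e (uz.2 i) * b (k1 f) (c i).
  case: (pselect (X f)) => [Xf|nX]; last by exists (1, [ffun=> j0]).
  have [Xb kb] := hb (k1 f) f Xf erefl.
  have bfA : agree A (b (k1 f)) f by apply: hk => //; case: kb.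
  have bfc i : T (f (c i) * (b (k1 f) (c i))^-1).
    have [_ /(congr1 (fun h : {ffun 'I_n -> 'I_q} => h i))] := kb.
    rewrite !ffunE => cle; have h1 := hcl (f (c i)); rewrite -cle in h1.
    have h2 := subgroupM sT h1 (subgroupV sT (hcl (b (k1 f) (c i)))).
    have := toral_cj tT (d (cl (b (k1 f) (c i)))) h2.
    by rewrite /cj !invgM !invgK !mulgA mulgV mul1g mulgK.
  have [u Tu hu] := pair_average sA AP (Xh _ Xb) (Xh _ Xf) cP cS cI bfA bfc.
  have [z hz] := choice (fun i => eS _ (hu _ (cP i))).
  exists (u, [ffun i => z i]); split=> // i /=.
  by rewrite ffunE hz mulgVK.
have [uz huz] := choice ex2.
exists (K * {ffun 'I_n -> 'I_q} * {ffun 'I_n -> 'I_m})%type, (fun f => (k1 f, (uz f).2)).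
move=> f g Xf Xg [ek1 ekc e2]; have e1 : k1 f = k1 g by rewrite /k1 ek1; congr pair.
have [Tu hu] := huz f Xf; have [Tv hv] := huz g Xg.
exists ((uz g).1 * (uz f).1^-1) => x Px /=.
have hA a u h : X h -> A a -> T u -> cj u^-1 (h a) = h a.
  move=> Xh' Aa Tu'; apply/commute_cj/commute_sym/commuteV/(toral_comm tT) => //.
  exact: XA.
have hgf : cj (uz g).1^-1 (g x) = cj (uz f).1^-1 (f x).
  have [i Ai] := cS x Px; rewrite -(mulVKg (c i) x); have Pa := AP _ Ai.
  rewrite (homM (Xh _ Xf)) // (homM (Xh _ Xg)) // !cjMr (hA _ _ _ Xg Ai Tv) (hA _ _ _ Xf Ai Tu).
  by rewrite hu hv e1 e2 (hk f g).
by rewrite cjM -hgf cjKV.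
Qed.

End Averaging.

Section Sym.
Variable T : Type.
Implicit Types (a b : sym T) (x : T).

Lemma symM a b x : (a * b) x = a (b x). Proof. by []. Qed.

Lemma symK a x : a^-1 (a x) = x.
Proof. by rewrite -symM mulVg. Qed.

Lemma symKV a x : a (a^-1 x) = x.
Proof. by rewrite -symM mulgV. Qed.

End Sym.

(** * Automorphism groups in fusion systems *)

Section Autos.
Variables (S : groupType) (F : homsets S).
Hypothesis fF : fusion_system F.
Implicit Types (P Q : set S) (f g : S -> S) (a b : sym S) (s t x y : S).

Lemma AutP P a : Aut F P a <-> [/\ forall x, ~ P x -> a x = x, mor F P a & a @` P = P].
Proof.
split=> [[aN /(iso_mor fF)[Fa aP]]|[aN Fa aP]]; first by split.
by split=> //; apply/(iso_mor fF).
Qed.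

Lemma Aut_in P a x : Aut F P a -> P x -> P (a x).
Proof. by case/AutP => _ _ aP Px; rewrite -aP; exists x. Qed.

Lemma Aut_mor P a : Aut F P a -> mor F P a.
Proof. by case/AutP. Qed.

Lemma Aut_eq P a b : Aut F P a -> Aut F P b -> agree P a b -> a = b.
Proof.
move=> /AutP[aN _ _] /AutP[bN _ _] ab; apply: sym_inj => x.
by case: (pselect (P x)) => [/ab//|nPx]; rewrite aN ?bN.
Qed.

Lemma Aut_of P f : mor F P f -> f @` P = P ->
  exists2 a, Aut F P a & agree P a f.
Proof.
move=> Ff fP; have hf := mor_inj_hom fF Ff.
have [] := @sym_ext S P f (inv_on P f).
- by move=> x Px; rewrite -fP; exists x.
- by move=> x Px; apply: inv_on_in; rewrite fP.
- by move=> x Px; rewrite (inv_on_f hf).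
- by move=> x Px; rewrite inv_onK // fP.
move=> a [aN af]; exists a => //; apply/AutP; split=> //.
  by apply: mor_agree Ff => // x Px; rewrite af.
rewrite -[RHS]fP; apply/seteqP; split=> _ [x Px <-]; by exists x => //; rewrite af.
Qed.

Lemma subgroup_Aut P : subgroup P -> subgroup (Aut F P).
Proof.
move=> sP; apply: mk_subgroup.
- by apply/AutP; split=> //; [exact: mor_id|exact: image_id].
- move=> a b Aa Ab; have [aN Fa aP] := (AutP _ _).1 Aa.
  have [bN Fb bP] := (AutP _ _).1 Ab; apply/AutP; split.
  + by move=> x nPx; rewrite symM bN // aN.
  + by apply: (mor_comp fF Fb Fa) => x Px; apply: (Aut_in Ab).
  + by rewrite -[RHS]aP -[in RHS]bP -image_comp.
- move=> a Aa; have [aN Fa aP] := (AutP _ _).1 Aa; apply/AutP; split.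
  + by move=> x nPx; rewrite -{1}(aN x nPx) symK.
  + have := mor_inv fF Fa; rewrite aP; apply: mor_agree => // x Px.
    rewrite -aP in Px; case: Px => y Py <-.
    by rewrite symK (inv_on_f (mor_inj_hom fF Fa)).
  + apply/seteqP; split=> [_ [x Px <-]|x Px].
      by rewrite -aP in Px; case: Px => y Py <-; rewrite symK.
    by exists (a x); [exact: Aut_in Aa Px|rewrite symK].
Qed.

Lemma Inn_homS P a : subgroup P -> Inn P a -> Aut (homS (S:=S)) P a.
Proof.
move=> sP [aN [s Ps as_]]; have PsV := subgroupV sP Ps; split=> //; split.
  by split=> //; exists s => // x Px; apply: subgroup_cj.
exists (cj s^-1).
  by split=> //; exists s^-1 => // x Px; apply: subgroup_cj.
by split=> x Px /=; rewrite as_ ?cjK ?cjKV //; apply: subgroup_cj.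
Qed.

Lemma AutSP P a : subgroup P -> Aut (homS (S:=S)) P a <->
  (forall x, ~ P x -> a x = x) /\ exists2 s, normaliser P s & agree P a (cj s).
Proof.
move=> sP; split=> [[aN [[_ _ [s sP' as_]] [g [_ _ [t tP gt]] [ga ag]]]]|[aN [s Ns as_]]].
  split=> //; exists s => //; apply/normaliserP; split=> [x Px|x Px]; first exact: sP'.
  have gP y : P y -> P (g y) by move=> Py; rewrite gt //; apply: tP.
  have := ag x Px; rewrite /= as_; last exact: gP.
  by move=> <-; rewrite cjK; apply: gP.
have h1 := normaliser_cj Ns; have h2 := normaliser_cj (normaliserV Ns).
split=> //; split; first by split=> //; exists s.
exists (cj s^-1); first by split=> //; exists s^-1.
by split=> x Px /=; rewrite as_ ?cjK ?cjKV //; apply: h2.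
Qed.

Lemma AutS_of P s : subgroup P -> normaliser P s ->
  exists2 a, Aut (homS (S:=S)) P a & agree P a (cj s).
Proof.
move=> sP Ns; have h1 := normaliser_cj Ns.
have h2 := normaliser_cj (normaliserV Ns).
have [a [aN aE]] := sym_ext h1 h2 (fun x _ => cjK s x) (fun x _ => cjKV s x).
by exists a => //; apply/AutSP => //; split=> //; exists s.
Qed.

Lemma AutS_Aut P : subgroup P -> Aut (homS (S:=S)) P `<=` Aut F P.
Proof.
move=> sP a /(AutSP _ sP)[aN [s Ns as_]]; apply/AutP; split=> //.
  by apply: (mor_agree fF) (mor_cj fF s sP) => x Px; rewrite as_.
rewrite -[RHS]Ns; apply/seteqP; split=> _ [x Px <-]; exists x => //.
  by rewrite as_.
exact: as_.
Qed.

Lemma Inn_Aut P : subgroup P -> Inn P `<=` Aut F P.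
Proof. by move=> sP a Ia; apply: AutS_Aut => //; apply: Inn_homS. Qed.

Lemma subgroup_AutS P : subgroup P -> subgroup (Aut (homS (S:=S)) P).
Proof.
move=> sP; apply: mk_subgroup.
- apply/AutSP => //; split=> //; exists 1; first exact: normaliser1.
  by move=> x _; rewrite cj1g.
- move=> a b /(AutSP _ sP)[aN [s Ns as_]] /(AutSP _ sP)[bN [t Nt bt]].
  apply/AutSP => //; split=> [x nPx|]; first by rewrite symM bN // aN.
  exists (s * t); first exact: normaliserM.
  move=> x Px; rewrite symM bt // as_ ?cjM //; exact: normaliser_cj Nt Px.
- move=> a /(AutSP _ sP)[aN [s Ns as_]]; have NsV := normaliserV Ns.
  apply/AutSP => //; split=> [x nPx|]; first by rewrite -{1}(aN x nPx) symK.
  exists s^-1 => // x Px; rewrite -{1}(cjKV s x) -as_ ?symK //.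
  exact: normaliser_cj NsV Px.
Qed.

Lemma subgroup_Inn P : subgroup P -> subgroup (Inn P).
Proof.
move=> sP; apply: mk_subgroup.
- by split=> //; exists 1; [exact: subgroup1|move=> x _; rewrite cj1g].
- move=> a b [aN [s Ps as_]] [bN [t Pt bt]].
  split=> [x nPx|]; first by rewrite symM bN // aN.
  exists (s * t); first exact: subgroupM.
  move=> x Px; rewrite symM bt // as_ ?cjM //; exact: subgroup_cj.
- move=> a [aN [s Ps as_]]; have PsV := subgroupV sP Ps.
  split=> [x nPx|]; first by rewrite -{1}(aN x nPx) symK.
  exists s^-1 => // x Px; rewrite -{1}(cjKV s x) -as_ ?symK //; exact: subgroup_cj.
Qed.

Lemma Inn_AutS P : subgroup P -> Inn P `<=` Aut (homS (S:=S)) P.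
Proof. by move=> sP a; apply: Inn_homS. Qed.

Lemma Aut_cj P a s x : Aut F P a -> P s -> P x -> a (cj s x) = cj (a s) (a x).
Proof. by move=> /Aut_mor/(mor_inj_hom fF) ha Ps Px; rewrite (hom_cj ha). Qed.

Lemma Aut_normInn P : subgroup P -> Aut F P `<=` normaliser (Inn P).
Proof.
move=> sP a Aa; have AaV := subgroupV (subgroup_Aut sP) Aa.
suff h b c : Aut F P b -> Inn P c -> Inn P (cj b c).
  by apply/normaliserP; split=> c; apply: h.
move=> Ab [cN [s Ps cs]]; have AbV := subgroupV (subgroup_Aut sP) Ab.
have [bN _ _] := (AutP _ _).1 Ab; have [bVN _ _] := (AutP _ _).1 AbV.
split=> [x nPx|]; first by rewrite cjE !symM bVN // cN // bN.
exists (b s); first exact: Aut_in Ab Ps.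
move=> x Px; rewrite cjE !symM; have Pbx := Aut_in AbV Px.
by rewrite cs // (Aut_cj Ab) // symKV.
Qed.

Lemma AutS_ptorsion p P : subgroup P -> (forall s, exists k, s ^+ (p ^ k) = 1) ->
  ptorsion p (Aut (homS (S:=S)) P).
Proof.
move=> sP tS a Aa; have [aN [s Ns as_]] := (AutSP _ sP).1 Aa.
have [k sk] := tS s; exists k.
have e n x : P x -> (a ^+ n) x = cj (s ^+ n) x /\ P (cj (s ^+ n) x).
  move=> Px; elim: n => [|n [IH1 IH2]]; first by rewrite cj1g.
  rewrite expgS symM IH1 as_ // expgS cjM; split=> //.
  exact: normaliser_cj Ns _.
have sA := subgroup_AutS sP.
apply: (Aut_eq (P := P)).
- by apply: (AutS_Aut sP); apply: subgroupX.
- by apply: (subgroup1 (subgroup_Aut sP)).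
- by move=> x Px; rewrite (e _ x Px).1 sk cj1g.
Qed.

End Autos.

(** * Isomorphism invariance of orders *)

Section Order.
Variables (p : nat) (S : groupType).
Implicit Types (P Q : set S) (f : S -> S).

Lemma ptoral_order_im P f rm : inj_hom P [set: S] f -> ptoral_order p P rm ->
  ptoral_order p (f @` P) rm.
Proof.
move=> hf [T [[sT TP PN] [_ [g gb gM]] iT pm]].
have gfT x : T x -> inv_on P f (f x) = x by move=> Tx; rewrite (inv_on_f hf) //; apply: TP.
exists (f @` T); split=> //.
- split; first exact: (hom_im_sub hf).
    exact: image_subset.
  move=> _ [x Px <-]; have Nx := PN x Px; have NxV := normaliserV Nx.
  have PxV := subgroupV (hom_sub hf) Px.
  apply/normaliserP; split=> _ [y Ty <-].
    by exists (cj x y); [exact: normaliser_cj|rewrite (hom_cj hf) //; exact: TP].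
  exists (cj x^-1 y); first exact: normaliser_cj.
  by rewrite (hom_cj hf) ?(homV hf) //; apply: TP.
- split; first exact: (hom_im_sub hf).
  have [gT gI gS] := gb; exists (g \o inv_on P f).
    split.
    + by move=> _ [x Tx <-] /=; rewrite gfT //; apply: gT.
    + move=> y z /set_mem[x Tx <-] /set_mem[u Tu <-] /=; rewrite !gfT // => e.
      by rewrite (gI x u) // inE.
    + by move=> v /gS[x Tx <-]; exists (f x); [exists x|rewrite /= gfT].
  move=> _ _ [x Tx <-] [y Ty <-] i; rewrite /= -(homM hf) ?gfT //; try exact: TP.
    exact: gM.
  exact: subgroupM.
- have sfT := hom_im_sub hf sT TP.
  have /(has_index_reps _ _ sT)[c [cP cS cI]] := iT.
  apply/(has_index_reps _ _ sfT); exists (f \o c); split.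
  + by move=> i; exists (c i).
  + move=> _ [x Px <-]; have [i Ti] := cS x Px; exists i.
    exists ((c i)^-1 * x) => //=; rewrite (homM hf) ?(homV hf) //.
    exact: (subgroupV (hom_sub hf)).
  + move=> i j [x Tx fx]; apply: cI; suff <- : x = (c i)^-1 * c j by [].
    have PV := subgroupV (hom_sub hf) (cP i).
    apply: (hom_inj hf); first exact: TP.
      exact: (subgroupM (hom_sub hf)).
    by rewrite fx /= (homM hf) ?(homV hf).
Qed.

(** Isomorphic groups admit the same pairs, and [xget] makes the same choice from equal sets. *)
Lemma pt_order_im P f : inj_hom P [set: S] f -> pt_order p (f @` P) = pt_order p P.
Proof.
move=> hf; rewrite /pt_order; congr (xget _ _); apply/seteqP; split=> rm /= h.
  have := ptoral_order_im (inj_hom_inv hf) h; rewrite (im_inv_on hf) //.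
exact: ptoral_order_im.
Qed.

Lemma normaliser_cjim P u : normaliser (cj u @` P) = cj u @` normaliser P.
Proof.
have h v Q x : normaliser Q x -> normaliser (cj v @` Q) (cj v x).
  move=> Nx; have NxV := normaliserV Nx; apply/normaliserP; split=> _ [y Qy <-].
    exists (cj x y); first exact: normaliser_cj.
    by rewrite (hom_cj (inj_hom_cj v (subgroupT S))).
  exists (cj x^-1 y); first exact: normaliser_cj.
  by rewrite (hom_cj (inj_hom_cj v (subgroupT S))) // cjV.
apply/seteqP; split=> [x Nx|_ [x Nx <-]]; last exact: h.
exists (cj u^-1 x); last by rewrite cjKV.
have := h u^-1 _ _ Nx.
suff -> : cj u^-1 @` (cj u @` P) = P by [].
by apply/seteqP; split=> [_ [_ [y Py <-] <-]|y Py]; rewrite ?cjK //; exists (cj u y); rewrite ?cjK //; exists y.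
Qed.

Lemma pt_order_normaliser_cj P u :
  pt_order p (normaliser (cj u @` P)) = pt_order p (normaliser P).
Proof.
by rewrite normaliser_cjim; apply/pt_order_im/inj_hom_cj/subgroup_normaliser.
Qed.

End Order.

(** * Consequences of saturation: Aut_F(T) and fully normalized conjugates *)

Section Saturated.
Variables (p : nat) (S : groupType) (T : set S) (q : nat) (F : homsets S).
Hypotheses (p_pr : prime p) (tT : toral p T q) (sF : saturated p F).
Implicit Types (P Q R N A : set S) (f g h : S -> S) (a b w : sym S) (s t u x y z : S).

Let fF := saturated_fusion sF.
Let sT := toral_sub tT.

Lemma mor_extend P f N : mor F P f -> fully_centralized p F (f @` P) ->
  subgroup N -> N `<=` normaliser P -> (forall s, N s -> liftable P f s) ->
  exists2 g, mor F N g & agree P g f.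
Proof.
move=> Ff cf sN NN Nl; have [g Fg gf] := saturated_extend sF Ff cf.
exists g => //; apply: (mor_sub fF sN _ Fg) => s Ns.
by apply/(extenderP fF) => //; split; [exact: NN|exact: Nl].
Qed.

Lemma fn_sylow P : subgroup P -> fully_normalized p F P ->
  pidx p (Aut F P) (Aut (homS (S:=S)) P).
Proof.
move=> sP nP; have [_ _ sy] := saturated_sylow sF sP nP.
have sA := subgroup_Aut fF sP; have sB := subgroup_AutS sP.
have := Sylow_quotient p_pr (subgroup_Inn sP) sA sB sA (Inn_AutS sP)
  (AutS_Aut fF sP) _ (Aut_normInn fF sP) sy.
by case.
Qed.

Lemma fn_fc P : subgroup P -> fully_normalized p F P -> fully_centralized p F P.
Proof. by move=> sP nP; have [] := saturated_sylow sF sP nP. Qed.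

Definition transports Q f b s := forall x, Q x -> b (f x) = f (cj s x).

Lemma exists_transport Q f s : mor F Q f -> normaliser Q s ->
  exists2 b, Aut F (f @` Q) b & transports Q f b s.
Proof.
move=> Ff Ns; have hf := mor_inj_hom fF Ff; have sQ := hom_sub hf.
have Fk : mor F (f @` Q) (f \o (cj s \o inv_on Q f)).
  apply: (mor_comp fF (Q := Q) _ Ff).
    apply: (mor_comp fF (mor_inv fF Ff) (mor_cj fF s sQ)) => _ [x Qx <-].
    by rewrite (inv_on_f hf).
  by move=> _ [x Qx <-] /=; rewrite (inv_on_f hf) //; apply: normaliser_cj Ns Qx.
have [] := Aut_of fF Fk.
  apply/seteqP; split=> [_ [_ [x Qx <-] <-] /=|_ [x Qx <-]].
    by rewrite (inv_on_f hf) //; exists (cj s x) => //; apply: normaliser_cj Ns Qx.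
  have Qx' := normaliser_cj (normaliserV Ns) Qx.
  by exists (f (cj s^-1 x)); [exists (cj s^-1 x)|rewrite /= (inv_on_f hf) // cjKV].
move=> c Ac cE; exists c => // x Qx; rewrite cE /= ?(inv_on_f hf) //; by exists x.
Qed.

Lemma transportsM Q f b c s t : normaliser Q t ->
  transports Q f b s -> transports Q f c t -> transports Q f (b * c) (s * t).
Proof.
by move=> Nt bs ct x Qx; rewrite symM ct // bs ?cjM //; apply: normaliser_cj Nt Qx.
Qed.

Lemma transportsV Q f b s : normaliser Q s -> transports Q f b s ->
  transports Q f b^-1 s^-1.
Proof.
move=> Ns bs x Qx; rewrite -{1}(cjKV s x) -bs ?symK //.
exact: normaliser_cj (normaliserV Ns) Qx.
Qed.

Lemma transports_ptorsion Q f b s : mor F Q f -> Aut F (f @` Q) b -> normaliser Q s ->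
  transports Q f b s -> exists k, b ^+ (p ^ k) = 1.
Proof.
move=> Ff Ab Ns bs; have [k sk] := toral_p tT s; exists k.
have sAP := subgroup_Aut fF (hom_im (mor_inj_hom fF Ff)).
apply: (Aut_eq fF (P := f @` Q)); [exact: subgroupX|exact: subgroup1|].
move=> _ [x Qx <-]; have e n : (b ^+ n) (f x) = f (cj (s ^+ n) x).
  elim: n => [|n IH]; first by rewrite cj1g.
  rewrite expgS symM IH bs ?expgS ?cjM //.
  by apply: normaliser_cj Qx; apply: (subgroupX n (@subgroup_normaliser _ Q) Ns).
by rewrite e sk cj1g.
Qed.

(** The automorphisms f c_s f^-1 with s in Y form a p-torsion subgroup of G, so some a in G
    conjugates them into B, hence into Aut_S(f(Q)). Choosing G smaller than Aut_F(f(Q)) restricts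
    the correction a, for instance to automorphisms trivial on a subgroup. *)
Lemma receptive_core Q f Y (G B : set (sym S)) : mor F Q f -> subgroup Y ->
  Y `<=` normaliser Q -> subgroup G -> G `<=` Aut F (f @` Q) -> subgroup B -> B `<=` G ->
  B `<=` Aut (homS (S:=S)) (f @` Q) -> pidx p G B ->
  (forall b s, Aut F (f @` Q) b -> Y s -> transports Q f b s -> G b) ->
  exists2 a, G a & forall s, Y s -> liftable Q (a \o f) s.
Proof.
move=> Ff sY YN sG GA sB BG BS pGB YG; have hf := mor_inj_hom fF Ff.
have sQ := hom_sub hf; have sP := hom_im hf.
pose C := [set b | Aut F (f @` Q) b /\ exists2 s, Y s & transports Q f b s].
have sAP := subgroup_Aut fF sP.
have sC : subgroup C.
  apply: mk_subgroup.
  - split; first exact: subgroup1.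
    by exists 1; [exact: subgroup1|move=> x _; rewrite cj1g].
  - move=> b c [Ab [s Ys bs]] [Ac [t Yt ct]]; split; first exact: subgroupM.
    by exists (s * t); [exact: subgroupM|apply: transportsM => //; exact: YN].
  - move=> b [Ab [s Ys bs]]; split; first exact: subgroupV.
    by exists s^-1; [exact: subgroupV|apply: transportsV => //; exact: YN].
have CG : C `<=` G by move=> b [Ab [s Ys bs]]; apply: YG bs.
have tC : ptorsion p C.
  by move=> b [Ab [s Ys bs]]; apply: (transports_ptorsion Ff Ab (YN s Ys) bs).
have [a Ga aC] := pidx_conj p_pr sG sB BG pGB sC CG tC.
exists a => // s Ys; have [c Ac cs] := exists_transport Ff (YN s Ys).
have /BS/AutSP-/(_ sP)[_ [t Nt tE]] : B (cj a c) by apply: aC; split=> //; exists s.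
exists t => x Qx /=; have fQx : (f @` Q) (f x) by exists x.
have Pafx := Aut_in fF (GA _ Ga) fQx.
by rewrite -tE // cjE !symM symK cs.
Qed.

(** The morphism [h] extends f only up to an automorphism of f(Q). *)
Lemma fn_receptive Q f : mor F Q f -> fully_normalized p F (f @` Q) ->
  exists2 h, mor F (normaliser Q) h & h @` Q = f @` Q.
Proof.
move=> Ff nP; have hf := mor_inj_hom fF Ff; have sP := hom_im hf.
have sN := @subgroup_normaliser _ Q; have sA := subgroup_Aut fF sP.
have [a Aa al] := receptive_core Ff sN (@subset_refl _ _) sA (@subset_refl _ _)
  (subgroup_AutS sP) (AutS_Aut fF sP) (@subset_refl _ _) (fn_sylow sP nP) (fun b s Ab _ _ => Ab).
have [aN Fa aP] := (AutP fF _ _).1 Aa.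
have Fg : mor F Q (a \o f) by apply: (mor_comp fF Ff Fa) => x Qx; exists x.
have gQ : (a \o f) @` Q = f @` Q by rewrite -image_comp.
have cg : fully_centralized p F ((a \o f) @` Q) by rewrite gQ; apply: fn_fc.
have [g Fgg gE] := mor_extend Fg cg sN (fun x i => i) al.
exists g => //; rewrite -gQ.
by apply/seteqP; split=> _ [x Qx <-]; exists x => //; rewrite gE.
Qed.

Lemma torus_im P f : mor F P f -> T `<=` P -> forall x, T x -> T (f x).
Proof.
move=> Ff TP x Tx; have [y Ty <-] := toral_div tT Tx (toral_q tT).
by rewrite (homX (mor_inj_hom fF Ff)); [apply: (toral_exp tT)|apply: TP].
Qed.

Lemma torus_Aut P f : mor F P f -> T `<=` P -> exists2 w, Aut F T w & agree T w f.
Proof.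
move=> Ff TP; have FT := mor_sub fF sT TP Ff; have hf := mor_inj_hom fF FT.
have fT := torus_im Ff TP.
apply: (Aut_of fF FT); apply/seteqP; split=> [_ [x Tx <-]|y Ty]; first exact: fT.
have [x Tx xy] := coHopf p_pr tT sT fT (fun x y hx hy => homM hf hx hy)
  (fun x y hx hy => hom_inj hf hx hy) Ty.
by exists x.
Qed.

Lemma fn_torus : fully_normalized p F T.
Proof.
move=> Q /(isoclassP fF)[f Ff <-]; have [w Aw wf] := torus_Aut Ff (fun x k => k).
have [_ _ wT] := (AutP fF _ _).1 Aw.
suff -> : f @` T = T by exact: Order.POrderTheory.le_refl.
by rewrite -[RHS]wT; apply/seteqP; split=> _ [x Tx <-]; exists x => //; rewrite wf.
Qed.

(** Inn(T) is trivial as T is abelian, and Out_F(T) is finite because T, being alone in its class,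
    is fully normalized. *)
Lemma finite_W : finite_set (Aut F T).
Proof.
have [_ fO _] := saturated_sylow sF sT fn_torus.
have sI := subgroup_Inn sT; have AN := Aut_normInn fF sT.
move: fO; rewrite /Out quotientE // => fO.
suff inj : {in Aut F T &, injective (coset_class (Inn T))}.
  by rewrite -(eq_finite_set (inj_card_eq inj)).
move=> a b /set_mem Aa /set_mem Ab /(coset_class_eq sI (AN _ Aa) (AN _ Ab)) [nT [s Ts sE]].
have e : a^-1 * b = 1.
  apply: sym_inj => x; case: (pselect (T x)) => [Tx|nTx]; last by rewrite nT.
  by rewrite sE //; apply/commute_cj/(toral_comm tT).
by rewrite -(mulVKg a b) e mulg1.
Qed.

(** Images conjugate in S have normalisers of the same order, so finitely many orders occur and one
    is the largest. *)
Lemma exists_fn P : subgroup P ->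
  finitely_many [set f | mor F P f] (fun f g => exists u, agree P g (cj u \o f)) ->
  exists2 f, mor F P f & fully_normalized p F (f @` P).
Proof.
move=> sP [K [k hk]].
have ex (i : K) : exists f, forall g, mor F P g -> k g = i -> mor F P f /\ k f = i.
  case: (pselect (exists2 g, mor F P g & k g = i)) => [[g Fg gi]|n]; first by exists g.
  by exists id => g Fg gi; case: n; exists g.
have [r hr] := choice ex.
pose v i : (nat *l nat)%type := pt_order p (normaliser (r i @` P)).
have vE f : mor F P f -> pt_order p (normaliser (f @` P)) = v (k f).
  move=> Ff; have [Fr kr] := hr (k f) f Ff erefl.
  have [u uE] := hk _ _ Fr Ff kr.
  have -> : f @` P = cj u @` (r (k f) @` P).
    by apply/seteqP; split=> [_ [x Px <-]|_ [_ [x Px <-] <-]];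
      [exists (r (k f) x); [exists x|rewrite uE]|exists x => //; rewrite uE].
  exact: pt_order_normaliser_cj.
pose Pk i := `[< exists2 f, mor F P f & k f = i >].
have P0 : Pk (k id) by apply/asboolP; exists id => //; apply: mor_id.
case: (Order.TotalTheory.arg_maxP (P := Pk) v P0) => i /asboolP[f Ff fi] imax.
exists f => // Q /(isoclassP fF)[g Fg <-].
rewrite /order_le image_comp vE; last by apply: (mor_comp fF Ff Fg) => x Px; exists x.
rewrite vE // fi; apply: imax; apply/asboolP; exists (g \o f) => //.
by apply: (mor_comp fF Ff Fg) => x Px; exists x.
Qed.

(** T centralises P and f(P), so the isomorphisms from both to a common fully centralized subgroup
    extend to T. They give two elements of Aut_F(T), whose quotient induces f. *)
Lemma fusion_torus_rep P f : P `<=` T -> mor F P f -> f @` P `<=` T ->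
  (exists2 g, mor F P g & fully_normalized p F (g @` P)) ->
  exists2 w, Aut F T w & agree P w f.
Proof.
move=> PT Ff fPT [g Fg ng].
have sP := mor_subgroup fF Ff; have hf := mor_inj_hom fF Ff.
have cg := fn_fc (hom_im (mor_inj_hom fF Fg)) ng.
have ext Q h : Q `<=` T -> mor F Q h -> h @` Q = g @` P ->
    exists2 k, mor F T k & agree Q k h.
  move=> QT Fh hQ; apply: mor_extend => //; first by rewrite hQ.
    move=> t Tt; apply: centraliser_normaliser => x Px.
    by apply: (toral_comm tT) => //; apply: QT.
  move=> t Tt; exists 1 => x Px; rewrite cj1g.
  by rewrite (commute_cj _ _).1 //; apply: (toral_comm tT) => //; apply: QT.
have [k Fk kg] := ext P g PT Fg erefl.
have Fgf : mor F (f @` P) (g \o inv_on P f).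
  apply: (mor_comp fF (mor_inv fF Ff) Fg) => _ [x Px <-].
  by rewrite (inv_on_f hf).
have eP : (g \o inv_on P f) @` (f @` P) = g @` P by rewrite -image_comp (im_inv_on hf).
have [l Fl lg] := ext _ _ fPT Fgf eP.
have [w1 A1 w1k] := torus_Aut Fk (fun x k => k).
have [w2 A2 w2l] := torus_Aut Fl (fun x k => k).
exists (w2^-1 * w1).
  by have sA := subgroup_Aut fF sT; apply: (subgroupM sA) => //; apply: subgroupV.
move=> x Px; rewrite symM w1k ?kg //; last exact: PT.
have fPx : (f @` P) (f x) by exists x.
by rewrite -[RHS](symK w2) w2l ?lg /= ?(inv_on_f hf) //; apply: fPT.
Qed.

(** This breaks a circle: fully normalized conjugates are obtained in general from the fact that
    morphisms inside T come from Aut_F(T), and that fact from fully normalized conjugates. For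
    finite P the finiteness of classes follows with A trivial. *)
Lemma finite_torus_rep P f : finite_set P -> P `<=` T -> mor F P f ->
  f @` P `<=` T -> exists2 w, Aut F T w & agree P w f.
Proof.
move=> fP PT Ff fPT; apply: fusion_torus_rep => //.
have sP := mor_subgroup fF Ff; apply: exists_fn => //.
have [n iP] : exists n, has_index P [set 1] n.
  apply/finite_setP/(sub_finite_set _ (finite_image (fun x => [set x]) fP)).
  move=> _ [x Px <-]; exists x => //; apply/seteqP; split=> [y ->|_ [y -> <-]] /=.
    by exists 1; rewrite ?mulg1.
  by rewrite mulg1.
have P1 : [set 1] `<=` P by move=> _ ->; apply: subgroup1.
apply: (finite_conj_classes tT (subgroup_set1 S) P1 iP).
- by move=> g Fg; exact: mor_inj_hom Fg.
- by move=> g _ Fg ->; rewrite (hom1 (mor_inj_hom fF Fg)); apply: subgroup1.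
- exists unit, (fun=> tt) => g h Fg Fh _ _ ->.
  by rewrite (hom1 (mor_inj_hom fF Fg)) (hom1 (mor_inj_hom fF Fh)).
Qed.

(* The finite case applied to all the p^k-torsion subgroups of P, and finiteness of W. *)
Lemma torus_rep P f : P `<=` T -> mor F P f -> f @` P `<=` T ->
  exists2 w, Aut F T w & agree P w f.
Proof.
move=> PT Ff fPT; have sP := mor_subgroup fF Ff.
apply: contrapT => nw.
have ex w : exists k, Aut F T w -> exists x, [/\ P x, x ^+ (p ^ k) = 1 & w x <> f x].
  case: (pselect (Aut F T w)) => [Aw|nA]; last by exists 0%N.
  have [x /not_implyP[Px wx]] : exists x, ~ (P x -> w x = f x).
    by apply/existsNP => h; apply: nw; exists w.
  by have [k xk] := toral_p tT x; exists k => _; exists x.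
have [k hk] := choice ex; have [K hK] := finite_bound k finite_W.
pose PK := [set x | P x /\ x ^+ (p ^ K) = 1].
have PKP : PK `<=` P by move=> x [].
have sPK : subgroup PK.
  apply: mk_subgroup.
  - by split; [exact: subgroup1|exact: expg1n].
  - move=> x y [Px xK] [Py yK]; split; first exact: subgroupM.
    by rewrite expgMn ?xK ?yK ?mulg1 //; apply: (toral_comm tT); apply: PT.
  - by move=> x [Px xK]; split; [exact: subgroupV|rewrite expVgn xK invg1].
have [] := @finite_torus_rep PK f.
- by apply: sub_finite_set (toral_fin tT (p_gt0 p_pr K)) => x [/PT Tx xK].
- by move=> x /PKP/PT.
- exact: mor_sub Ff.
- by move=> _ [x /PKP Px <-]; apply: fPT; exists x.
move=> w Aw wE; have [x [Px xk]] := hk w Aw; apply; apply: wE; split=> //.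
by rewrite -(subnK (hK w Aw)) addnC expnD expgnA xk expg1n.
Qed.

Lemma divpart_torus P f : mor F P f -> forall x, divpart p (P `&` T) x -> T (f x).
Proof.
move=> Ff; have hf := mor_inj_hom fF Ff; have sPT := subgroupI (hom_sub hf) sT.
have PTT : P `&` T `<=` T by move=> x [].
move=> x Dx.
have [[_ Tfx] _] : divpart p ([set: S] `&` T) (f x); last by [].
apply: (divpart_hom p_pr tT sPT PTT) => // y n [[Py _] _]; exact: (homX hf).
Qed.

(** Here A is the divisible part of the intersection of P with T, to which every morphism restricts
    as an element of the finite group Aut_F(T). *)
Lemma exists_fn_conj P : subgroup P ->
  exists2 f, mor F P f & fully_normalized p F (f @` P).
Proof.
move=> sP; apply: exists_fn => //; have [n iP] := index_divpart p_pr tT sP.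
have sPT := subgroupI sP sT; have PTT : P `&` T `<=` T by move=> x [].
have sD := subgroup_divpart tT sPT PTT.
have DP : divpart p (P `&` T) `<=` P by move=> x [[]].
apply: (finite_conj_classes tT sD DP iP).
- by move=> f Ff; exact: mor_inj_hom Ff.
- by move=> f x Ff; apply: divpart_torus.
have /finite_setP[m /card_IP[e [_ _ eS]]] := finite_W.
have ex f : exists i : 'I_m, mor F P f -> agree (divpart p (P `&` T)) (e i) f.
  case: (pselect (mor F P f)) => [Ff|nF].
    have [] := @torus_rep (divpart p (P `&` T)) f.
    - by move=> x /divpart_sub/PTT.
    - exact: mor_sub Ff.
    - by move=> _ [x Dx <-]; apply: divpart_torus Ff _ Dx.
    by move=> w /eS[i <-] wE; exists i.
  by have [i _] := eS 1 (subgroup1 (subgroup_Aut fF sT)); exists i.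
have [k hk] := choice ex; exists 'I_m, k => f g Ff Fg kfg x Dx.
by rewrite -(hk f Ff x Dx) -(hk g Fg x Dx) kfg.
Qed.

Lemma exists_fc_conj P : subgroup P ->
  exists2 f, mor F P f & fully_centralized p F (f @` P).
Proof.
move=> sP; have [f Ff nf] := exists_fn_conj sP; exists f => //.
exact: (fn_fc (hom_im (mor_inj_hom fF Ff)) nf).
Qed.

End Saturated.

(** * The closure of a subgroup *)

Section Exhaustion.
Variables (p : nat) (S : groupType) (T : set S) (q : nat).
Hypotheses (p_pr : prime p) (tT : toral p T q).
Implicit Types (P Q Z U X : set S) (C : set (set S)) (s x : S).

Lemma toral_enum : exists e : nat -> S, forall s, exists n, e n = s.
Proof.
have [c [_ cS _]] := (has_index_reps _ _ (toral_sub tT)).1 (toral_index tT).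
pose X (k : nat) : set S := (fun it => c it.1 * it.2) @`
  ([set: 'I_q] `*` [set t | T t /\ t ^+ (p ^ k) = 1]).
have cX : countable (\bigcup_(k in [set: nat]) X k).
  apply: bigcup_countable => // k _; apply: finite_set_countable.
  apply/finite_image/finite_setX; first exact: finite_finset.
  exact: (toral_fin tT (p_gt0 p_pr k)).
have XT s : (\bigcup_(k in [set: nat]) X k) s.
  have [i Ti] := cS s Logic.I; have [k sk] := toral_p tT ((c i)^-1 * s).
  by exists k => //; exists (i, (c i)^-1 * s) => //=; rewrite mulVKg.
have /countable_injP[f fI] := cX.
have ex n : exists s, forall t, f t = n -> t = s.
  case: (pselect (exists s, f s = n)) => [[s fs]|h]; last first.
    by exists 1 => t ft; case: h; exists t.
  by exists s => t ft; apply: fI; rewrite ?inE // fs.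
by have [e he] := choice ex; exists e => s; exists (f s); rewrite -(he (f s) s).
Qed.

(** S is countable, so some increasing sequence in the chain has the same union. Zorn's lemma
    concerns arbitrary chains, axiom (III) only sequences. *)
Lemma chain_sequence C : total_on C subset -> (\bigcup_(X in C) X) !=set0 ->
  exists D : nat -> set S, [/\ forall n, C (D n), forall n, D n `<=` D n.+1 &
    \bigcup_n D n = \bigcup_(X in C) X].
Proof.
move=> Ct [s0 [X0 CX0 _]]; have [e eS] := toral_enum.
have ex n : exists X, C X /\ ((\bigcup_(X in C) X) (e n) -> X (e n)).
  case: (pselect ((\bigcup_(X in C) X) (e n))) => [[X CX Xe]|h]; first by exists X.
  by exists X0.
have [r hr] := choice ex.
pose D := fix D n := if n is m.+1 then D m `|` r m.+1 else r 0%N.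
have CD n : C (D n).
  elim: n => [|n IH] /=; first by case: (hr 0%N).
  have [Cr _] := hr n.+1; have [h|h] := Ct _ _ IH Cr.
    by rewrite (setUidPr _ _).2.
  by rewrite (setUidPl _ _).2.
exists D; split=> // [n|]; first exact: subsetUl.
apply/seteqP; split=> [s [n _ Ds]|s Us]; first by exists (D n).
have [n en] := eS s; exists n => //; rewrite -en; rewrite -en in Us.
by case: n {en} Us => [|n] Us; [case: (hr 0%N) => _; apply|right; case: (hr n.+1) => _; apply].
Qed.

Variable E : homsets S.
Hypothesis sE : saturated p E.

(* Zorn's lemma, chains being handled by axiom (III). *)
Lemma mor_exhaust P Z f : hom Z [set: S] f -> P `<=` Z -> mor E P f ->
  (forall Q, P `<=` Q -> Q `<=` Z -> mor E Q f -> ~ Z `<=` Q ->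
     exists Q', [/\ Q `<=` Q', Q' `<=` Z, mor E Q' f & ~ Q' `<=` Q]) ->
  mor E Z f.
Proof.
move=> [sZ _ _ fM] PZ EP step; have fE := saturated_fusion sE.
pose good Q := [/\ P `<=` Q, Q `<=` Z & mor E Q f].
have [|Q [[Q0|[PQ QZ EQ]] Qmax]] := @Zorn_bigcup S (fun Q => Q = set0 \/ good Q).
- move=> C CP Ct; case: (pselect ((\bigcup_(X in C) X) !=set0)) => [U0|U0]; last first.
    by left; apply/seteqP; split=> // x Ux; case: U0; exists x.
  right; pose C' := [set X | C X /\ X !=set0].
  have eC : \bigcup_(X in C) X = \bigcup_(X in C') X.
    apply/seteqP; split=> x [X CX Xx]; last by exists X; case: CX.
    by exists X => //; split=> //; exists x.
  have C't : total_on C' subset by move=> X Y [CX _] [CY _]; apply: Ct.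
  rewrite eC in U0 *.
  have [D [CD DS <-]] := chain_sequence C't U0.
  have gD n : good (D n).
    by have [/CP[D0|//] [x]] := CD n; rewrite D0.
  have Em : mor E (\bigcup_n D n) f.
    apply: (saturated_union sE) => // [n| |n]; try by case: (gD n) => _ _ /(mor_subgroup fE).
    - have DSle m n : (m <= n)%N -> D m `<=` D n.
        move=> /subnK <-; elim: (n - m)%N => [|k IH] //.
        by rewrite addSn; apply: subset_trans IH (DS _).
      have gsub n : subgroup (D n) by case: (gD n) => _ _ /(mor_subgroup fE).
      split=> //; [|exact: subgroupT|]; last first.
        move=> x y [n _ Dx] [m _ Dy]; have [_ DZ _] := gD n; have [_ DZm _] := gD m.
        by apply: fM; [exact: DZ|exact: DZm].
      apply: mk_subgroup.
      + by exists 0%N => //; apply: (subgroup1 (gsub _)).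
      + move=> x y [m _ Dx] [n _ Dy]; exists (maxn m n) => //.
        by apply: (subgroupM (gsub _)); [exact: (DSle m _ (leq_maxl m n))|exact: (DSle n _ (leq_maxr m n))].
      + by move=> x [n _ Dx]; exists n => //; apply: (subgroupV (gsub _)).
    - by case: (gD n).
  split=> //; first by move=> x Px; exists 0%N => //; case: (gD 0%N) => PD _ _; exact: PD.
  by move=> x [n _ Dx]; case: (gD n) => _ DZ _; exact: DZ.
- exfalso; apply: (Qmax P); last by right; split.
  rewrite Q0; split=> // h; have P1 := subgroup1 (mor_subgroup fE EP).
  exact: (h 1 P1).
- case: (pselect (Z `<=` Q)) => [ZQ|nZQ].
    by rewrite (_ : Z = Q) //; apply/seteqP; split.
  have [Q' [QQ' Q'Z EQ' nQ']] := step Q PQ QZ EQ nZQ.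
  exfalso; apply: (Qmax Q'); first by split.
  by right; split=> //; apply: subset_trans QQ'.
Qed.

End Exhaustion.

Section Bullet.
Variables (p : nat) (S : groupType) (T : set S) (q : nat) (F : homsets S).
Hypotheses (p_pr : prime p) (tT : toral p T q) (sF : saturated p F).
Implicit Types (P Q R N A Y : set S) (f g h : S -> S) (a b v w : sym S) (s t u x y z : S).

Let fF := saturated_fusion sF.
Let sT := toral_sub tT.
Let sW := subgroup_Aut fF sT.

(** P is seen through its q-th powers: they lie in T, where Aut_F(T) acts. *)
Definition fixW P : set (sym S) :=
  [set w | Aut F T w /\ forall x, P x -> w (x ^+ q) = x ^+ q].

Definition invT P : set S := [set t | T t /\ forall w, fixW P w -> w t = t].

Definition torus_core P : set S := divpart p (invT P).

(* The closure of P of Broto, Levi and Oliver, with P^q in place of P^[m]. *)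
Definition bullet P : set S := mul_set P (torus_core P).

Lemma WT w t : Aut F T w -> T t -> T (w t).
Proof. exact: (Aut_in fF). Qed.

Lemma WM w t u : Aut F T w -> T t -> T u -> w (t * u) = w t * w u.
Proof. by move=> /(Aut_mor fF)/(mor_inj_hom fF) h Tt Tu; rewrite (homM h). Qed.

Lemma WX w t n : Aut F T w -> T t -> w (t ^+ n) = w t ^+ n.
Proof. by move=> /(Aut_mor fF)/(mor_inj_hom fF) h Tt; rewrite (homX h). Qed.

Lemma WV w t : Aut F T w -> T t -> w t^-1 = (w t)^-1.
Proof. by move=> /(Aut_mor fF)/(mor_inj_hom fF) h Tt; rewrite (homV h). Qed.

Lemma W_cj s : exists2 w, Aut F T w & agree T w (cj s).
Proof. exact: (torus_Aut p_pr tT sF (mor_cj fF s sT) (fun x k => k)). Qed.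

Lemma invT_sub P : invT P `<=` T. Proof. by move=> t []. Qed.

Lemma subgroup_invT P : subgroup (invT P).
Proof.
apply: mk_subgroup.
- split=> [|w [Aw _]]; first exact: subgroup1.
  exact: (hom1 (mor_inj_hom fF (Aut_mor fF Aw))).
- move=> t u [Tt ht] [Tu hu]; split=> [|w Cw]; first exact: subgroupM.
  by rewrite WM ?ht ?hu //; case: Cw.
- move=> t [Tt ht]; split=> [|w Cw]; first exact: subgroupV.
  by rewrite WV ?ht //; case: Cw.
Qed.

Lemma subgroup_core P : subgroup (torus_core P).
Proof. exact: (subgroup_divpart tT (subgroup_invT P) (@invT_sub P)). Qed.

Lemma core_invT P : torus_core P `<=` invT P. Proof. exact: divpart_sub. Qed.

Lemma coreT P : torus_core P `<=` T. Proof. by move=> t /core_invT/invT_sub. Qed.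

Lemma core_div P t n : torus_core P t -> (0 < n)%N -> exists2 u, torus_core P u & u ^+ n = t.
Proof. exact: (divpart_div p_pr tT (subgroup_invT P) (@invT_sub P)). Qed.

Lemma fixWS P Q : P `<=` Q -> fixW Q `<=` fixW P.
Proof. by move=> PQ w [Aw h]; split=> // x /PQ; apply: h. Qed.

Lemma invTS P Q : P `<=` Q -> invT P `<=` invT Q.
Proof. by move=> PQ t [Tt h]; split=> // w /(fixWS PQ); apply: h. Qed.

Lemma coreS P Q : P `<=` Q -> torus_core P `<=` torus_core Q.
Proof. by move=> PQ; apply/divpartS/invTS. Qed.

(** Every morphism is represented ([exists_rep]); w is not unique, but its restriction to [invT P]
    is ([rep_uniq]). *)
Definition represents P f w := Aut F T w /\ forall x, P x -> f (x ^+ q) = w (x ^+ q).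

Lemma exists_rep P f : mor F P f -> exists w, represents P f w.
Proof.
move=> Ff; have hf := mor_inj_hom fF Ff; have sP := hom_sub hf.
pose Q := [set x | [/\ P x, T x & T (f x)]].
have sQ : subgroup Q.
  apply: mk_subgroup.
  - by split; rewrite ?(hom1 hf); apply: subgroup1.
  - by move=> x y [Px Tx Tfx] [Py Ty Tfy]; split; rewrite ?(homM hf) //; apply: subgroupM.
  - by move=> x [Px Tx Tfx]; split; rewrite ?(homV hf) //; apply: subgroupV.
have [] := @torus_rep p S T q F p_pr tT sF Q f.
- by move=> x [].
- by apply: (mor_sub fF sQ _ Ff) => x [].
- by move=> _ [x [_ _ h] <-].
move=> w Aw wE; exists w; split=> // x Px; rewrite wE //.
split; [exact: (subgroupX _ sP)|exact: (toral_exp tT)|].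
by rewrite (homX hf) //; apply: (toral_exp tT).
Qed.

Lemma rep_uniq P f v w t : represents P f v -> represents P f w -> invT P t -> v t = w t.
Proof.
move=> [Av hv] [Aw hw] [Tt ht].
have : fixW P (v^-1 * w).
  have AvV := subgroupV sW Av; split; first exact: subgroupM.
  by move=> x Px; rewrite symM -hw // hv // symK.
by move=> /ht; rewrite symM => e; rewrite -{1}e symKV.
Qed.

Lemma repS P Q f w : P `<=` Q -> represents Q f w -> represents P f w.
Proof. by move=> PQ [Aw h]; split=> // x /PQ; apply: h. Qed.

Lemma rep_inv P f w : mor F P f -> represents P f w ->
  represents (f @` P) (inv_on P f) w^-1.
Proof.
move=> Ff [Aw h]; have hf := mor_inj_hom fF Ff; have sP := hom_sub hf.
split; first exact: subgroupV.
move=> _ [x Px <-]; rewrite -(homX hf) // (inv_on_f hf); last exact: (subgroupX _ sP).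
by rewrite h // symK.
Qed.

Lemma invT_im P f w t : mor F P f -> represents P f w -> invT P t ->
  invT (f @` P) (w t).
Proof.
move=> Ff [Aw h] [Tt ht]; split=> [|v [Av hv]]; first exact: WT.
have AwV := subgroupV sW Aw.
have : fixW P (w^-1 * (v * w)).
  split; first by apply: (subgroupM sW) => //; apply: (subgroupM sW).
  move=> x Px; rewrite !symM -h // (homX (mor_inj_hom fF Ff)) //.
  by rewrite hv; [rewrite -(homX (mor_inj_hom fF Ff)) // h // symK|exists x].
by move=> /ht; rewrite !symM => e; rewrite -[RHS](congr1 w e) symKV.
Qed.

Lemma core_im P f w t : mor F P f -> represents P f w -> torus_core P t ->
  torus_core (f @` P) (w t).
Proof.
move=> Ff rw [It kt]; split=> [|k]; first exact: invT_im.
have [s Is st] := kt k; exists (w s); first exact: invT_im.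
by rewrite -WX ?st //; [case: rw|apply: invT_sub Is].
Qed.

Lemma core_im_surj P f w u : mor F P f -> represents P f w -> torus_core (f @` P) u ->
  exists2 t, torus_core P t & w t = u.
Proof.
move=> Ff rw Cu; exists (w^-1 u); last by rewrite symKV.
have := core_im (mor_inv fF Ff) (rep_inv Ff rw) Cu.
by rewrite (im_inv_on (mor_inj_hom fF Ff)).
Qed.

Lemma rep_cj P s w : agree T w (cj s) -> Aut F T w -> represents P (cj s) w.
Proof. by move=> ws Aw; split=> // x Px; rewrite ws //; apply: (toral_exp tT). Qed.

Lemma core_norm P x t : subgroup P -> P x -> torus_core P t -> torus_core P (cj x t).
Proof.
move=> sP Px Ct; have [w Aw ws] := W_cj x.
have := core_im (mor_cj fF x sP) (rep_cj P ws Aw) Ct.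
by rewrite ws; [rewrite (sub_normaliser sP Px)|apply: coreT Ct].
Qed.

Lemma core_normaliser P : subgroup P -> P `<=` normaliser (torus_core P).
Proof.
move=> sP x Px; have PxV := subgroupV sP Px.
by apply/normaliserP; split=> t; apply: core_norm.
Qed.

Lemma subgroup_bullet P : subgroup P -> subgroup (bullet P).
Proof. by move=> sP; apply: subgroup_mul (core_normaliser sP); [|apply: subgroup_core]. Qed.

Lemma sub_bullet P : P `<=` bullet P.
Proof. exact/mul_setl/subgroup_core. Qed.

Lemma bulletS P Q : P `<=` Q -> bullet P `<=` bullet Q.
Proof.
by move=> PQ _ [x /PQ Qx [t /(coreS PQ) Ct <-]]; exists x => //; exists t.
Qed.

(** If u and v are the actions of x and f(x) on T, then v w u^-1 also represents f, so it agrees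
    with w on [invT P]. *)
Lemma rep_cj_invT P f w x t : mor F P f -> represents P f w -> P x -> invT P t ->
  w (cj x t) = cj (f x) (w t).
Proof.
move=> Ff rw Px It; have hf := mor_inj_hom fF Ff; have sP := hom_sub hf.
have [u Au ux] := W_cj x; have [v Av vfx] := W_cj (f x).
have Tt := invT_sub It; have PxV := subgroupV sP Px.
rewrite -ux // -vfx; last by apply: WT => //; case: rw.
suff r : represents P f (v * (w * u^-1)).
  have It' : invT P (u t).
    have := invT_im (mor_cj fF x sP) (rep_cj P ux Au) It.
    by rewrite (sub_normaliser sP Px).
  by rewrite (rep_uniq rw r It') !symM symK.
have [Aw hw] := rw; split.
  by apply: (subgroupM sW) => //; apply: (subgroupM sW) => //; apply: subgroupV.
move=> y Py; have Pcy : P (cj x^-1 y) by apply: subgroup_cj.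
have e : u^-1 (y ^+ q) = (cj x^-1 y) ^+ q.
  rewrite -{1}(cjKV x y) -cjX -ux ?symK //; exact: (toral_exp tT).
rewrite !symM e -hw // vfx.
  by rewrite !(homX hf) // cjX -(hom_cj hf) // cjKV.
by rewrite (homX hf) //; apply: (toral_exp tT).
Qed.

End Bullet.

(** * Unique extension of morphisms to the closure *)

Section BulletExtension.
Variables (p : nat) (S : groupType) (T : set S) (q : nat) (F : homsets S).
Hypotheses (p_pr : prime p) (tT : toral p T q) (sF : saturated p F).
Implicit Types (P Q R N A Y Z : set S) (f g h : S -> S) (v w : sym S) (s t u x y z : S).

Let fF := saturated_fusion sF.
Let sT := toral_sub tT.
Let sW := subgroup_Aut fF sT.

Local Notation core := (torus_core p T q F).
Local Notation bullet := (bullet p T q F).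
Local Notation invT := (invT T q F).
Local Notation fixW := (fixW T q F).
Local Notation represents := (represents T q F).

Lemma invT_exp P x : P x -> invT P (x ^+ q).
Proof. by move=> Px; split=> [|w [_ h]]; [exact: (toral_exp tT)|exact: h]. Qed.

(* Compare [f] and [w] through a fully centralized conjugate of [P `&` invT P]. *)
Lemma rep_core P f w y : mor F P f -> represents P f w -> P y -> core P y ->
  f y = w y.
Proof.
move=> Ff rw Py Cy; have hf := mor_inj_hom fF Ff; have sP := hom_sub hf.
have [Aw hw] := rw.
pose Y := P `&` invT P; have sY : subgroup Y.
  by apply: subgroupI => //; apply: (subgroup_invT tT sF).
have YP : Y `<=` P by move=> x [].
have YT : Y `<=` T by move=> x [_ []].
have Yq x : P x -> Y (x ^+ q).
  by move=> Px; split; [exact: (subgroupX _ sP)|exact: invT_exp].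
have FY := mor_sub fF sY YP Ff; have sfY := hom_im (mor_inj_hom fF FY).
have Ycomm x z : Y x -> Y z -> commute x z.
  by move=> /YT Tx /YT Tz; apply: (toral_comm tT).
have [h Fh ch] := exists_fc_conj p_pr tT sF sfY.
have hh := mor_inj_hom fF Fh.
have Fhf : mor F Y (h \o f) by apply: (mor_comp fF FY Fh) => x Yx; exists x.
have [w1 A1 w1E] : exists2 w1, Aut F T w1 & agree Y w1 (h \o f).
  have [] := mor_extend (N := T) sF Fhf _ sT.
  - by rewrite -image_comp.
  - move=> t Tt; apply: centraliser_normaliser => x /YT Tx; exact: (toral_comm tT).
  - move=> t Tt; exists 1 => x Yx; rewrite cj1g (commute_cj _ _).1 //.
    by apply: (toral_comm tT) => //; apply: YT.
  move=> g Fg gE; have [w1 A1 w1g] := torus_Aut p_pr tT sF Fg (fun x k => k).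
  by exists w1 => // x Yx; rewrite w1g ?gE //; apply: YT.
have wI t : core P t -> centraliser (f @` Y) (w t).
  move=> Ct _ [z [Pz Iz] <-]; apply/commute_sym/commute_cj.
  rewrite -(rep_cj_invT p_pr tT sF Ff rw Pz (core_invT Ct)); congr (w _).
  by apply/commute_cj/(toral_comm tT); [case: Iz|exact: coreT Ct].
pose C := w @` core P; have sC : subgroup C.
  have hw' := mor_inj_hom fF (Aut_mor fF Aw).
  exact: (hom_im_sub hw' (subgroup_core tT sF _) (@coreT _ _ _ _ _ _)).
have CN : f @` Y `<=` normaliser C.
  move=> _ [z [Pz Iz] <-].
  have e x : C x -> cj (f z) x = x.
    case=> t Ct <-; rewrite (commute_cj _ _).1 //.
    by apply/commute_sym/wI => //; exists z.
  apply/normaliserP; split=> x Cx; first by rewrite e.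
  by rewrite -{1}(e x Cx) cjK.
(* Both f(y) and w(y) lie in N. Once h is extended to an injective k on N, it remains to compare
   k(f(y)) = w1(y) with k(w(y)) = w2(w(y)). *)
pose N := mul_set (f @` Y) C; have sN : subgroup N by apply: subgroup_mul.
have fYN : f @` Y `<=` N by apply: mul_setl.
have CN' : C `<=` N by apply: mul_setr.
have NfY : N `<=` centraliser (f @` Y).
  move=> _ [_ [x Yx <-] [_ [t Ct <-] <-]]; apply: (subgroupM (@subgroup_centraliser _ _)).
    by move=> _ [z Yz <-]; rewrite /commute -!(homM hf) ?(Ycomm x z) //; apply: YP.
  exact: wI.
have [k Fk kh] : exists2 k, mor F N k & agree (f @` Y) k h.
  apply: (mor_extend sF Fh ch sN).
    by move=> s /NfY; apply: centraliser_normaliser.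
  by move=> s /NfY cs; exists 1 => x Yx; rewrite cj1g; congr h; have [h1 _] := centraliserP (f @` Y) s; apply: h1 x Yx.
have hk := mor_inj_hom fF Fk.
have kCT x : C x -> T (k x).
  case=> t Ct <-; have [u Cu <-] := core_div p_pr tT sF Ct (toral_q tT).
  rewrite (WX sF _ Aw (coreT Cu)).
  by rewrite (homX hk); [exact: (toral_exp tT)|apply: CN'; exists u].
pose M := [set x | [/\ N x, T x & T (k x)]].
have sM : subgroup M.
  apply: mk_subgroup.
  - by split; rewrite ?(hom1 hk); apply: subgroup1.
  - by move=> x z [Nx Tx Tkx] [Nz Tz Tkz]; split; rewrite ?(homM hk) //; apply: subgroupM.
  - by move=> x [Nx Tx Tkx]; split; rewrite ?(homV hk) //; apply: subgroupV.
have [w2 A2 w2E] : exists2 w2, Aut F T w2 & agree M w2 k.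
  apply: (torus_rep p_pr tT sF); first by move=> x [].
    by apply: (mor_sub fF sM _ Fk) => x [].
  by move=> _ [x [_ _ h'] <-].
have MC t : core P t -> M (w t).
  move=> Ct; have Cwt : C (w t) by exists t.
  by split; [exact: CN'|apply: (WT sF Aw); apply: coreT Ct|exact: kCT].
have Mq x : P x -> M (f (x ^+ q)).
  move=> Px; have Yx := Yq x Px; have fYx : (f @` Y) (f (x ^+ q)) by exists (x ^+ q).
  split; first exact: fYN.
    by rewrite (homX hf) //; apply: (toral_exp tT).
  rewrite kh // -[h _]/((h \o f) (x ^+ q)) -w1E //; apply: (WT sF A1); exact: YT.
(* Both sides represent [w1] on P, so they agree on [invT P]. *)
have e : w1 y = (w2 * w) y.
  apply: (rep_uniq tT sF (f := w1) (P := P)); last exact: (core_invT Cy).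
    by split.
  split; first exact: (subgroupM sW).
  move=> x Px; have Yx := Yq x Px; rewrite w1E // symM -hw // w2E; last exact: Mq.
  by rewrite kh //; exists (x ^+ q).
have Yy : Y y by split=> //; exact: (core_invT Cy).
have fYy : (f @` Y) (f y) by exists y.
apply: (hom_inj hk); [exact: fYN|by apply: CN'; exists y|].
by rewrite kh // -[h _]/((h \o f) y) -w1E // e symM w2E //; apply: MC.
Qed.

(** On the core both morphisms act through elements of Aut_F(T) that represent the same restriction
    to P. *)
Lemma bullet_uniq P Q g g' : P `<=` Q -> Q `<=` bullet P -> subgroup P ->
  mor F Q g -> mor F Q g' -> agree P g g' -> agree Q g g'.
Proof.
move=> PQ QP sP Fg Fg' e z Qz; have sQ := mor_subgroup fF Fg.
have [x Px [a Ca xa]] := QP z Qz; have Qx := PQ x Px.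
have Qa : Q a by rewrite -(mulKg x a) xa; apply: (subgroupM sQ) => //; apply: subgroupV.
have [w rw] := exists_rep p_pr tT sF Fg; have [w' rw'] := exists_rep p_pr tT sF Fg'.
have CQa := coreS PQ Ca.
rewrite -xa (homM (mor_inj_hom fF Fg)) // (homM (mor_inj_hom fF Fg')) // e //.
rewrite (rep_core Fg rw Qa CQa) (rep_core Fg' rw' Qa CQa); congr (_ * _).
apply: (rep_uniq tT sF (repS PQ rw) _ (core_invT Ca)).
have [Aw' hw'] := repS PQ rw'; split=> // u Pu; rewrite -hw' // e //.
exact: (subgroupX _ sP).
Qed.

Section Hat.
Variables (P : set S) (f : S -> S) (w : sym S).
Hypotheses (Ff : mor F P f) (rw : represents P f w).

Let hf := mor_inj_hom fF Ff.
Let sP := hom_sub hf.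

(** The candidate extension to the closure, xa -> f(x)w(a). It is well defined because f and w agree
    where P meets the core, by [rep_core]. *)
Definition hat z : S := xget 1 [set y | exists x a, [/\ P x, core P a, z = x * a & y = f x * w a]].

Lemma hatE x a : P x -> core P a -> hat (x * a) = f x * w a.
Proof.
move=> Px Ca; rewrite /hat; case: xgetP => [y -> [x' [a' [Px' Ca' e ->]]]|h]; last first.
  by case: (h (f x * w a)); exists x, a.
have [Aw _] := rw; have Px'V := subgroupV sP Px'.
have sC := subgroup_core tT sF P; have CaV := subgroupV sC Ca.
have e2 : x'^-1 * x = a' * a^-1 by rewrite -[x](mulgK a) e mulgA mulKg.
have P2 : P (x'^-1 * x) by apply: (subgroupM sP).
have C2 : core P (x'^-1 * x) by rewrite e2; apply: (subgroupM sC).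
have := rep_core Ff rw P2 C2; rewrite {2}e2 (homM hf) // (homV hf) //.
have Ta := coreT Ca; have Ta' := coreT Ca'; have TaV := coreT CaV.
rewrite (WM sF Aw Ta' TaV) (WV sF Aw Ta) => e3.
by rewrite -(mulVKg (f x') (f x)) e3 -mulgA mulgVK.
Qed.

Lemma hat_hom : hom (bullet P) [set: S] hat.
Proof.
split=> //; [exact: (subgroup_bullet p_pr tT sF)|exact: subgroupT|].
move=> _ _ [x Px [a Ca <-]] [y Py [b Cb <-]].
have [Aw _] := rw; have PyV := subgroupV sP Py.
have Cc : core P (cj y^-1 a) by apply: (core_norm p_pr tT sF).
have sC := subgroup_core tT sF P.
have e : x * a * (y * b) = x * y * (cj y^-1 a * b) by rewrite /cj invgK !mulgA mulgK.
rewrite e !hatE //; try exact: (subgroupM sP); try exact: (subgroupM sC).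
rewrite (homM hf) // (WM sF Aw (coreT Cc) (coreT Cb)).
rewrite (rep_cj_invT p_pr tT sF Ff rw PyV (core_invT Ca)) (homV hf) //.
by rewrite /cj invgK !mulgA mulgK.
Qed.

Lemma hat_agree : agree P f hat.
Proof.
move=> x Px; rewrite -{2}(mulg1 x) hatE //.
  by have [Aw _] := rw; rewrite (hom1 (mor_inj_hom fF (Aut_mor fF Aw))) mulg1.
exact: (subgroup1 (subgroup_core tT sF P)).
Qed.

Lemma hat_uniq Q g : P `<=` Q -> Q `<=` bullet P -> mor F Q g -> agree P g f ->
  agree Q g hat.
Proof.
move=> PQ QP Fg gf z Qz; have sQ := mor_subgroup fF Fg; have hg := mor_inj_hom fF Fg.
have [x Px [a Ca xa]] := QP z Qz; have Qx := PQ x Px.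
have Qa : Q a by rewrite -(mulKg x a) xa; apply: (subgroupM sQ) => //; apply: subgroupV.
have [v rv] := exists_rep p_pr tT sF Fg.
rewrite -xa hatE // (homM hg) // gf // (rep_core Fg rv Qa (coreS PQ Ca)).
congr (_ * _); have [Av hv] := repS PQ rv.
apply: (rep_uniq tT sF _ rw (core_invT Ca)); split=> // u Pu.
by rewrite -hv // gf //; apply: (subgroupX _ sP).
Qed.

End Hat.

(** An element centralising k(P) acts on T as an element of Aut_F(T) that fixes the q-th powers of
    k(P), hence fixes [invT] of k(P), which contains the image of the core. *)
Lemma centraliser_bullet_im P Q k : P `<=` Q -> Q `<=` bullet P -> subgroup P ->
  mor F Q k -> centraliser (k @` Q) = centraliser (k @` P).
Proof.
move=> PQ QP sP Fk; have sQ := mor_subgroup fF Fk; have hk := mor_inj_hom fF Fk.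
apply/seteqP; split; first exact/centraliserS/image_subset.
move=> s cs _ [z Qz <-]; apply/commute_cj.
have [x Px [a Ca xa]] := QP z Qz; have Qx := PQ x Px.
have Qa : Q a by rewrite -(mulKg x a) xa; apply: (subgroupM sQ) => //; apply: subgroupV.
have [v rv] := exists_rep p_pr tT sF Fk; have CQa := coreS PQ Ca.
rewrite -xa (homM hk) // cjMr.
rewrite (commute_cj s (k x)).1; last by apply: cs; exists x.
congr (_ * _); rewrite (rep_core Fk rv) //.
have Fk' := mor_sub fF sP PQ Fk.
have [_ hI] := invT_im tT sF Fk' (repS PQ rv) (core_invT Ca).
have [u Au us] := W_cj p_pr tT sF s; have [Av _] := rv.
rewrite -us; last by apply: (WT sF Av); apply: coreT Ca.
apply: hI; split=> // _ [y Py <-]; rewrite us; last exact: (toral_exp tT).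
by rewrite cjX (commute_cj s (k y)).1 //; apply: cs; exists y.
Qed.

(** For R between P and its closure, the image of R has the same centraliser as f(P), hence is fully
    centralized, and conjugation inside the closure is lifted by [hat] itself. So the morphism
    extends to the normaliser of R in the closure, where uniqueness identifies it with [hat]
    again. *)
Lemma bullet_extend_fc P Q f : subgroup Q -> P `<=` Q -> Q `<=` bullet P ->
  mor F P f -> fully_centralized p F (f @` P) ->
  exists2 g, mor F Q g & agree P g f.
Proof.
move=> sQ PQ QP Ff cf; have hf := mor_inj_hom fF Ff; have sP := hom_sub hf.
have [w rw] := exists_rep p_pr tT sF Ff.
exists (hat P f w); last by move=> x Px; rewrite -(hat_agree Ff rw).
suff FZ : mor F (bullet P) (hat P f w) by apply: (mor_sub fF sQ QP FZ).
have sZ := subgroup_bullet p_pr tT sF sP.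
apply: (mor_exhaust p_pr tT sF (P := P) (hat_hom Ff rw)).
- exact: (sub_bullet tT sF).
- by apply: (mor_agree fF _ Ff); apply: hat_agree.
move=> R PR RZ FR nR; have sR := mor_subgroup fF FR; have hR := mor_inj_hom fF FR.
have [y [Zy nRy Ny]] := normalizer_grows p_pr tT sR sZ RZ nR.
pose N := normaliser R `&` bullet P.
have sN : subgroup N by apply: subgroupI => //; apply: subgroup_normaliser.
have RN : R `<=` N by move=> x Rx; split; [exact: sub_normaliser|exact: RZ].
have NZ : N `<=` bullet P by move=> x [].
have [_ _ _ hatM] := hat_hom Ff rw.
have hatV x : bullet P x -> hat P f w x^-1 = (hat P f w x)^-1.
  move=> Zx; apply/esym/mulg1_eq; rewrite -hatM ?mulgV //; last exact: subgroupV.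
  exact: (hom1 hR).
have cR : fully_centralized p F (hat P f w @` R).
  move=> _ /(isoclassP fF)[k Fk <-].
  have FkR : mor F R (k \o hat P f w) by apply: (mor_comp fF FR Fk) => x Rx; exists x.
  have e : hat P f w @` P = f @` P.
    by apply/seteqP; split=> _ [x Px <-]; exists x => //; rewrite -(hat_agree Ff rw).
  rewrite image_comp (centraliser_bullet_im PR RZ sP FkR).
  rewrite (centraliser_bullet_im PR RZ sP FR) e -image_comp e; apply: cf.
  apply/(isoclassP fF); exists k => //; apply: (mor_sub fF (hom_im hf)) Fk.
  by rewrite -e; apply: image_subset.
have [] := mor_extend sF FR cR sN.
- by move=> x [].
- move=> s [Ns Zs]; exists (hat P f w s) => x Rx; have Zx := RZ _ Rx.
  have ZsV := subgroupV sZ Zs; have Zsx := subgroupM sZ Zs Zx.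
  by rewrite /cj !hatM // hatV.
move=> g Fg gE; exists N; split=> //; last by move=> h; apply/nRy/h.
have PN : P `<=` N by apply: subset_trans RN.
apply: (mor_agree fF _ Fg); apply: (hat_uniq Ff rw PN NZ Fg) => x Px.
by rewrite gE -?(hat_agree Ff rw) //; apply: PR.
Qed.

Lemma bullet_im P f g : subgroup P -> mor F (bullet P) g -> agree P g f -> mor F P f ->
  g @` bullet P = bullet (f @` P).
Proof.
move=> sP Fg gf Ff; have [w rw] := exists_rep p_pr tT sF Ff.
have Pb := @sub_bullet p S T q F tT sF P.
have gE := hat_uniq Ff rw Pb (fun x k => k) Fg gf.
apply/seteqP; split=> [_ [_ [x Px [a Ca <-]] <-]|_ [_ [x Px <-] [b Cb <-]]].
  rewrite gE; last by exists x => //; exists a.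
  rewrite (hatE Ff rw) //; exists (f x); first by exists x.
  by exists (w a) => //; apply: (core_im tT sF).
have [a Ca <-] := core_im_surj tT sF Ff rw Cb.
have Zxa : bullet P (x * a) by exists x => //; exists a.
by exists (x * a) => //; rewrite gE // (hatE Ff rw).
Qed.

(** For h from f(P) to a fully centralized subgroup, h and [h \o f] extend to the closures, with the
    same image by [bullet_im]; the extension of h is then inverted. *)
Lemma bullet_extend P Q f : subgroup Q -> P `<=` Q -> Q `<=` bullet P ->
  mor F P f -> exists2 g, mor F Q g & agree P g f.
Proof.
move=> sQ PQ QP Ff; have hf := mor_inj_hom fF Ff; have sP := hom_sub hf.
have [h Fh ch] := exists_fc_conj p_pr tT sF (hom_im hf).
have Fhf : mor F P (h \o f) by apply: (mor_comp fF Ff Fh) => x Px; exists x.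
have sZ := subgroup_bullet p_pr tT sF sP.
have Pb R := @sub_bullet p S T q F tT sF R.
have ch' : fully_centralized p F ((h \o f) @` P) by rewrite -image_comp.
have [u Fu uE] := bullet_extend_fc sZ (Pb P) (fun x k => k) Fhf ch'.
have sZ' := subgroup_bullet p_pr tT sF (hom_im hf).
have [k Fk kE] := bullet_extend_fc sZ' (Pb _) (fun x k => k) Fh ch.
have iu := bullet_im sP Fu uE Fhf; have ik := bullet_im (hom_im hf) Fk kE Fh.
rewrite -image_comp -ik in iu.
have Fg : mor F (bullet P) (inv_on (bullet (f @` P)) k \o u).
  apply: (mor_comp fF Fu (mor_inv fF Fk)) => x Zx; rewrite -iu; by exists x.
exists (inv_on (bullet (f @` P)) k \o u); first exact: (mor_sub fF sQ QP Fg).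
move=> x Px /=; rewrite uE //= -kE; last by exists x.
by rewrite (inv_on_f (mor_inj_hom fF Fk)) //; apply: Pb; exists x.
Qed.

End BulletExtension.

(** * The measure of a subgroup and induction on it *)

Section Measure.
Variables (p : nat) (S : groupType) (T : set S) (q : nat) (F : homsets S).
Hypotheses (p_pr : prime p) (tT : toral p T q) (sF : saturated p F).
Implicit Types (P Q R N Y Z M : set S) (f g h : S -> S) (v w : sym S) (s t u x y z : S).

Let fF := saturated_fusion sF.
Let sT := toral_sub tT.
Let sW := subgroup_Aut fF sT.

Local Notation core := (torus_core p T q F).
Local Notation bullet := (bullet p T q F).
Local Notation invT := (invT T q F).
Local Notation fixW := (fixW T q F).

(** The largest such n is the index of [core P] in [bullet P]. *)
Definition incongruent P n := exists c : 'I_n -> S,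
  (forall i, P (c i)) /\ forall i j, core P ((c i)^-1 * c j) -> i = j.

Lemma incongruent_im P f n : mor F P f -> incongruent P n -> incongruent (f @` P) n.
Proof.
move=> Ff [c [cP cI]]; have hf := mor_inj_hom fF Ff; have sP := hom_sub hf.
have [w rw] := exists_rep p_pr tT sF Ff.
exists (f \o c); split=> [i|i j]; first by exists (c i).
have PV := subgroupV sP (cP i); have Pij := subgroupM sP PV (cP j).
rewrite /= -(homV hf) // -(homM hf) // => Cf; apply: cI.
have fPij : (f @` P) (f ((c i)^-1 * c j)) by exists ((c i)^-1 * c j).
have Fi := mor_inv fF Ff; have ri := rep_inv tT sF Ff rw.
have := core_im tT sF Fi ri Cf; rewrite -(rep_core p_pr tT sF Fi ri fPij Cf).
by rewrite (inv_on_f hf) // (im_inv_on hf).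
Qed.

(** The ingredients are the order of the stabiliser [fixW P] and the index of [core P] in
    [bullet P]. Both are invariant: a morphism represented by w conjugates the stabiliser by w and
    preserves incongruence modulo the core, and so does its inverse. *)
Lemma exists_measure : exists mu : set S -> nat,
  (forall P f, mor F P f -> mu (f @` P) = mu P) /\
  (forall P Q, subgroup P -> subgroup Q -> P `<=` Q ->
     (mu Q <= mu P)%N /\ (mu Q = mu P -> Q `<=` bullet P)).
Proof.
have /finite_setP[m /card_IP[e [eW eI eS]]] := finite_W p_pr tT sF.
pose fx P : {set 'I_m} := [set i | `[< fixW P (e i) >]]%SET.
have fxP P i : (i \in fx P) = `[< fixW P (e i) >] by rewrite inE.
have fx_core P Q : fx P = fx Q -> core P = core Q.
  move=> h; rewrite /torus_core; congr (divpart p _).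
  have E w : fixW P w <-> fixW Q w.
    split=> hw; have [Aw _] := hw; have [i ei] := eS w Aw; rewrite -ei in hw *.
      by apply/asboolP; rewrite -fxP -h fxP; apply/asboolP.
    by apply/asboolP; rewrite -fxP h fxP; apply/asboolP.
  by apply/seteqP; split=> t [Tt ht]; split=> // w /E; apply: ht.
have fxS P Q : P `<=` Q -> fx Q \subset fx P.
  move=> PQ; apply/fintype.subsetP => i; rewrite !fxP => /asboolP hi.
  by apply/asboolP; apply: fixWS hi.
have fx0 P : subgroup P -> (0 < #|fx P|)%N.
  move=> sP; have [i ei] := eS 1 (subgroup1 sW).
  apply/card_gt0P; exists i; rewrite fxP; apply/asboolP; rewrite ei.
  by split; [exact: subgroup1 sW|].
have fx_le P f : mor F P f -> (#|fx P| <= #|fx (f @` P)|)%N.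
  move=> Ff; have hf := mor_inj_hom fF Ff; have [w [Aw hw]] := exists_rep p_pr tT sF Ff.
  have AwV := subgroupV sW Aw.
  have [si hsi] := choice (fun i => eS _ (subgroupM sW Aw (subgroupM sW (eW i) AwV))).
  have siI : injective si.
    move=> i j h; apply: eI; have := hsi i; rewrite h hsi => /mulgI.
    by move=> /mulIg.
  rewrite -(card_imset _ siI); apply/subset_leq_card/fintype.subsetP => _ /imsetP[i hi ->].
  move: hi; rewrite !fxP => /asboolP[_ hi]; apply/asboolP; split; first exact: eW.
  move=> _ [x Px <-]; rewrite hsi -(homX hf) // hw // !symM symK.
  by rewrite hi.
have fx_eq P f : mor F P f -> #|fx (f @` P)| = #|fx P|.
  move=> Ff; apply/eqP; rewrite eqn_leq fx_le // andbT.
  by have := fx_le _ _ (mor_inv fF Ff); rewrite (im_inv_on (mor_inj_hom fF Ff)).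
pose fixed (A : {set 'I_m}) : set S := [set t | T t /\ forall i, i \in A -> e i t = t].
have sfixed A : subgroup (fixed A).
  apply: mk_subgroup.
  - split=> [|i _]; first exact: subgroup1.
    exact: (hom1 (mor_inj_hom fF (Aut_mor fF (eW i)))).
  - move=> t u [Tt ht] [Tu hu]; split=> [|i Ai]; first exact: subgroupM.
    by rewrite (WM sF (eW i) Tt Tu) ht ?hu.
  - move=> t [Tt ht]; split=> [|i Ai]; first exact: subgroupV.
    by rewrite (WV sF (eW i) Tt) ht.
have [ex hex] := choice (fun A => divpart_exp p_pr tT (sfixed A) (fun t (h : fixed A t) => h.1)).
(* [invT P] is determined by a subset of the finite group Aut_F(T), so one exponent p^E sends
   [invT P] into the core for all P. *)
pose E := \max_A ex A.
have invE P : invT P = fixed (fx P).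
  apply/seteqP; split=> t [Tt ht]; split=> //.
    by move=> i; rewrite fxP => /asboolP; apply: ht.
  by move=> w hw; have [i ei] := eS w hw.1; rewrite -ei; apply: ht; rewrite fxP ei; apply/asboolP.
have invexp P x : invT P x -> core P (x ^+ (p ^ E)).
  rewrite /torus_core invE => hx; rewrite -(subnK (leq_bigmax (fx P) : (ex (fx P) <= E)%N)).
  rewrite addnC expnD expgnA; apply: subgroupX; last exact: hex.
  exact: (subgroup_divpart tT (sfixed _) (fun t (h : fixed _ t) => h.1)).
have qE0 : (0 < q * p ^ E)%N by rewrite muln_gt0 (toral_q tT) (p_gt0 p_pr).
have /finite_setP[k /card_IP[z [_ _ zS]]] := toral_fin tT qE0.
have [d [_ dS _]] := (has_index_reps _ _ sT).1 (toral_index tT).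
(* Elements of P in the same coset of T differ by an element of P in T. Its q-th power is in
   [invT P], so its (q p^E)-th power is in the core and it is congruent to one of the k elements of
   T of exponent q p^E. *)
have bound P n : subgroup P -> incongruent P n -> (n <= q * k)%N.
  move=> sP [c [cP cI]].
  have [cl hcl] := choice (fun i => dS (c i) Logic.I).
  have exr (j : 'I_q) : exists r, forall i, cl i = j -> P r /\ T (r^-1 * c i).
    case: (pselect (exists i, cl i = j)) => [[i0 ij]|h]; last first.
      by exists 1 => i ij; case: h; exists i.
    exists (c i0) => i ij'; split=> //.
    have := subgroupM sT (subgroupV sT (hcl i0)) (hcl i).
    by rewrite ij ij' invgM invgK !mulgA mulgK.
  have [r hr] := choice exr.
  have exz i : exists j, core P ((r (cl i) * z j)^-1 * c i).
    have [Pr Tri] := hr (cl i) i erefl.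
    have Pri : P ((r (cl i))^-1 * c i) by apply: (subgroupM sP) => //; apply: subgroupV.
    have Cri : core P (((r (cl i))^-1 * c i) ^+ (q * p ^ E)).
      by rewrite expgnA; apply: invexp; exact: (invT_exp F tT Pri).
    have [t [u [Ct Tu un e1]]] := divpart_split p_pr tT (subgroup_invT tT sF P)
      (@invT_sub _ _ _ _ P) Tri qE0 Cri.
    have [j zj] := zS u (conj Tu un); exists j; rewrite zj invgM -mulgA e1.
    by rewrite (toral_comm tT (coreT Ct) Tu) mulKg.
  have [j hj] := choice exz.
  have inj : injective (fun i => (cl i, j i)).
    move=> i1 i2 [ecl ej]; apply: cI; have := hj i1; rewrite ecl ej => h1.
    have := subgroupM (subgroup_core tT sF P) (subgroupV (subgroup_core tT sF P) h1) (hj i2).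
    by rewrite invgM invgK -mulgA mulVKg.
  by have := leq_card _ inj; rewrite card_prod !card_ord.
pose B := (q * k)%N.
have exi P : exists n, subgroup P -> incongruent P n /\ forall n', incongruent P n' -> (n' <= n)%N.
  case: (pselect (subgroup P)) => [sP|nsP]; last by exists 0%N.
  have ne : exists n, `[< incongruent P n >].
    by exists 0%N; apply/asboolP; exists (fun=> 1); split=> [[]|[]].
  have bd n : `[< incongruent P n >] -> (n <= B)%N by move/asboolP; apply: bound.
  exists (ex_maxn ne bd) => _; case: ex_maxnP => n /asboolP hn hmax; split=> // n' hn'.
  by apply: hmax; apply/asboolP.
have [idx hidx] := choice exi.
have idxB P : subgroup P -> (idx P <= B)%N.
  by move=> sP; apply: (bound P) => //; case: (hidx P sP).
have idx_le P f : mor F P f -> (idx P <= idx (f @` P))%N.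
  move=> Ff; have hf := mor_inj_hom fF Ff.
  have [_] := hidx _ (hom_im hf); apply.
  by apply: incongruent_im => //; case: (hidx P (hom_sub hf)).
have idx_eq P f : mor F P f -> idx (f @` P) = idx P.
  move=> Ff; apply/eqP; rewrite eqn_leq idx_le // andbT.
  by have := idx_le _ _ (mor_inv fF Ff); rewrite (im_inv_on (mor_inj_hom fF Ff)).
(* Larger P have smaller fx P; when fx P is constant so is core P, and then
   idx P = |P : core P|, which is bounded by B, grows. *)
exists (fun P => #|fx P| * B.+1 - idx P)%N; split.
  by move=> P f Ff; rewrite fx_eq ?idx_eq.
move=> P Q sP sQ PQ.
have iP := idxB P sP; have iQ := idxB Q sQ; have P0 := fx0 P sP; have Q0 := fx0 Q sQ.
have := subset_leq_card (fxS P Q PQ); rewrite leq_eqVlt => /orP[/eqP e1|lt]; last first.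
  have h : ((#|fx Q|).+1 * B.+1 <= #|fx P| * B.+1)%N by rewrite leq_mul2r lt orbT.
  rewrite mulSn in h; split; lia.
have e2 : fx Q = fx P by apply/eqP; rewrite eqEcard fxS //= e1.
have Ce := fx_core _ _ e2.
have [[c [cP cI]] maxP] := hidx P sP; have [_ maxQ] := hidx Q sQ.
have PQi : (idx P <= idx Q)%N.
  by apply: maxQ; exists c; split=> [i|i j]; [exact: PQ|rewrite Ce; exact: cI].
have h : (B.+1 <= #|fx P| * B.+1)%N by rewrite leq_pmull.
rewrite e2; split; first lia.
move=> e3; have {}e3 : idx Q = idx P by lia.
move=> y Qy; apply: contrapT => nb.
have : incongruent Q (idx P).+1.
  exists (fun i : 'I_(idx P).+1 => if unlift ord_max i is Some j then c j else y).
  have nC j : ~ core P ((c j)^-1 * y).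
    by move=> Cy; apply: nb; exists (c j) => //; exists ((c j)^-1 * y); rewrite ?mulVKg.
  have sC := subgroup_core tT sF P.
  split=> [i|i j]; first by case: (unlift ord_max i) => [j|//]; apply: PQ.
  rewrite Ce; case: unliftP => [i'|] ->; case: unliftP => [j'|] -> //.
  - by move/cI => ->.
  - by move/nC.
  - by move/(subgroupV sC); rewrite invgM invgK => /nC.
by move/maxQ; rewrite e3 ltnn.
Qed.

(** Induction on [mu] inside Z in which M is first replaced by the part of its closure in Z.
    Afterwards every strictly larger subgroup of Z has smaller measure, which is what the main case
    receives. *)
Lemma bullet_ind (mu : set S -> nat) Z (X : set S -> Prop) : subgroup Z ->
  (forall P Q, subgroup P -> subgroup Q -> P `<=` Q ->
     (mu Q <= mu P)%N /\ (mu Q = mu P -> Q `<=` bullet P)) ->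
  (forall M, subgroup M -> M `<=` Z -> X (bullet M `&` Z) -> X M) ->
  (forall M, subgroup M -> M `<=` Z ->
     (forall M', subgroup M' -> M' `<=` Z -> M `<=` M' -> ~ M' `<=` M -> (mu M' < mu M)%N) ->
     (forall M', subgroup M' -> M' `<=` Z -> (mu M' < mu M)%N -> X M') -> X M) ->
  forall M, subgroup M -> M `<=` Z -> X M.
Proof.
move=> sZ hmu Xa Xb M; have [n] := ubnP (mu M).
elim: n M => // n IH M; rewrite ltnS => Mn sM MZ.
pose M1 := bullet M `&` Z.
have sM1 : subgroup M1 by apply: subgroupI => //; apply: (subgroup_bullet p_pr tT sF).
have MM1 : M `<=` M1 by move=> x Mx; split; [exact: (sub_bullet tT sF Mx)|exact: MZ].
have M1Z : M1 `<=` Z by move=> x [].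
apply: Xa => //; rewrite -/M1.
have [le1 _] := hmu M M1 sM sM1 MM1.
case: (ltnP (mu M1) (mu M)) => [lt|ge]; first by apply: IH => //; apply: leq_trans Mn.
have eM : mu M1 = mu M by apply/eqP; rewrite eqn_leq le1.
apply: Xb => // [M' sM' M'Z M1M' nM'|M' sM' M'Z lt].
  have [le2 _] := hmu M1 M' sM1 sM' M1M'.
  rewrite ltn_neqAle le2 andbT; apply/eqP => e; apply: nM' => x M'x; split; last exact: M'Z.
  have [_] := hmu M M' sM sM' (subset_trans MM1 M1M'); apply=> //.
  by rewrite e.
by apply: IH => //; apply: leq_trans lt _; rewrite eM.
Qed.

End Measure.

(** * Centric subgroups and Alperin's fusion theorem *)

Section Centric.
Variables (p : nat) (S : groupType) (T : set S) (q : nat) (F : homsets S).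
Hypotheses (p_pr : prime p) (tT : toral p T q) (sF : saturated p F).
Implicit Types (P Q R N M Z : set S) (f g h k : S -> S) (a b u v : sym S) (s t x y z : S).

Let fF := saturated_fusion sF.
Let sT := toral_sub tT.

Lemma centralP Q : centraliser Q = center Q <-> centraliser Q `<=` Q.
Proof.
split=> [e x|h]; first by rewrite e => -[].
by apply/seteqP; split=> [x cx|x []//]; split=> //; apply: h.
Qed.

Lemma centric_im P f : centric F P -> mor F P f -> centric F (f @` P).
Proof.
move=> [sP cP] Ff; split; first exact/hom_im/(mor_inj_hom fF Ff).
by move=> Q hQ; apply: cP; apply: (isoclass_trans fF) hQ; apply: isoclass_im.
Qed.

Lemma centric_over P Q : centric F P -> subgroup Q -> P `<=` Q -> centric F Q.
Proof.
move=> [sP cP] sQ PQ; split=> // _ /(isoclassP fF)[f Ff <-].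
apply/centralP => x cx; have Ff' := mor_sub fF sP PQ Ff.
have [y Py <-] : (f @` P) x; last by exists y => //; apply: PQ.
have h := (centralP _).1 (cP _ (isoclass_im fF Ff')).
by apply: h; apply: centraliserS cx; apply: image_subset.
Qed.

Lemma mor_setT f : mor F [set: S] f -> f @` [set: S] = [set: S].
Proof.
move=> Ff; have hf := mor_inj_hom fF Ff; apply/seteqP; split=> // y _.
have [//|x _ xy] := coHopf p_pr tT (subgroupT S) (f := f) _
  (fun x y hx hy => homM hf hx hy) (fun x y hx hy => hom_inj hf hx hy) (I : [set: S] y).
by exists x.
Qed.

Lemma centric_setT : centric F [set: S].
Proof.
split; first exact: subgroupT.
by move=> _ /(isoclassP fF)[f /mor_setT -> <-]; apply/centralP.
Qed.

(** All conjugates have their centre as centraliser, and these centres are isomorphic. *)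
Lemma centric_fc P : centric F P -> fully_centralized p F P.
Proof.
move=> [sP cP] _ /(isoclassP fF)[f Ff <-]; have hf := mor_inj_hom fF Ff.
rewrite /order_le (cP _ (isoclass_im fF Ff)) (cP _ (isoclass_refl fF sP)).
suff -> : center (f @` P) = f @` center P.
  rewrite pt_order_im; first exact: Order.POrderTheory.le_refl.
  apply: (inj_hom_sub hf); last by move=> x [].
  by apply: subgroupI => //; apply: subgroup_centraliser.
apply/seteqP; split=> [_ [[x Px <-] cx]|_ [x [Px cx] <-]].
  exists x => //; split=> // y Py; apply: (hom_inj hf); try exact: subgroupM.
  by rewrite !(homM hf) //; apply: cx; exists y.
by split; [exists x|apply: (hom_centraliser hf)].
Qed.

Definition RC P : set S := mul_set P (centraliser P).

Lemma normaliser_cent P : normaliser P `<=` normaliser (centraliser P).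
Proof.
move=> x Nx; have e z c y : normaliser P z -> centraliser P c -> P y -> cj (cj z c) y = y.
  move=> Nz cc Py; rewrite /cj !invgM invgK.
  rewrite (_ : _ * y * _ = cj z (cj c (cj z^-1 y))); last by rewrite /cj invgK !mulgA.
  by rewrite ((centraliserP _ _).1 cc) ?cjKV //; apply: normaliser_cj Py; apply: normaliserV.
have NxV := normaliserV Nx.
by apply/normaliserP; split=> c cc; apply/centraliserP => y; apply: e.
Qed.

Lemma norm_cent P : subgroup P -> P `<=` normaliser (centraliser P).
Proof. by move=> sP x /(sub_normaliser sP)/normaliser_cent. Qed.

Lemma subgroup_RC P : subgroup P -> subgroup (RC P).
Proof. by move=> sP; exact: (subgroup_mul sP (@subgroup_centraliser _ _) (norm_cent sP)). Qed.

Lemma sub_RC P : P `<=` RC P. Proof. exact/mul_setl/subgroup_centraliser. Qed.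

Lemma cent_RC P : subgroup P -> centraliser P `<=` RC P.
Proof. by move=> sP; apply: mul_setr. Qed.

Lemma RC_normaliser P : subgroup P -> RC P `<=` normaliser P.
Proof.
move=> sP _ [x Px [c cc <-]]; apply: normaliserM; first exact: sub_normaliser.
exact: centraliser_normaliser.
Qed.

Lemma RC_liftable P f s : inj_hom P [set: S] f -> RC P s -> liftable P f s.
Proof.
move=> hf [x Px [c cc <-]]; exists (f x) => y Py.
by rewrite cjM ((centraliserP _ _).1 cc) // (hom_cj hf).
Qed.

Lemma mor_RC P Q f : mor F Q f -> subgroup P -> P `<=` Q ->
  forall x, Q x -> RC P x -> RC (f @` P) (f x).
Proof.
move=> Ff sP PQ z Qxc [x Px [c cc e]]; rewrite -e in Qxc *; have hf := mor_inj_hom fF Ff.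
have Qc : Q c by apply: (subgroup_divl (hom_sub hf) _ Qxc); exact: PQ.
rewrite (homM hf) //; last exact: PQ.
exists (f x); first by exists x.
exists (f c) => // _ [y Py <-].
by rewrite /commute -!(homM hf) ?(cc y Py) //; apply: PQ.
Qed.

Lemma mor_cent P Q f c : mor F Q f -> P `<=` Q -> Q c -> centraliser P c ->
  centraliser (f @` P) (f c).
Proof.
move=> Ff PQ Qc cc _ [y Py <-]; have hf := mor_inj_hom fF Ff.
by rewrite /commute -!(homM hf) ?(cc y Py) //; apply: PQ.
Qed.

Lemma extend_RC P f : mor F P f -> fully_centralized p F (f @` P) ->
  exists2 g, mor F (RC P) g & agree P g f.
Proof.
move=> Ff cf; have hf := mor_inj_hom fF Ff; have sP := hom_sub hf.
apply: (mor_extend sF Ff cf (subgroup_RC sP) (RC_normaliser sP)).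
by move=> s; apply: RC_liftable.
Qed.

Lemma RC_onto P g : subgroup P -> mor F (RC P) g -> g @` P = P -> g @` RC P = RC P.
Proof.
move=> sP Fg gP; have hg := mor_inj_hom fF Fg; have sR := subgroup_RC sP.
have gR x : RC P x -> RC P (g x).
  by move=> Rx; rewrite -{1}gP; apply: (mor_RC Fg sP (@sub_RC P) Rx Rx).
apply/seteqP; split=> [_ [x Rx <-]|y Ry]; first exact: gR.
have [x Rx xy] := coHopf p_pr tT sR gR (fun x y hx hy => homM hg hx hy)
  (fun x y hx hy => hom_inj hg hx hy) Ry.
by exists x.
Qed.

(** For h defined on [RC P], the inverse of h on h(P) extends to a morphism k on [RC (h P)], and
    [k \o h] maps [RC P] onto itself by the co-Hopf property. An s centralising h(RC P) lies in
    [RC (h P)], so k(s) = k(h(r)) for some r in [RC P], and s = h(r). *)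
Lemma RC_centric P : subgroup P -> fully_centralized p F P -> centric F (RC P).
Proof.
move=> sP cP; have sR := subgroup_RC sP; split=> // _ /(isoclassP fF)[h Fh <-].
have PR := @sub_RC P; have Fh' := mor_sub fF sP PR Fh.
have hh := mor_inj_hom fF Fh; have hh' := mor_inj_hom fF Fh'.
have Fi := mor_inv fF Fh'.
have iP : inv_on P h @` (h @` P) = P by apply: (im_inv_on hh').
have [|k Fk kE] := extend_RC Fi; first by rewrite iP.
have hk := mor_inj_hom fF Fk; have sP2 := hom_im hh'.
have hR x : RC P x -> RC (h @` P) (h x).
  by move=> Rx; apply: (mor_RC Fh sP PR Rx Rx).
have kP : k @` (h @` P) = P.
  rewrite -[RHS]iP; apply/seteqP; split=> _ [x Px <-]; exists x => //; by rewrite kE.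
have kR x : RC (h @` P) x -> RC P (k x).
  by move=> Rx; rewrite -kP; apply: (mor_RC Fk sP2 (@sub_RC _) Rx Rx).
have Fkh : mor F (RC P) (k \o h) by apply: (mor_comp fF Fh Fk).
have := RC_onto sP Fkh; rewrite -image_comp kP => /(_ erefl) onto.
apply/centralP => s cs.
have cs' : centraliser (h @` P) s by apply: centraliserS cs; apply: image_subset.
have Rs := cent_RC sP2 cs'.
have [r Rr e] : ((k \o h) @` RC P) (k s) by rewrite onto; apply: kR.
by exists r => //; apply: (hom_inj hk) e => //; apply: hR.
Qed.

Lemma fc_not_centric P : subgroup P -> fully_centralized p F P -> ~ centric F P ->
  ~ RC P `<=` P.
Proof.
move=> sP cP nP RP; apply: nP; suff <- : RC P = P by apply: RC_centric.
by apply/seteqP; split=> //; apply: sub_RC.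
Qed.

(** An overgroup M' of f(P) of equal measure would lie in the closure of f(P); the inverse of f
    would extend to it and map it to a strictly larger overgroup of P of equal measure. *)
Lemma closed_im (mu : set S -> nat) P f :
  (forall P f, mor F P f -> mu (f @` P) = mu P) ->
  (forall P Q, subgroup P -> subgroup Q -> P `<=` Q ->
     (mu Q <= mu P)%N /\ (mu Q = mu P -> Q `<=` bullet p T q F P)) ->
  (forall M', subgroup M' -> P `<=` M' -> ~ M' `<=` P -> (mu M' < mu P)%N) ->
  mor F P f ->
  forall M', subgroup M' -> f @` P `<=` M' -> ~ M' `<=` f @` P -> (mu M' < mu P)%N.
Proof.
move=> muF muS cl Ff M' sM' fPM' nM'; have hf := mor_inj_hom fF Ff.
have sfP := hom_im hf; have [le eq] := muS _ _ sfP sM' fPM'.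
rewrite muF // in le eq; rewrite ltn_neqAle le andbT; apply/eqP => e.
have [g Fg gE] := bullet_extend p_pr tT sF sM' fPM' (eq e) (mor_inv fF Ff).
have hg := mor_inj_hom fF Fg.
have gP : g @` (f @` P) = P.
  rewrite -[RHS](im_inv_on hf (fun x i => i)).
  by apply/seteqP; split=> _ [x Px <-]; exists x => //; rewrite gE.
have := cl (g @` M') (hom_im hg); rewrite muF // e ltnn => h; suff : false by [].
apply: h; first by rewrite -{1}gP; apply: image_subset.
move=> gM'; apply: nM' => y M'y; have Pgy : P (g y) by apply: gM'; exists y.
rewrite -gP in Pgy; case: Pgy => z fPz zy.
by rewrite -(hom_inj hg (fPM' _ fPz) M'y zy).
Qed.

End Centric.

Section Twist.
Variable S : groupType.
Implicit Types (a : sym S) (f : S -> S).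

Definition twist a f (x : S) : S := a^-1 (f x).
Definition cjm a f (x : S) : S := a (f (a^-1 x)).

End Twist.

(** * Alperin's fusion theorem relative to a subsystem *)

Section Alperin.
Variables (p : nat) (S : groupType) (T : set S) (q : nat) (F E : homsets S).
Hypotheses (p_pr : prime p) (tT : toral p T q) (sF : saturated p F)
  (fE : fusion_system E) (EF : subsystem E F).
Implicit Types (P Q R N M Z : set S) (f g h k : S -> S) (a b u v : sym S) (s t x y z : S).

Let fF := saturated_fusion sF.
Let A := Aut F [set: S].
Let sA : subgroup A := subgroup_Aut fF (subgroupT S).

Hypothesis E_norm : forall a P f, A a -> mor E P f -> mor E (a @` P) (cjm a f).

Definition factors P f := exists2 a, A a & mor E P (twist a f).

Lemma factors_mor P f : factors P f -> mor F P f.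
Proof.
move=> [a Aa Ef]; have := mor_comp fF (EF Ef) (Aut_mor fF Aa) (fun x _ => Logic.I).
by apply: (mor_agree fF) => x _ /=; rewrite /twist symKV.
Qed.

Lemma factors_A a P : A a -> subgroup P -> factors P a.
Proof.
move=> Aa sP; exists a => //; apply: (mor_agree fE _ (mor_id fE sP)) => x _ /=.
by rewrite /twist symK.
Qed.

Lemma factors_E P f : mor E P f -> factors P f.
Proof.
move=> Ef; exists 1; first exact: (subgroup1 sA).
by apply: (mor_agree fE _ Ef) => x _; rewrite /twist -{1}(symKV 1 (f x)).
Qed.

Lemma factors_agree P f g : agree P f g -> factors P f -> factors P g.
Proof.
move=> fg [a Aa Ef]; exists a => //; apply: (mor_agree fE _ Ef) => x Px.
by rewrite /twist fg.
Qed.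

Lemma factors_sub P Q f : subgroup P -> P `<=` Q -> factors Q f -> factors P f.
Proof. by move=> sP PQ [a Aa Ef]; exists a => //; apply: (mor_sub fE sP PQ Ef). Qed.

Lemma factors_comp P Q f g : factors P f -> factors Q g -> (forall x, P x -> Q (f x)) ->
  factors P (g \o f).
Proof.
move=> [a Aa Ef] [b Ab Eg] fPQ; exists (b * a); first exact: (subgroupM sA).
have AaV := subgroupV sA Aa; have Ec := E_norm AaV Eg.
have h : mor E P (cjm a^-1 (twist b g) \o twist a f).
  by apply: (mor_comp fE Ef Ec) => x Px; exists (f x) => //; apply: fPQ.
apply: (mor_agree fE _ h) => x Px.
by rewrite /cjm /twist /= invgK symKV invgM symM.
Qed.

Lemma factors_inv P f : factors P f -> factors (f @` P) (inv_on P f).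
Proof.
move=> hf; have Ff := factors_mor hf; have [a Aa Ef] := hf.
have hhf := mor_inj_hom fF Ff; have hEf := mor_inj_hom fE Ef.
exists a^-1; first exact: (subgroupV sA).
have := E_norm Aa (mor_inv fE Ef).
have -> : a @` (twist a f @` P) = f @` P.
  rewrite image_comp; apply/seteqP; split=> _ [x Px <-]; exists x => //=;
  by rewrite /twist symKV.
apply: (mor_agree fE) => _ [x Px <-].
by rewrite /twist /cjm invgK (inv_on_f hhf) //; congr (a _); apply: (inv_on_f hEf Px).
Qed.

(** These conjugates generate the normal closure of Aut_S(P) in Aut_F(P), the part supplied by the
    Frattini argument. *)
Hypothesis E_centric : forall P, centric F P -> forall a b, Aut F P a ->
  Aut (homS (S:=S)) P b -> mor E P (cj a b : sym S).

(** Everything reduces to an automorphism of a fully normalized P1. If P1 is not centric, it extends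
    to the larger group [RC P1]. Otherwise it is a product u v with u in the normal closure of
    Aut_S(P1), hence in E, and v extending to N_S(P1). The subsystem E is left general because the
    theorem is applied to [E1], to [Opstar], and inside a subsystem of index prime to p. *)
Theorem alperin P f : mor F P f -> factors P f.
Proof.
move=> Ff; have sP := mor_subgroup fF Ff.
have [mu [muF muS]] := exists_measure p_pr tT sF.
move: f Ff; pose X M := forall f, mor F M f -> factors M f.
apply: (bullet_ind (mu := mu) (Z := [set: S]) (X := X) p_pr tT sF) sP _ => //.
- exact: subgroupT.
- move=> M sM _; rewrite setIT => XB f Ff; have MB := @sub_bullet p S T q F tT sF M.
  have [g Fg gf] := bullet_extend p_pr tT sF (subgroup_bullet p_pr tT sF sM) MB
    (@subset_refl _ _) Ff.
  exact/(factors_agree gf)/(factors_sub sM MB)/XB.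
move=> M sM _ cl XM f Ff.
have cl' : forall M', subgroup M' -> M `<=` M' -> ~ M' `<=` M -> (mu M' < mu M)%N.
  by move=> M' sM' MM' nM'; apply: cl.
(* Q = S is the base case, where morphisms are automorphisms of S; otherwise N has smaller
   measure. *)
have big Q g N : isoclass F M Q -> subgroup N -> Q `<=` N -> (N `<=` Q -> Q = [set: S]) ->
    mor F N g -> factors Q g.
  move=> /(isoclassP fF)[k Fk <-] sN QN nN Fg; have sQ := hom_im (mor_inj_hom fF Fk).
  case: (pselect (N `<=` k @` M)) => [/nN e|h].
    have NT : N = [set: S] by apply/seteqP; split=> // x _; apply: QN; rewrite e.
    rewrite e; rewrite NT in Fg.
    have [a Aa aE] := Aut_of fF Fg (mor_setT p_pr tT sF Fg).
    apply: factors_agree (factors_A Aa (subgroupT S)) => x Px; exact: aE.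
  apply: (factors_sub sQ QN); apply: XM => //.
  exact: (closed_im p_pr tT sF muF muS cl' Fk sN QN h).
have nbig Q : subgroup Q -> normaliser Q `<=` Q -> Q = [set: S].
  move=> sQ NQ; apply/seteqP; split=> // x _; apply: contrapT => nQx.
  have nZ : ~ [set: S] `<=` Q by move=> h; apply/nQx/h.
  have [y [_ nQy Ny]] := normalizer_grows p_pr tT sQ (subgroupT S) (fun x _ => Logic.I) nZ.
  by apply/nQy/NQ.
have [r Fr nr] := exists_fn_conj p_pr tT sF sM.
set P1 := r @` M in nr; have sP1 : subgroup P1 by exact: hom_im (mor_inj_hom fF Fr).
have MP1 : isoclass F M P1 by apply: isoclass_im.
have rec Q : isoclass F M Q -> exists h, [/\ mor F Q h, h @` Q = P1 & factors Q h].
  move=> MQ; have [_ sQ] := isoclass_subgroup fF MQ.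
  have /(isoclassP fF)[g Fg gQ] := isoclass_trans fF (isoclass_sym fF MQ) MP1.
  rewrite -gQ in nr; have [h Fh hQ] := fn_receptive p_pr tT sF Fg nr.
  have QN := sub_normaliser sQ.
  exists h; split; [exact: (mor_sub fF sQ QN Fh)|by rewrite hQ|].
  by apply: (big Q h (normaliser Q)) => //; [exact: subgroup_normaliser|exact: nbig].
have MM := isoclass_refl fF sM; have MfM := isoclass_im fF Ff.
have [h0 [F0 h0P g0]] := rec M MM; have [h1 [F1 h1P g1]] := rec (f @` M) MfM.
have hh0 := mor_inj_hom fF F0; have hh1 := mor_inj_hom fF F1.
have Fal : mor F P1 (h1 \o (f \o inv_on M h0)).
  rewrite -h0P; apply: (mor_comp fF (Q := f @` M) _ F1).
    by apply: (mor_comp fF (mor_inv fF F0) Ff) => y; apply: inv_on_in.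
  by move=> y h0y; exists (inv_on M h0 y) => //; apply: inv_on_in.
have [al Aal alE] : exists2 al, Aut F P1 al & agree P1 al (h1 \o (f \o inv_on M h0)).
  apply: (Aut_of fF Fal); rewrite -image_comp -image_comp -{1}h0P.
  by rewrite (im_inv_on hh0).
suff gal : factors P1 al.
  have g2 : factors M (al \o h0).
    by apply: (factors_comp g0 gal) => x Mx; rewrite -h0P; exists x.
  have gi := factors_inv g1; rewrite h1P in gi.
  have g3 : factors M (inv_on (f @` M) h1 \o (al \o h0)).
    by apply: (factors_comp g2 gi) => x Mx; apply: (Aut_in fF Aal); rewrite -h0P; exists x.
  apply: factors_agree g3 => x Mx /=; rewrite alE /=; last by rewrite -h0P; exists x.
  by rewrite (inv_on_f hh0) // (inv_on_f hh1) //; exists x.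
have cP1 := fn_fc sF sP1 nr.
have Fal1 := Aut_mor fF Aal.
case: (pselect (centric F P1)) => [ceP1|nce]; last first.
  have nRC := fc_not_centric p_pr tT sF sP1 cP1 nce.
  have alP : al @` P1 = P1 by case/(AutP fF): Aal.
  have [|g Fg ge] := extend_RC sF Fal1; first by rewrite alP.
  apply: (factors_agree ge); apply: (big P1 g (RC P1)) => //.
    exact: (subgroup_RC sP1).
  exact: sub_RC.
have sAP := subgroup_Aut fF sP1; have sBP := subgroup_AutS sP1.
have BA := AutS_Aut fF sP1.
have tB := AutS_ptorsion fF sP1 (toral_p tT).
have [u [v [Ou Av aluv vB]]] :=
  frattini p_pr sAP sBP BA (fn_sylow p_pr sF sP1 nr) tB Aal.
have gv : factors P1 v.
  have vP : v @` P1 = P1 by case/(AutP fF): Av.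
  have [] := mor_extend sF (Aut_mor fF Av) _ (subgroup_normaliser P1) (fun x i => i).
  - by rewrite vP.
  - move=> s Ns; have [b Bb bs] := AutS_of sP1 Ns.
    have [_ [t Nt te]] := (AutSP _ sP1).1 (vB b Bb).
    exists t => x Px; rewrite -te; last exact: (Aut_in fF Av).
    by rewrite cjE !symM symK bs.
  move=> g Fg ge; apply: (factors_agree ge).
  apply: (big P1 g (normaliser P1)) => //; first exact: subgroup_normaliser.
    exact: sub_normaliser.
  exact: nbig.
have gu : mor E P1 u.
  suff : nclosure (Aut F P1) (Aut (homS (S:=S)) P1) `<=` Aut F P1 `&` [set c | mor E P1 (c : sym S)].
    by move=> /(_ u Ou)[].
  have inA c : Aut F P1 c -> c @` P1 = P1 by case/(AutP fF).
  apply: gen_subset; last first.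
    move=> _ [x Ax [b Bb <-]]; split; last exact: E_centric.
    by apply: subgroup_cj => //; apply: BA.
  apply: mk_subgroup.
  - by split; [exact: subgroup1|exact: (mor_id fE sP1)].
  - move=> x y [Ax Ex] [Ay Ey]; split; first exact: subgroupM.
    by apply: (mor_comp fE Ey Ex) => z Pz; apply: (Aut_in fF Ay).
  - move=> x [Ax Ex]; split; first exact: subgroupV.
    have := mor_inv fE Ex; rewrite (inA x Ax); apply: (mor_agree fE) => z.
    rewrite -{1}(inA x Ax) => -[y Py <-].
    by rewrite symK (inv_on_f (mor_inj_hom fE Ex)).
rewrite aluv; apply: factors_agree (factors_comp gv (factors_E gu) _) => // x Px.
exact: (Aut_in fF Av).
Qed.

End Alperin.

(** * Labels *)

Section OpprimeBasics.
Variables (p : nat) (G : groupType).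
Hypothesis p_pr : prime p.
Implicit Types (A N : set G) (x y : G).

Lemma Opprime_sub A : subgroup A -> Opprime p A `<=` A.
Proof.
move=> sA x; apply; split; first by split=> //; exact: sub_normaliser.
exists 1%N; last by rewrite dvdn1 neq_ltn prime_gt1 // orbT.
apply/(has_index_reps _ _ sA); exists (fun=> 1); split.
- by move=> _; apply: subgroup1.
- by move=> y Ay; exists ord0; rewrite invg1 mul1g.
- by move=> i j _; rewrite !ord1.
Qed.

Lemma Opprime_cj A a x : Opprime p A x -> Opprime p (cj a @` A) (cj a x).
Proof.
move=> Ox N [[sN NA AN] [n iN pn]].
have h : inj_hom [set: G] [set: G] (cj a^-1) by apply/inj_hom_cj/subgroupT.
have sN' : subgroup (cj a^-1 @` N) by apply: (hom_im_sub h).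
suff : (cj a^-1 @` N) x by case=> y Ny <-; rewrite cjKV.
apply: Ox; split; first split=> //.
- by move=> _ [y /NA[z Az <-] <-]; rewrite cjK.
- move=> y Ay; have Ny : normaliser N (cj a y) by apply: AN; exists y.
  rewrite normaliser_cjim; exists (cj a y) => //; exact: cjK.
exists n => //; have := has_index_cj a^-1 sN iN.
suff -> : cj a^-1 @` (cj a @` A) = A by [].
by rewrite image_comp -[RHS]image_id; apply: eq_imagel => y _; apply: cjK.
Qed.

End OpprimeBasics.

(** * The functor on centric subgroups and the definition of labels *)

Section Theta.
Variables (p : nat) (S : groupType) (T : set S) (q : nat) (F : homsets S)
  (theta : set S -> set S -> (S -> S) -> coset_type (Out0 p F)).
Hypotheses (p_pr : prime p) (tT : toral p T q) (sF : saturated p F)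
  (hth : theta_hat theta).
Implicit Types (P Q R N M Z : set S) (f g h k : S -> S) (a b u v : sym S) (s t x y z : S)
  (H : set (coset_type (Out0 p F))) (c d e : coset_type (Out0 p F)).

Let fF := saturated_fusion sF.
Let A := Aut F [set: S].
Let sA : subgroup A := subgroup_Aut fF (subgroupT S).
Let cS := centric_setT p_pr tT sF.

Lemma A_hom a : A a -> inj_hom [set: S] [set: S] a.
Proof. by move=> /(Aut_mor fF)/(mor_inj_hom fF). Qed.

Lemma A_mor a P : A a -> subgroup P -> mor F P a.
Proof. by move=> Aa sP; apply: (mor_sub fF sP _ (Aut_mor fF Aa)). Qed.

Lemma mor_cjm a P f : A a -> mor F P f -> mor F (a @` P) (cjm a f).
Proof.
move=> Aa Ff; have sP := mor_subgroup fF Ff; have AaV := subgroupV sA Aa.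
have saP := hom_im_sub (A_hom Aa) sP (fun x _ => Logic.I).
have h1 : mor F (a @` P) (f \o (a^-1)%g).
  by apply: (mor_comp fF (A_mor AaV saP) Ff) => _ [x Px <-]; rewrite symK.
exact: (mor_comp fF h1 (Aut_mor fF Aa)).
Qed.

Lemma im_symV a P : (a^-1)%g @` (a @` P) = P.
Proof.
by apply/seteqP; split=> [_ [_ [x Px <-] <-]|x Px]; rewrite ?symK //; exists (a x);
  [exists x|rewrite symK].
Qed.

Lemma gen_norm (X : homsets S) a : A a -> subsystem X F ->
  (forall P Q f, X P Q f -> X (a @` P) (a @` Q) (cjm a f)) ->
  forall P f, mor (fusion_gen X) P f -> mor (fusion_gen X) (a @` P) (cjm a f).
Proof.
move=> Aa XF Xa; set E := fusion_gen X.
have fE : fusion_system E := fusion_gen_fusion fF XF.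
have EF : subsystem E F := fusion_gen_min fF XF.
pose M P f := mor F P f /\ mor E (a @` P) (cjm a f).
have aP P : subgroup P -> subgroup (a @` P).
  by move=> sP; apply: (hom_im_sub (A_hom Aa)).
have fM : fusion_system (of_mor M).
  apply: mk_fusion.
  - by move=> P f [/(mor_inj_hom fF)].
  - move=> P f g fg [Ff Ef]; split; first exact: mor_agree fg Ff.
    by apply: (mor_agree fE _ Ef) => _ [x Px <-]; rewrite /cjm symK fg.
  - move=> P Q f g [Ff Ef] [Fg Eg] fPQ; split; first exact: (mor_comp fF Ff Fg).
    have h : mor E (a @` P) (cjm a g \o cjm a f).
      apply: (mor_comp fE Ef Eg) => _ [x Px <-]; rewrite /cjm symK.
      by exists (f x) => //; apply: fPQ.
    by apply: (mor_agree fE _ h) => x _; rewrite /cjm /= symK.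
  - move=> P s sP; split; first exact: mor_cj.
    apply: (mor_agree fE _ (mor_cj fE (a s) (aP P sP))) => _ [x Px <-].
    by rewrite /cjm symK (hom_cj (A_hom Aa)).
  - move=> P f [Ff Ef]; split; first exact: mor_inv.
    have := mor_inv fE Ef; have -> : cjm a f @` (a @` P) = a @` (f @` P).
      rewrite !image_comp; apply/seteqP; split=> _ [x Px <-]; exists x => //=;
      by rewrite /cjm symK.
    apply: (mor_agree fE) => _ [_ [x Px <-] <-].
    have -> : a (f x) = cjm a f (a x) by rewrite /cjm symK.
    rewrite (inv_on_f (mor_inj_hom fE Ef)); last by exists x.
    by rewrite /cjm !symK (inv_on_f (mor_inj_hom fF Ff)).
move=> P f Ef; suff : of_mor M P [set: S] f by case=> -[].
apply: (fusion_gen_min fM _ Ef) => {Ef}P {f}Q f Xf.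
have /(F_mor fF)[Ff sQ fPQ] := XF _ _ _ Xf; split=> //; split=> //.
have /(F_mor fE)[] // : E (a @` P) (a @` Q) (cjm a f).
by apply: fusion_gen_sub; apply: Xa.
Qed.

Lemma Opstar_gen_sub : subsystem (fun P Q => [set f : S -> S | [/\ subgroup P, Q = P &
    exists2 a : sym S, Opprime p (Aut F P) a & f = a :> (S -> S)]]) F.
Proof.
move=> P _ f [sP -> [a Oa ->]].
by have [_ []] : Aut F P a by apply: (Opprime_sub p_pr (subgroup_Aut fF sP)).
Qed.

Lemma Opstar_fusion : fusion_system (Opstar p F).
Proof. exact: (fusion_gen_fusion fF Opstar_gen_sub). Qed.

Lemma Opstar_sub : subsystem (Opstar p F) F.
Proof. exact: (fusion_gen_min fF Opstar_gen_sub). Qed.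

Lemma Opstar_Opprime P a : subgroup P -> Opprime p (Aut F P) a -> mor (Opstar p F) P a.
Proof.
move=> sP Oa; have : Opstar p F P P a.
  by apply: fusion_gen_sub; split=> //; exists a.
by case/(F_mor Opstar_fusion).
Qed.

Lemma Aut_cjm P a b : A a -> Aut F P b -> Aut F (a @` P) (cj a b : sym S).
Proof.
move=> Aa Ab; have [bN Fb bP] := (AutP fF _ _).1 Ab; apply/(AutP fF); split.
- move=> x nx; rewrite cjE !symM bN ?symKV //.
  by move=> Px; apply: nx; exists (a^-1 x) => //; rewrite symKV.
- exact: mor_cjm Aa Fb.
- rewrite -[in RHS]bP !image_comp; apply: eq_imagel => x Px.
  by rewrite -[LHS]/((cj a b : sym S) (a x)) cjE !symM symK.
Qed.

Lemma Opstar_norm a P f : A a -> mor (Opstar p F) P f -> mor (Opstar p F) (a @` P) (cjm a f).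
Proof.
move=> Aa; apply: gen_norm => //; first exact: Opstar_gen_sub.
move=> R Q g [sR -> [b Ob ->]]; split=> //; first exact: (hom_im_sub (A_hom Aa)).
exists (cj a b); last by [].
have -> : Aut F (a @` R) = cj a @` Aut F R.
  have AaV := subgroupV sA Aa.
  apply/seteqP; split=> [u Au|_ [u Au <-]]; last exact: Aut_cjm.
  exists (cj a^-1 u); last by rewrite cjKV.
  by have := Aut_cjm AaV Au; rewrite im_symV.
exact: Opprime_cj.
Qed.

Lemma Opstar_centric P : centric F P -> forall a b, Aut F P a ->
  Aut (homS (S:=S)) P b -> mor (Opstar p F) P (cj a b : sym S).
Proof.
move=> [sP _] a b Aa Bb; apply: Opstar_Opprime => //.
have sAP := subgroup_Aut fF sP; have Ab := AutS_Aut fF sP Bb.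
have [k bk] := AutS_ptorsion fF sP (toral_p tT) Bb.
apply: (Opprime_ptorsion p_pr sAP (k := k)); first exact: subgroup_cj.
by rewrite -cjX bk cjg1.
Qed.

(** Inclusions of centric subgroups have class 1, so the class is independent of the target
    ([th_theta]). *)
Definition th P f := theta P [set: S] f.
Definition ta a := theta [set: S] [set: S] a.

Lemma th_agree P f g : centric F P -> mor F P f -> agree P f g -> th P f = th P g.
Proof. by move=> cP Ff fg; apply: (theta_agree hth). Qed.

Lemma th_Opstar P f : centric F P -> mor (Opstar p F) P f -> th P f = 1.
Proof. by move=> cP Of; apply: (theta_Opstar hth). Qed.

Lemma th_cj P s : centric F P -> th P (cj s) = 1.
Proof.
by move=> cP; apply: th_Opstar => //; apply: (mor_cj Opstar_fusion); case: cP.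
Qed.

Lemma th_id P : centric F P -> th P id = 1.
Proof.
by move=> cP; apply: th_Opstar => //; apply: (mor_id Opstar_fusion); case: cP.
Qed.

Lemma th_theta P Q f : centric F P -> centric F Q -> F P Q f -> theta P Q f = th P f.
Proof.
move=> cP cQ Ff; have sQ := cQ.1.
have := theta_comp hth cP cQ cS Ff (mor_id fF sQ).
by rewrite -/(th Q id) th_id // mul1g => <-.
Qed.

Lemma th_comp P Q f g : centric F P -> mor F P f -> mor F Q g ->
  (forall x, P x -> Q (f x)) -> th P (g \o f) = th Q g * th P f.
Proof.
move=> cP Ff Fg fPQ; have sQ := mor_subgroup fF Fg.
have fQ : f @` P `<=` Q by move=> _ [x Px <-]; apply: fPQ.
have cQ := centric_over sF (centric_im sF cP Ff) sQ fQ.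
have FPQ : F P Q f by apply/(F_mor fF).
by rewrite /th (theta_comp hth cP cQ cS FPQ Fg) (th_theta cP cQ FPQ).
Qed.

Lemma th_sub P Q f : centric F P -> P `<=` Q -> mor F Q f -> th P f = th Q f.
Proof.
move=> cP PQ Ff; rewrite -[LHS]/(th P (f \o id)) (th_comp cP (mor_id fF cP.1) Ff PQ).
by rewrite th_id // mulg1.
Qed.

Lemma th_inv P f : centric F P -> mor F P f -> th (f @` P) (inv_on P f) = (th P f)^-1.
Proof.
move=> cP Ff; have hf := mor_inj_hom fF Ff.
have : th P (inv_on P f \o f) = 1.
  rewrite -(th_id cP); apply/esym/th_agree => //; first exact: mor_id cP.1.
  by move=> x Px; rewrite /= (inv_on_f hf).
rewrite (th_comp cP Ff (mor_inv fF Ff)); last by move=> x Px; exists x.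
by move=> /eqP; rewrite mulg_eq1 => /eqP.
Qed.

Lemma ta_th a P : A a -> centric F P -> th P a = ta a.
Proof. by move=> Aa cP; apply: th_sub => //; apply: Aut_mor Aa. Qed.

Lemma taM a b : A a -> A b -> ta (a * b) = ta a * ta b.
Proof. by move=> Aa Ab; apply: (th_comp cS (Aut_mor fF Ab) (Aut_mor fF Aa)). Qed.

Lemma ta1 : ta 1 = 1. Proof. exact: th_id cS. Qed.

Lemma taV a : A a -> ta a^-1 = (ta a)^-1.
Proof.
move=> Aa; apply/esym/mulg1_eq; rewrite -taM ?mulgV ?ta1 //; exact: (subgroupV sA).
Qed.

Lemma Gamma_ta c : Gamma p F c -> exists2 a, A a & ta a = c.
Proof.
move=> [d [[a [Aa _] <-] _] <-]; exists a => //; exact: (theta_Aut hth).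
Qed.

Lemma ta_Gamma a : A a -> Gamma p F (ta a).
Proof. by move=> Aa; apply: (theta_Gamma hth) => //; apply: (Aut_mor fF Aa). Qed.

Section FusionOf.
Variable H : set (coset_type (Out0 p F)).
Hypothesis sH : subgroup H.

Lemma fusion_of_gen_sub : subsystem (fun P Q => [set f |
    [/\ centric F P, centric F Q, F P Q f & H (theta P Q f)]]) F.
Proof. by move=> P Q f []. Qed.

Lemma fusion_of_fusion : fusion_system (fusion_of theta H).
Proof. exact: (fusion_gen_fusion fF fusion_of_gen_sub). Qed.

Lemma fusion_of_sub : subsystem (fusion_of theta H) F.
Proof. exact: (fusion_gen_min fF fusion_of_gen_sub). Qed.

Lemma fusion_of_th P f : centric F P -> mor F P f -> H (th P f) ->
  mor (fusion_of theta H) P f.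
Proof. by move=> cP Ff Hf; apply: fusion_gen_sub; split=> //; apply: cS. Qed.

(** The morphisms whose class is in H whenever their source is centric form a fusion system, since
    images and overgroups of centric subgroups are centric. *)
Lemma th_fusion_of P f : centric F P -> mor (fusion_of theta H) P f -> H (th P f).
Proof.
move=> cP Ef.
pose M P f := mor F P f /\ (centric F P -> H (th P f)).
have fM : fusion_system (of_mor M).
  apply: mk_fusion.
  - by move=> Q g [/(mor_inj_hom fF)].
  - move=> Q g h gh [Fg Hg]; split; first exact: mor_agree gh Fg.
    by move=> cQ; rewrite -(th_agree cQ Fg gh); apply: Hg.
  - move=> R Q g h [Fg Hg] [Fh Hh] gRQ; split; first exact: (mor_comp fF Fg Fh).
    move=> cR; rewrite (th_comp cR Fg Fh gRQ); apply: (subgroupM sH); last exact: Hg.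
    apply: Hh; apply: (centric_over sF (centric_im sF cR Fg) (mor_subgroup fF Fh)).
    by move=> _ [x Rx <-]; apply: gRQ.
  - move=> Q s sQ; split; first exact: mor_cj.
    by move=> cQ; rewrite th_cj //; apply: subgroup1.
  - move=> Q g [Fg Hg]; split; first exact: mor_inv.
    move=> cQ; have hg := mor_inj_hom fF Fg; have Fi := mor_inv fF Fg.
    have cQ' : centric F Q.
      by have := centric_im sF cQ Fi; rewrite (im_inv_on hg).
    by rewrite (th_inv cQ' Fg); apply: (subgroupV sH); apply: Hg.
suff : of_mor M P [set: S] f by case=> -[_ h] _ _; apply: h.
apply: (fusion_gen_min fM _ Ef) => R Q g [cR cQ Fg Hg].
have /(F_mor fF)[Mg sQ gRQ] := Fg; split=> //; split=> // _.
by rewrite -(th_theta cR cQ Fg).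
Qed.

Lemma fusion_of_norm a : A a -> (forall c, H c -> H (cj (ta a) c)) ->
  forall P f, mor (fusion_of theta H) P f -> mor (fusion_of theta H) (a @` P) (cjm a f).
Proof.
move=> Aa Ha; apply: gen_norm => //; first exact: fusion_of_gen_sub.
move=> P Q f [cP cQ Ff Hf]; have /(F_mor fF)[Mf sQ fPQ] := Ff.
have Fa := Aut_mor fF Aa; have FaP := A_mor Aa cP.1; have FaQ := A_mor Aa cQ.1.
have caP := centric_im sF cP FaP; have caQ := centric_im sF cQ FaQ.
have Fc := mor_cjm Aa Mf.
have FFc : F (a @` P) (a @` Q) (cjm a f).
  apply/(F_mor fF); split=> //; first by case: caQ.
  move=> _ [_ [x Px <-] <-]; rewrite /cjm symK; exists (f x) => //.
  by apply: fPQ; exists x.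
split=> //; rewrite (th_theta caP caQ FFc).
suff -> : th (a @` P) (cjm a f) = cj (ta a) (theta P Q f) by apply: Ha.
rewrite (th_theta cP cQ Ff); have AaV := subgroupV sA Aa.
have F1 := A_mor AaV caP.1.
have F2 : mor F (a @` P) (f \o (a^-1)%g).
  by apply: (mor_comp fF F1 Mf) => _ [x Px <-]; rewrite symK.
have -> : cjm a f = (a : S -> S) \o (f \o (a^-1)%g) by [].
rewrite (th_comp caP F2 Fa) // (th_comp caP F1 Mf); last first.
  by move=> _ [x Px <-]; rewrite symK.
by rewrite !ta_th // taV // /cj mulgA.
Qed.

End FusionOf.

Definition E1 : homsets S := fusion_of theta [set 1].

Let s1 : subgroup [set (1 : coset_type (Out0 p F))] := subgroup_set1 _.

Lemma E1_fusion : fusion_system E1. Proof. exact: fusion_of_fusion. Qed.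

Lemma E1_sub : subsystem E1 F. Proof. exact: fusion_of_sub. Qed.

Lemma E1_norm a P f : A a -> mor E1 P f -> mor E1 (a @` P) (cjm a f).
Proof. by move=> Aa; apply: (fusion_of_norm Aa) => c ->; rewrite /= cjg1. Qed.

Lemma th_conj P a b : centric F P -> Aut F P a -> Aut (homS (S:=S)) P b ->
  th P (cj a b : sym S) = 1.
Proof. by move=> cP Aa Bb; apply: th_Opstar => //; apply: Opstar_centric. Qed.

Lemma E1_centric P : centric F P -> forall a b, Aut F P a ->
  Aut (homS (S:=S)) P b -> mor E1 P (cj a b : sym S).
Proof.
move=> cP a b Aa Bb; apply: fusion_of_th => //; last exact: th_conj.
exact: Opstar_sub (Opstar_centric cP Aa Bb).
Qed.

(* Labels are unique only on centric subgroups. *)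
Definition lab P f c := exists a, [/\ A a, ta a = c & mor E1 P (twist a f)].

Lemma lab_factors P f c : lab P f c -> factors F E1 P f.
Proof. by move=> [a [Aa _ Ef]]; exists a. Qed.

Lemma lab_mor P f c : lab P f c -> mor F P f.
Proof. by move/lab_factors; apply: factors_mor; [exact: sF|exact: E1_sub]. Qed.

Lemma lab_ex P f : mor F P f -> exists c, lab P f c.
Proof.
move=> Ff.
have [a Aa Ef] := alperin p_pr tT sF E1_fusion E1_sub E1_norm E1_centric Ff.
by exists (ta a), a.
Qed.

Lemma lab_A a P : A a -> subgroup P -> lab P a (ta a).
Proof.
move=> Aa sP; exists a; split=> //.
apply: (mor_agree E1_fusion _ (mor_id E1_fusion sP)) => x _.
by rewrite /twist symK.
Qed.

Lemma lab_E1 P f : mor E1 P f -> lab P f 1.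
Proof.
move=> Ef; exists 1; split; [exact: (subgroup1 sA)|exact: ta1|].
by apply: (mor_agree E1_fusion _ Ef) => x _; rewrite /twist -{1}(symKV 1 (f x)).
Qed.

Lemma lab_agree P f g c : agree P f g -> lab P f c -> lab P g c.
Proof.
move=> fg [a [Aa ac Ef]]; exists a; split=> //.
by apply: (mor_agree E1_fusion _ Ef) => x Px; rewrite /twist fg.
Qed.

Lemma lab_sub P Q f c : subgroup P -> P `<=` Q -> lab Q f c -> lab P f c.
Proof.
by move=> sP PQ [a [Aa ac Ef]]; exists a; split=> //; apply: (mor_sub E1_fusion sP PQ Ef).
Qed.

Lemma lab_comp P Q f g c d : lab P f c -> lab Q g d -> (forall x, P x -> Q (f x)) ->
  lab P (g \o f) (d * c).
Proof.
move=> [a [Aa <- Ef]] [b [Ab <- Eg]] fPQ; exists (b * a); split.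
- exact: (subgroupM sA).
- by rewrite taM.
have AaV := subgroupV sA Aa; have Ec := E1_norm AaV Eg.
have h : mor E1 P (cjm a^-1 (twist b g) \o twist a f).
  by apply: (mor_comp E1_fusion Ef Ec) => x Px; exists (f x) => //; apply: fPQ.
apply: (mor_agree E1_fusion _ h) => x Px.
by rewrite /cjm /twist /= invgK symKV invgM symM.
Qed.

Lemma lab_inv P f c : lab P f c -> lab (f @` P) (inv_on P f) c^-1.
Proof.
move=> hf; have Ff := lab_mor hf; have [a [Aa <- Ef]] := hf.
have hhf := mor_inj_hom fF Ff; have hEf := mor_inj_hom E1_fusion Ef.
exists a^-1; split; [exact: (subgroupV sA)|by rewrite taV|].
have := E1_norm Aa (mor_inv E1_fusion Ef).
have -> : a @` (twist a f @` P) = f @` P.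
  rewrite image_comp; apply/seteqP; split=> _ [x Px <-]; exists x => //=;
  by rewrite /twist symKV.
apply: (mor_agree E1_fusion) => _ [x Px <-].
by rewrite /twist /cjm invgK (inv_on_f hhf) //; congr (a _); apply: (inv_on_f hEf Px).
Qed.

Lemma lab_cj P s : subgroup P -> lab P (cj s) 1.
Proof. by move=> sP; apply: lab_E1; apply: (mor_cj E1_fusion). Qed.

Lemma lab_th P f c : centric F P -> lab P f c -> c = th P f.
Proof.
move=> cP hl; have Ff := lab_mor hl; have [a [Aa <- Ef]] := hl.
have e : th P (twist a f) = 1 := th_fusion_of s1 cP Ef.
have FE := E1_sub Ef.
have : th P ((a : S -> S) \o twist a f) = th P f.
  apply: th_agree => //; first exact: (mor_comp fF FE (Aut_mor fF Aa)).
  by move=> x _; rewrite /= /twist symKV.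
by rewrite (th_comp cP FE (Aut_mor fF Aa)) // e mulg1.
Qed.

Lemma th_lab P f : centric F P -> mor F P f -> lab P f (th P f).
Proof. by move=> cP Ff; have [c hc] := lab_ex Ff; rewrite -(lab_th cP hc). Qed.

Lemma fusion_ofP H P f : subgroup H -> H `<=` Gamma p F ->
  mor (fusion_of theta H) P f <-> exists2 c, H c & lab P f c.
Proof.
move=> sH HG; split=> [Ef|[c Hc [a [Aa ac Ef]]]]; last first.
  have Ea : mor (fusion_of theta H) [set: S] a.
    by apply: fusion_of_th; [exact: cS|exact: (Aut_mor fF Aa)|rewrite -[th _ _]/(ta a) ac].
  have fH := fusion_of_fusion H.
  have EH : subsystem E1 (fusion_of theta H).
    apply: (fusion_gen_min fH) => R Q g [cR cQ Fg g1]; apply: fusion_gen_sub.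
    by split=> //; rewrite g1; apply: subgroup1.
  have := mor_comp fH (EH _ _ _ Ef) Ea (fun x _ => Logic.I).
  by apply: (mor_agree fH) => x _; rewrite /= /twist symKV.
pose M P f := exists2 c, H c & lab P f c.
have fM : fusion_system (of_mor M).
  apply: mk_fusion.
  - by move=> Q g [c _ /lab_mor/(mor_inj_hom fF)].
  - by move=> Q g h gh [c Hc lc]; exists c => //; apply: lab_agree lc.
  - move=> R Q g h [c Hc lc] [d Hd ld] gRQ; exists (d * c); first exact: (subgroupM sH).
    exact: lab_comp lc ld gRQ.
  - by move=> Q s sQ; exists 1; [exact: (subgroup1 sH)|exact: lab_cj].
  - by move=> Q g [c Hc lc]; exists c^-1; [exact: (subgroupV sH)|exact: lab_inv].
suff : of_mor M P [set: S] f by case.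
apply: (fusion_gen_min fM _ Ef) => R Q g [cR cQ Fg Hg].
have /(F_mor fF)[Mg sQ gRQ] := Fg; split=> //.
by exists (th R g); [rewrite -(th_theta cR cQ Fg)|apply: th_lab].
Qed.

End Theta.

(** * Fully normalized conjugates adapted to a group of automorphisms *)

Section FnMeet.
Variables (p : nat) (S : groupType) (T : set S) (q : nat) (F : homsets S).
Hypotheses (p_pr : prime p) (tT : toral p T q) (sF : saturated p F).
Implicit Types (P Q R N M Z : set S) (f g h : S -> S) (a b u v : sym S) (s t x y z : S).

Let fF := saturated_fusion sF.

(** The group f G f^-1, acting as the identity outside f(M). *)
Definition transport M f (G : set (sym S)) : set (sym S) :=
  [set b | Aut F (f @` M) b /\ exists2 a, G a & forall x, M x -> b (f x) = f (a x)].

Lemma subgroup_transport M f (G : set (sym S)) : mor F M f -> subgroup G ->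
  G `<=` Aut F M -> subgroup (transport M f G).
Proof.
move=> Ff sG GA; have hf := mor_inj_hom fF Ff.
have sAP := subgroup_Aut fF (hom_im hf); apply: mk_subgroup.
- by split; [exact: subgroup1|exists 1; [exact: subgroup1|]].
- move=> b c [Ab [a Ga ba]] [Ac [d Gd cd]]; split; first exact: subgroupM.
  exists (a * d); first exact: subgroupM.
  by move=> x Mx; rewrite !symM cd // ba //; apply: (Aut_in fF (GA _ Gd)).
- move=> b [Ab [a Ga ba]]; split; first exact: subgroupV.
  exists a^-1; first exact: subgroupV.
  have GaV := subgroupV sG Ga; move=> x Mx.
  by rewrite -{1}(symKV a x) -ba ?symK //; apply: (Aut_in fF (GA _ GaV)).
Qed.

Lemma transport_of M f (G : set (sym S)) a : mor F M f -> G `<=` Aut F M -> G a ->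
  exists2 b, transport M f G b & forall x, M x -> b (f x) = f (a x).
Proof.
move=> Ff GA Ga; have hf := mor_inj_hom fF Ff; have Aa := GA _ Ga.
have Mi y : (f @` M) y -> M (inv_on M f y) by apply: inv_on_in.
have Fk : mor F (f @` M) (f \o (a \o inv_on M f)).
  apply: (mor_comp fF (Q := M) _ Ff).
    exact: (mor_comp fF (mor_inv fF Ff) (Aut_mor fF Aa)).
  by move=> y /Mi My; apply: (Aut_in fF Aa).
have [] := Aut_of fF Fk.
  have aM : a @` M = M by case/(AutP fF): Aa.
  by rewrite -image_comp -image_comp (im_inv_on hf) // aM.
move=> b Ab bE; have bf x : M x -> b (f x) = f (a x).
  by move=> Mx; rewrite bE /= ?(inv_on_f hf) //; exists x.
by exists b => //; split=> //; exists a.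
Qed.

(** On a fully normalized conjugate Aut_S has index prime to p. By [pidx_meet], following the
    isomorphism by an automorphism a makes Aut_S also meet the transported G in a subgroup of index
    prime to p. *)
Lemma exists_fn_meet M (G : set (sym S)) : subgroup M -> subgroup G -> G `<=` Aut F M ->
  exists j, [/\ mor F M j, fully_normalized p F (j @` M) &
    pidx p (transport M j G) (transport M j G `&` Aut (homS (S:=S)) (j @` M))].
Proof.
move=> sM sG GA; have [r Fr nr] := exists_fn_conj p_pr tT sF sM.
have hr := mor_inj_hom fF Fr; have sM2 := hom_im hr.
have sA := subgroup_Aut fF sM2; have sB := subgroup_AutS sM2.
have sG2 := subgroup_transport Fr sG GA.
have G2A : transport M r G `<=` Aut F (r @` M) by move=> b [].
have [a Aa pa] := pidx_meet p_pr sA sB (AutS_Aut fF sM2) (fn_sylow p_pr sF sM2 nr) sG2 G2A.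
have [aN Fa aP] := (AutP fF _ _).1 Aa.
have Fj : mor F M (a \o r) by apply: (mor_comp fF Fr Fa) => x Mx; exists x.
have jM : (a \o r) @` M = r @` M by rewrite -image_comp.
exists (a \o r); rewrite jM; split=> //.
have AaV := subgroupV sA Aa.
have eG : transport M (a \o r) G = cj a @` transport M r G.
  apply/seteqP; split=> [b [Ab [c Gc bc]]|_ [b [Ab [c Gc bc]] <-]].
    rewrite jM in Ab; exists (cj a^-1 b); last exact: cjKV.
    split; first exact: subgroup_cj.
    by exists c => // x Mx; rewrite cjE invgK !symM -[a (r x)]/((a \o r) x) bc // symK.
  split; first by rewrite jM; apply: subgroup_cj.
  by exists c => // x Mx; rewrite cjE !symM /= symK bc.
set D := [set y | _] in pa.
have sD : subgroup D.
  apply: mk_subgroup.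
  - by split; [exact: subgroup1|rewrite cjg1; exact: subgroup1].
  - by move=> x y [Gx Bx] [Gy By]; split; [exact: subgroupM|rewrite cjMr; exact: subgroupM].
  - by move=> x [Gx Bx]; split; [exact: subgroupV|rewrite cjV; exact: subgroupV].
have := pidx_cj a sD pa; rewrite -eG.
suff -> : cj a @` D = transport M (a \o r) G `&` Aut (homS (S:=S)) (r @` M) by [].
rewrite eG; apply/seteqP; split=> [_ [b [Gb Bb] <-]|_ [[b Gb <-] Bb]].
  by split=> //; exists b.
by exists b.
Qed.

End FnMeet.

(** * Labels on closures and normalisers *)

Section LabelExtension.
Variables (p : nat) (S : groupType) (T : set S) (q : nat) (F : homsets S)
  (theta : set S -> set S -> (S -> S) -> coset_type (Out0 p F)).
Hypotheses (p_pr : prime p) (tT : toral p T q) (sF : saturated p F)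
  (hth : theta_hat theta).
Implicit Types (P Q R N M Z : set S) (f g h k : S -> S) (a b u v : sym S) (s t x y z : S)
  (c d e : coset_type (Out0 p F)).

Let fF := saturated_fusion sF.
Let fE1 : fusion_system (E1 theta) := E1_fusion theta sF.

Local Notation bullet := (bullet p T q F).
Local Notation lab := (lab theta).
Local Notation E1 := (E1 theta).

(** The extension exists in F; it has to be found in [E1]. The property is stated for all subgroups
    of the source so as to be stable under composition and inversion. For a generator the closure of
    its source is again centric, and the extension has the same class. *)
Lemma E1_bullet P Q f : subgroup Q -> P `<=` Q -> Q `<=` bullet P -> mor E1 P f ->
  exists2 g, mor E1 Q g & agree P g f.
Proof.
pose M P0 f := mor E1 P0 f /\ forall P Q, subgroup P -> subgroup Q -> P `<=` P0 ->
  P `<=` Q -> Q `<=` bullet P -> exists2 g, mor E1 Q g & agree P g f.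
have EF P0 g : mor E1 P0 g -> mor F P0 g by apply: E1_sub.
have bim P1 Q1 g : subgroup P1 -> P1 `<=` Q1 -> Q1 `<=` bullet P1 -> mor F Q1 g ->
    g @` Q1 `<=` bullet (g @` P1).
  move=> sP1 PQ QP Fg; have sQ1 := mor_subgroup fF Fg.
  have Fg1 := mor_sub fF sP1 PQ Fg.
  have sZ := subgroup_bullet p_pr tT sF sP1; have PZ := @sub_bullet p S T q F tT sF P1.
  have [k Fk kg] := bullet_extend p_pr tT sF sZ PZ (@subset_refl _ _) Fg1.
  have kg' := bullet_uniq p_pr tT sF PQ QP sP1 (mor_sub fF sQ1 QP Fk) Fg kg.
  rewrite -(bullet_im p_pr tT sF sP1 Fk kg Fg1) => _ [x Qx <-].
  by exists x; [exact: QP|exact: kg'].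
suff fM : fusion_system (of_mor M).
  move=> sQ PQ QP Ef; suff : of_mor M P [set: S] f.
    by case=> -[_ h] _ _; apply: (h P Q (mor_subgroup fE1 Ef)).
  apply: (fusion_gen_min fM _ Ef) => {Ef sQ PQ QP P Q f} P0 Q0 f [cP cQ Ff f1].
  have /(F_mor fF)[Mf sQ0 fPQ0] := Ff; split=> //.
  rewrite (th_theta p_pr tT sF hth cP cQ Ff) in f1.
  split; first exact: (fusion_of_th p_pr tT sF cP Mf f1).
  move=> P Q sP sQ PP0 PQ QP.
  have sZ := subgroup_bullet p_pr tT sF cP.1; have PZ := @sub_bullet p S T q F tT sF P0.
  have [g Fg gf] := bullet_extend p_pr tT sF sZ PZ (@subset_refl _ _) Mf.
  have cZ := centric_over sF cP sZ PZ.
  exists g; last by move=> x Px; rewrite gf //; apply: PP0.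
  have QZ : Q `<=` bullet P0 by apply: subset_trans QP _; apply: bulletS.
  apply: (mor_sub fE1 sQ QZ); apply: (fusion_of_th p_pr tT sF cZ Fg) => /=.
  rewrite -(th_sub p_pr tT sF hth cP PZ Fg) -f1.
  exact: (th_agree p_pr tT sF hth cP (mor_sub fF cP.1 PZ Fg) gf).
apply: mk_fusion.
- by move=> P0 g [/(mor_inj_hom fE1)].
- move=> P0 g h gh [Eg Mg]; split; first exact: (mor_agree fE1 gh Eg).
  move=> P1 Q1 sP1 sQ1 P10 PQ QP; have [k Ek kg] := Mg P1 Q1 sP1 sQ1 P10 PQ QP.
  by exists k => // x Px; rewrite kg // gh //; apply: P10.
- move=> P0 Q0 g h [Eg Mg] [Eh Mh] gPQ; split; first exact: (mor_comp fE1 Eg Eh).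
  move=> P1 Q1 sP1 sQ1 P10 PQ QP; have [k Ek kg] := Mg P1 Q1 sP1 sQ1 P10 PQ QP.
  have hk := mor_inj_hom fE1 Ek.
  have kg' : k @` P1 = g @` P1 by apply: eq_imagel.
  have k1 : k @` P1 `<=` Q0 by rewrite kg' => _ [x Px <-]; apply/gPQ/P10.
  have k2 : k @` P1 `<=` k @` Q1 by apply: image_subset.
  have [l El lh] := Mh (k @` P1) (k @` Q1) (hom_im_sub hk sP1 PQ) (hom_im hk) k1 k2
    (bim _ _ _ sP1 PQ QP (EF _ _ Ek)).
  exists (l \o k); first by apply: (mor_comp fE1 Ek El) => x Qx; exists x.
  by move=> x Px /=; rewrite lh; [rewrite kg|exists x].
- move=> P0 s sP0; split; first exact: (mor_cj fE1).
  by move=> P1 Q1 sP1 sQ1 _ _ _; exists (cj s) => //; exact: (mor_cj fE1).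
- move=> P0 g [Eg Mg]; split; first exact: (mor_inv fE1).
  move=> P1 Q1 sP1 sQ1 P10 PQ QP; have hg := mor_inj_hom fE1 Eg.
  have Ei := mor_inv fE1 Eg; have Ei1 := mor_sub fE1 sP1 P10 Ei.
  have [k Fk ki] := bullet_extend p_pr tT sF sQ1 PQ QP (EF _ _ Ei1).
  have hk := mor_inj_hom fF Fk.
  have k0 : k @` P1 `<=` P0.
    by move=> _ [x Px <-]; rewrite ki //; apply: (inv_on_in (P10 _ Px)).
  have [l El lg] := Mg (k @` P1) (k @` Q1) (hom_im_sub hk sP1 PQ) (hom_im hk) k0
    (@image_subset _ _ k _ _ PQ) (bim _ _ _ sP1 PQ QP Fk).
  have Flk : mor F Q1 (l \o k) by apply: (mor_comp fF Fk (EF _ _ El)) => x Qx; exists x.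
  have lk : agree Q1 (l \o k) id.
    apply: (bullet_uniq p_pr tT sF PQ QP sP1 Flk (mor_id fF sQ1)) => x Px.
    rewrite /= lg; last by exists x.
    by rewrite ki // (inv_onK (P10 _ Px)).
  exists k => //; have hl := mor_inj_hom fE1 El.
  have := mor_inv fE1 El.
  have -> : l @` (k @` Q1) = Q1.
    by rewrite image_comp -[RHS]image_id; apply: eq_imagel => x Qx; exact: lk.
  apply: (mor_agree fE1) => x Qx.
  by rewrite -{1}(lk x Qx) /= (inv_on_f hl) //; exists x.
Qed.

Lemma lab_bullet P Q f g c : subgroup Q -> P `<=` Q -> Q `<=` bullet P -> lab P f c ->
  mor F Q g -> agree P g f -> lab Q g c.
Proof.
move=> sQ PQ QP lf Fg gf; have Ff := lab_mor sF lf; have sP := mor_subgroup fF Ff.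
have [a [Aa ac Ef]] := lf; exists a; split=> //.
have [k Ek kf] := E1_bullet sQ PQ QP Ef; have Fk : mor F Q k by apply: E1_sub Ek.
have Fak : mor F Q ((a : S -> S) \o k) by apply: (mor_comp fF Fk (Aut_mor fF Aa)).
have e : agree Q (a \o k) g.
  apply: (bullet_uniq p_pr tT sF PQ QP sP Fak Fg) => x Px.
  by rewrite /= kf // /twist symKV gf.
by apply: (mor_agree fE1 _ Ek) => x Qx; rewrite /twist -(e x Qx) /= symK.
Qed.

Lemma lab_symM Q a b c d : Aut F Q a -> Aut F Q b -> lab Q a c -> lab Q b d ->
  lab Q (a * b : sym S) (c * d).
Proof. by move=> Aa Ab la lb; apply: (lab_comp p_pr tT sF hth lb la) => x; apply: (Aut_in fF Ab). Qed.

Lemma lab_symV Q a c : Aut F Q a -> lab Q a c -> lab Q (a^-1 : sym S)%g c^-1.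
Proof.
move=> Aa la; have [_ Fa aQ] := (AutP fF _ _).1 Aa.
have := lab_inv p_pr tT sF hth la; rewrite aQ; apply: lab_agree => // x Qx.
rewrite -{1}aQ in Qx; case: Qx => y Qy <-.
by rewrite symK (inv_on_f (mor_inj_hom fF Fa)).
Qed.

(** If x has label c, a conjugate by x of an element of label 1 has label c 1 c^-1 = 1. *)
Lemma lab_nclosure Q (G B : set (sym S)) u : subgroup Q -> subgroup G -> G `<=` Aut F Q ->
  B `<=` G -> (forall b, B b -> lab Q b 1) -> nclosure G B u -> lab Q u 1.
Proof.
move=> sQ sG GA BG B1 Ou.
suff : nclosure G B `<=` G `&` [set a | lab Q (a : sym S) 1] by move=> /(_ u Ou)[].
apply: gen_subset; last first.
  move=> _ [x Gx [b Bb <-]]; have Gb := BG b Bb.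
  have Ax := GA _ Gx; have Ab := GA _ Gb; have GxV := subgroupV sG Gx.
  split; first exact: subgroup_cj.
  have [c lc] := lab_ex p_pr tT sF hth (Aut_mor fF Ax).
  have l1 := lab_symM Ax Ab lc (B1 b Bb).
  have := lab_symM (subgroupM (subgroup_Aut fF sQ) Ax Ab) (GA _ GxV) l1 (lab_symV Ax lc).
  by rewrite mulg1 mulgV.
apply: mk_subgroup.
- by split; [exact: subgroup1|exact: (lab_E1 p_pr tT sF hth (mor_id fE1 sQ))].
- move=> x y [Gx lx] [Gy ly]; split; first exact: subgroupM.
  by have := lab_symM (GA _ Gx) (GA _ Gy) lx ly; rewrite mulg1.
- move=> x [Gx lx]; split; first exact: subgroupV.
  by have := lab_symV (GA _ Gx) lx; rewrite invg1.
Qed.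

Lemma im_agree_id Q f : agree Q f id -> f @` Q = Q.
Proof. by move=> fid; rewrite -[RHS]image_id; apply: eq_imagel => x Qx; apply: fid. Qed.

Lemma normaliser_RC Q : subgroup Q -> normaliser Q `<=` normaliser (RC Q).
Proof.
move=> sQ s Ns; have h t : normaliser Q t -> forall y, RC Q y -> RC Q (cj t y).
  move=> Nt _ [x Qx [c cc <-]]; rewrite cjMr; exists (cj t x).
    exact: normaliser_cj Nt Qx.
  by exists (cj t c) => //; apply: normaliser_cj (normaliser_cent Nt) cc.
by apply/normaliserP; split; apply: h => //; apply: normaliserV.
Qed.

(* A Frattini argument in the group G of automorphisms of C_S(Q)Q that act on Q as
   an element of N_S(Q): the subgroup induced by N_S(Q) has index prime to p in G. *)
Lemma lab_normaliser Q k0 e : subgroup Q -> fully_centralized p F Q ->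
  lab (RC Q) k0 e -> agree Q k0 id ->
  exists2 k1, lab (normaliser Q) k1 e & agree Q k1 id.
Proof.
move=> sQ cQ lk kid; have Fk := lab_mor sF lk.
have sR := subgroup_RC sQ; have QR := @sub_RC _ Q.
have ceR := RC_centric p_pr tT sF sQ cQ.
have sN := @subgroup_normaliser _ Q; have RN := RC_normaliser sQ.
have NR := normaliser_RC sQ.
have sAR := subgroup_Aut fF sR.
have [a Aa aE] := Aut_of fF Fk (RC_onto p_pr tT sF sQ Fk (im_agree_id kid)).
pose R := RC Q; rewrite -/R in lk Fk sR QR ceR RN NR sAR Aa aE *.
pose N := normaliser Q; rewrite -/N in sN RN NR *.
pose G : set (sym S) := [set x | Aut F R x /\ exists2 n, N n & forall y, Q y -> x y = cj n y].
have GA : G `<=` Aut F R by move=> x [].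
have sG : subgroup G.
  apply: mk_subgroup.
  - split; first exact: subgroup1.
    by exists 1; [exact: (subgroup1 sN)|move=> y _; rewrite cj1g].
  - move=> x y [Ax [m Nm xm]] [Ay [n Nn yn]]; split; first exact: subgroupM.
    exists (m * n); first exact: (subgroupM sN).
    by move=> z Qz; rewrite symM yn // xm ?cjM //; apply: normaliser_cj Nn Qz.
  - move=> x [Ax [m Nm xm]]; split; first exact: subgroupV.
    have NmV := subgroupV sN Nm; exists m^-1 => // z Qz.
    by rewrite -{1}(cjKV m z) -xm ?symK //; apply: normaliser_cj NmV Qz.
have Ga : G a.
  split=> //; exists 1; first exact: (subgroup1 sN).
  by move=> y Qy; rewrite cj1g aE ?kid //; apply: QR.
have [j [Fj nj pj]] := exists_fn_meet p_pr tT sF sR sG GA.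
have hj := mor_inj_hom fF Fj; have sR2 := hom_im hj.
pose R2 := j @` R; rewrite -/R2 in nj pj sR2.
pose G2 := transport F R j G; rewrite -/G2 in pj.
have G2A : G2 `<=` Aut F R2 by move=> x [].
have sG2 : subgroup G2 := subgroup_transport sF Fj sG GA.
pose ji := inv_on R j.
have jK x : R x -> ji (j x) = x by move=> Rx; apply: (inv_on_f hj).
have jV y : R2 y -> R (ji y) /\ j (ji y) = y.
  by move=> hy; split; [exact: inv_on_in|exact: inv_onK].
have jR x : R x -> R2 (j x) by move=> Rx; exists x.
pose B2 : set (sym S) := [set y | Aut F R2 y /\ exists2 n, N n & transports R j y n].
have Ncj n x : N n -> R x -> R (cj n x) by move=> /NR Nn Rx; apply: normaliser_cj Nn Rx.
have QcjN n x : N n -> Q x -> Q (cj n x) by move=> Nn Qx; apply: normaliser_cj Nn Qx.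
have B2G : B2 `<=` G2.
  move=> y [Ay [n Nn yn]]; split=> //.
  have [x Bx xn] := AutS_of sR (NR _ Nn); exists x; last first.
    by move=> z Rz; rewrite yn // xn.
  split; first exact: (AutS_Aut fF sR).
  by exists n => // z /QR; apply: xn.
have B2ex n : N n -> exists2 y, B2 y & transports R j y n.
  move=> Nn; have [b Ab bn] := exists_transport sF Fj (NR _ Nn).
  by exists b => //; split=> //; exists n.
have sB2 : subgroup B2.
  apply: mk_subgroup.
  - split; first exact: (subgroup1 (subgroup_Aut fF sR2)).
    by exists 1; [exact: (subgroup1 sN)|move=> z _; rewrite cj1g].
  - move=> x y [Ax [m Nm xm]] [Ay [n Nn yn]]; split.
      exact: (subgroupM (subgroup_Aut fF sR2)).
    by exists (m * n); [exact: (subgroupM sN)|apply: transportsM => //; apply: NR].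
  - move=> x [Ax [m Nm xm]]; split; first exact: (subgroupV (subgroup_Aut fF sR2)).
    by exists m^-1; [exact: (subgroupV sN)|apply: transportsV => //; apply: NR].
have tB2 : ptorsion p B2.
  by move=> y [Ay [n Nn yn]]; apply: (transports_ptorsion tT sF Fj Ay (NR _ Nn) yn).
(* The elements of S that induce a member of G2 on R2. Since Q is fully centralized, the inverse of
   j on j(Q) extends to N2, with values normalising Q on the elements used below. *)
pose N2 := [set s | normaliser R2 s /\ exists2 y, G2 y & agree R2 y (cj s)].
have sN2 : subgroup N2.
  apply: mk_subgroup.
  - split; first exact: (subgroup1 (@subgroup_normaliser _ R2)).
    by exists 1; [exact: (subgroup1 sG2)|move=> z _; rewrite cj1g].
  - move=> s t [Ns [x Gx xs]] [Nt [y Gy yt]]; split; first exact: normaliserM.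
    exists (x * y); first exact: (subgroupM sG2).
    by move=> z Rz; rewrite symM yt // xs ?cjM //; apply: normaliser_cj Nt Rz.
  - move=> s [Ns [x Gx xs]]; split; first exact: normaliserV.
    exists x^-1; first exact: (subgroupV sG2).
    move=> z Rz; rewrite -{1}(cjKV s z) -xs ?symK //.
    exact: normaliser_cj (normaliserV Ns) Rz.
have N2j s : N2 s -> exists2 n, N n & forall z, Q z -> cj s (j z) = j (cj n z).
  move=> [Ns [y [Ay [x [Ax [n Nn xn]] yx]] ys]]; exists n => // z Qz.
  rewrite -ys; last exact/jR/QR.
  rewrite yx; last exact: QR.
  by rewrite xn.
pose Q2 := j @` Q.
have Q2R : Q2 `<=` R2 by apply: image_subset.
have N2Q : N2 `<=` normaliser Q2.
  have h s : N2 s -> forall y, Q2 y -> Q2 (cj s y).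
    move=> Ns _ [z Qz <-]; have [n Nn ->] := N2j s Ns => //.
    by exists (cj n z) => //; apply: QcjN.
  by move=> s Ns; apply/normaliserP; split; apply: h => //; apply: (subgroupV sN2).
have R2N : R2 `<=` N2.
  move=> _ [r Rr <-]; split; first by apply: (sub_normaliser sR2); apply: jR.
  have [y By yr] := B2ex r (RN _ Rr); exists y; first exact: B2G.
  by move=> _ [z Rz <-]; rewrite yr // (hom_cj hj).
have sQ2 : subgroup Q2 := hom_im_sub hj sQ QR.
have [jh Fjh jhE] : exists2 jh, mor F N2 jh & agree Q2 jh ji.
  apply: (mor_extend sF) => //.
  - exact: (mor_sub fF sQ2 Q2R (mor_inv fF Fj)).
  - by rewrite (im_inv_on hj QR).
  - move=> s Ns; have [n Nn ns] := N2j s Ns; exists n => _ [z Qz <-].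
    by rewrite ns // !jK //; apply: QR => //; apply: QcjN.
have hjh := mor_inj_hom fF Fjh.
have Fk' : mor F R (jh \o j) by apply: (mor_comp fF Fj Fjh) => x Rx; apply/R2N/jR.
have k'id : agree Q (jh \o j) id.
  by move=> x Qx; rewrite /= jhE ?jK //; [exact: QR|exists x].
have [a' Aa' a'E] := Aut_of fF Fk' (RC_onto p_pr tT sF sQ Fk' (im_agree_id k'id)).
have Ga' : G a'.
  split=> //; exists 1; first exact: (subgroup1 sN).
  by move=> y Qy; rewrite cj1g a'E ?k'id //; apply: QR.
have [k2 Gk2 k2E] := transport_of sF Fj GA Ga'.
set D2 := _ `&` _ in pj.
have D2G : D2 `<=` G2 by move=> x [].
have sD2 : subgroup D2 by apply: subgroupI => //; apply: subgroup_AutS.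
(* The image under [jh] of an element inducing d in D2 induces the conjugate of d by k2, where k2 is
   the transport of [jh \o j]. So B2 contains a conjugate of D2, and its index in G2 is prime to
   p. *)
have D2B : cj k2 @` D2 `<=` B2.
  move=> _ [d [Gd Bd] <-]; split; first by apply/G2A/(subgroup_cj sG2).
  have [_ [s Ns ds]] := (AutSP _ sR2).1 Bd.
  have N2s : N2 s by split=> //; exists d.
  have N2sV := subgroupV sN2 N2s.
  have Nn : N (jh s).
    have h t : N2 t -> forall y, Q y -> Q (cj (jh t) y).
      move=> N2t y Qy; have [n Nn nt] := N2j t N2t.
      have ee : jh (j y) = y by apply: k'id.
      rewrite -{1}ee -(hom_cj hjh) //; last exact/R2N/jR/QR.
      rewrite nt // -[jh (j _)]/((jh \o j) (cj n y)) k'id; exact: QcjN.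
    by apply/normaliserP; split; [apply: h|rewrite -(homV hjh N2s); apply: h].
  exists (jh s) => // z Rz.
  have Rw : R (a'^-1 z) by apply: (Aut_in fF (subgroupV sAR Aa')).
  have wz : a' (a'^-1 z) = z by apply: symKV.
  move: (a'^-1 z) Rw wz => w Rw wz.
  have [w' Rw' w'E] : R2 (cj s (j w)) by apply: normaliser_cj Ns (jR _ Rw).
  rewrite cjE !symM -{1}wz -k2E // symK ds; last exact: jR.
  rewrite -w'E k2E // a'E //= w'E (hom_cj hjh) //; last exact/R2N/jR.
  by rewrite -[jh (j w)]/((jh \o j) w) -a'E ?wz.
have pB2 : pidx p G2 B2.
  have eG : cj k2 @` G2 = G2.
    apply/seteqP; split=> [_ [x Gx <-]|x Gx]; first exact: subgroup_cj.
    exists (cj k2^-1 x); last exact: cjKV.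
    by apply: subgroup_cj => //; apply: subgroupV.
  have := pidx_cj k2 sD2 pj; rewrite eG => pG.
  have sC : subgroup (cj k2 @` D2) by apply: (hom_im_sub (inj_hom_cj k2 (subgroupT _))).
  by have [] := pidx_trans sG2 sC (subset_trans D2B B2G) sB2 D2B B2G pG.
have [a0 Ga0 a0E] := transport_of sF Fj GA Ga.
have [u [v [Ou Gv uv vB]]] := frattini p_pr sG2 sB2 B2G pB2 tB2 Ga0.
have [c lj] := lab_ex p_pr tT sF hth Fj.
have lji : lab R2 ji c^-1 := lab_inv p_pr tT sF hth lj.
have lab_tr f d g0 : lab R f d -> (forall x, R x -> R (f x)) ->
    (forall x, R x -> g0 (j x) = j (f x)) -> lab R2 g0 (c * d * c^-1).
  move=> lf fR gE.
  have h1 := lab_comp p_pr tT sF hth lji lf (fun y hy => (jV y hy).1).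
  have := lab_comp p_pr tT sF hth h1 lj (fun y hy => fR _ (jV y hy).1).
  rewrite mulgA; apply: (lab_agree sF) => z hz.
  by rewrite /= -gE ?(jV z hz).2 //; case: (jV z hz).
have B2lab b : B2 b -> lab R2 b 1.
  move=> [Ab [n Nn bn]]; rewrite -(mulgV c) -{1}(mulg1 c).
  by apply: (lab_tr _ _ _ (lab_cj p_pr tT sF hth n sR)) => x Rx; [exact: Ncj|exact: bn].
have Gu : G2 u by apply: (nclosure_sub sG2 B2G).
have lu : lab R2 u 1 := lab_nclosure sR2 sG2 G2A B2G B2lab Ou.
have la0 : lab R2 a0 (c * e * c^-1).
  have la : lab R a e by apply: (lab_agree sF _ lk) => x Rx; rewrite aE.
  by apply: (lab_tr _ _ _ la) => x Rx; [exact: (Aut_in fF Aa)|exact: a0E].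
(* The factor v may move j(Q), where u acts like some n in N_S(Q). The element b of B2 induced by n
   has label 1, and b v is trivial on j(Q), keeps the label of a0 and still conjugates B2 into
   itself. *)
have [Au [x0 [Ax0 [n Nn x0n]] ux0]] := Gu.
have [b Bb bn] := B2ex n Nn.
have bG := B2G _ Bb.
have vE : v = u^-1 * a0 by rewrite uv mulgA mulVg mul1g.
have lw : lab R2 (b * v : sym S) (c * e * c^-1).
  have Ab := G2A _ bG; have Av := G2A _ Gv; have Aa0 := G2A _ Ga0.
  have AuV := subgroupV (subgroup_Aut fF sR2) Au.
  have lv : lab R2 v (c * e * c^-1).
    by rewrite vE; have := lab_symM AuV Aa0 (lab_symV Au lu) la0; rewrite invg1 mul1g.
  by have := lab_symM Ab Av (B2lab b Bb) lv; rewrite mul1g.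
pose w := b * v.
have Gw : G2 w by apply: (subgroupM sG2).
have wid x : Q x -> w (j x) = j x.
  move=> Qx; have NnV := subgroupV sN Nn.
  have Rx := QR x Qx; have RVx := QR _ (QcjN _ _ NnV Qx).
  rewrite /w vE !symM a0E // aE // kid //.
  have {1}-> : x = cj n (cj n^-1 x) by rewrite cjKV.
  rewrite -x0n; last exact: QcjN.
  by rewrite -ux0 // symK bn // cjKV.
have wR x : R2 x -> R2 (w x) := @Aut_in _ _ fF _ _ _ (G2A _ Gw).
pose k1 := ji \o ((w : S -> S) \o j).
have k1j x : R x -> j (k1 x) = w (j x) by move=> Rx; apply: (jV _ (wR _ (jR _ Rx))).2.
have k1R x : R x -> R (k1 x) by move=> Rx; apply: (jV _ (wR _ (jR _ Rx))).1.
have k1Q : agree Q k1 id by move=> x Qx; rewrite -[k1 x]/(ji (w (j x))) wid // jK //; apply: QR.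
have lk1 : lab R k1 e.
  have := lab_comp p_pr tT sF hth (lab_comp p_pr tT sF hth lj lw jR) lji (fun x Rx => wR _ (jR _ Rx)).
  by rewrite -!mulgA mulVg mulg1 mulgA mulVg mul1g.
have Fk1 := lab_mor sF lk1.
have k1im := RC_onto p_pr tT sF sQ Fk1 (im_agree_id k1Q); rewrite -/R in k1im.
have [g Fg gE] : exists2 g, mor F N g & agree R g k1.
  apply: (mor_extend sF Fk1) => //; first by rewrite k1im; apply: (centric_fc sF).
  move=> s Ns; have [bs Bs bsE] := B2ex s Ns.
  have [_ [n' Nn' n'E]] : B2 (cj w bs).
    by rewrite /w cjM; apply: (subgroup_cj sB2 Bb); apply: vB.
  exists n' => z Rz; apply: (hom_inj hj); [exact/k1R/Ncj|exact/Ncj/k1R|].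
  rewrite k1j; last exact: Ncj.
  by rewrite -n'E ?k1j //; [rewrite cjE !symM symK bsE|exact: k1R].
have [d ld] := lab_ex p_pr tT sF hth Fg.
exists g; last by move=> x Qx; rewrite gE ?k1Q //; apply: QR.
have ldR := lab_sub sF sR RN ld.
have lgR : lab R g e by apply: (lab_agree sF _ lk1) => x Rx; rewrite gE.
by rewrite (lab_th p_pr tT sF hth ceR lgR) -(lab_th p_pr tT sF hth ceR ldR).
Qed.

End LabelExtension.

(** * Extension of labelled morphisms *)

Section LabelledFixators.
Variables (p : nat) (S : groupType) (T : set S) (q : nat) (F : homsets S)
  (theta : set S -> set S -> (S -> S) -> coset_type (Out0 p F)).
Hypotheses (p_pr : prime p) (tT : toral p T q) (sF : saturated p F)
  (hth : theta_hat theta).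
Implicit Types (P Q R M Z D : set S) (f g h k : S -> S) (a b u v : sym S) (s t x y z : S)
  (c d e : coset_type (Out0 p F)).

Let fF := saturated_fusion sF.
Local Notation bullet := (bullet p T q F).
Local Notation lab := (lab theta).
Let lab_mor' := @lab_mor p S F theta sF.
Let lab_sub' := @lab_sub p S F theta sF.
Let lab_agree' := @lab_agree p S F theta sF.
Let lab_comp' := lab_comp p_pr tT sF hth.
Let lab_inv' := lab_inv p_pr tT sF hth.

(** Axiom (II) for morphisms on Q, with the label preserved. *)
Definition ext_at Q := forall f c, lab Q f c -> fully_centralized p F (f @` Q) ->
  exists2 g, lab (extender Q f) g c & agree Q g f.

Lemma lab_extend Q f c Z : ext_at Q -> lab Q f c -> fully_centralized p F (f @` Q) ->
  subgroup Z -> Z `<=` normaliser Q -> (forall s, Z s -> liftable Q f s) ->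
  exists2 g, lab Z g c & agree Q g f.
Proof.
move=> eQ lf cf sZ ZN Zl; have [g lg gf] := eQ f c lf cf; exists g => //.
apply: (lab_sub' sZ _ lg) => s Zs; apply/(extenderP fF _ (lab_mor' lf)).
by split; [exact: ZN|exact: Zl].
Qed.

(** By restriction each such c is a label of the identity of P. These labels form a group ([rclabM],
    [rclabV]), the ambiguity of labels on P. *)
Definition rclab P c := exists2 f, lab (RC P) f c & agree P f id.

Lemma rclabM P c d : subgroup P -> rclab P c -> rclab P d -> rclab P (c * d).
Proof.
move=> sP [f lf fid] [g lg gid].
have gR := RC_onto p_pr tT sF sP (lab_mor' lg) (im_agree_id gid).
exists (f \o g); last by move=> x Px; rewrite /= gid ?fid.
by apply: (lab_comp' lg lf) => x Rx; rewrite -gR; exists x.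
Qed.

Lemma rclabV P c : subgroup P -> rclab P c -> rclab P c^-1.
Proof.
move=> sP [f lf fid]; have hf := mor_inj_hom fF (lab_mor' lf).
have fR := RC_onto p_pr tT sF sP (lab_mor' lf) (im_agree_id fid).
exists (inv_on (RC P) f); first by have := lab_inv' lf; rewrite fR.
by move=> x Px; rewrite -{1}(fid x Px) (inv_on_f hf) //; apply: sub_RC.
Qed.

Lemma im_normaliser Q M f : mor F M f -> Q `<=` M -> M `<=` normaliser Q ->
  f @` M `<=` normaliser (f @` Q).
Proof.
move=> Ff QM MN; have hf := mor_inj_hom fF Ff.
have h x : M x -> forall y, (f @` Q) y -> (f @` Q) (cj (f x) y).
  move=> Mx _ [y Qy <-]; rewrite -(hom_cj hf) //; last exact: QM.
  by exists (cj x y) => //; apply: normaliser_cj (MN _ Mx) Qy.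
move=> _ [x Mx <-]; apply/normaliserP; split; first exact: h.
by rewrite -(homV hf Mx); apply/h/(subgroupV (hom_sub hf)).
Qed.

(** * Labels of morphisms that are trivial on P *)

Section Fix.
Variables (mu : set S -> nat) (P : set S).
Hypotheses (hmu1 : forall Q f, mor F Q f -> mu (f @` Q) = mu Q)
  (hmu2 : forall Q R, subgroup Q -> subgroup R -> Q `<=` R ->
     (mu R <= mu Q)%N /\ (mu R = mu Q -> R `<=` bullet Q))
  (sP : subgroup P) (nP : fully_normalized p F P)
  (Pcl : forall M, subgroup M -> P `<=` M -> ~ M `<=` P -> (mu M < mu P)%N)
  (IH : forall M, subgroup M -> (mu M < mu P)%N -> ext_at M).

Let N := normaliser P.
Let C := centraliser P.
Let cP : fully_centralized p F P := fn_fc sF sP nP.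

Definition fixed_at M := forall f c, lab M f c -> agree P f id -> rclab P c.

Lemma fix_normaliser M f : mor F M f -> P `<=` M -> M `<=` N -> agree P f id ->
  f @` M `<=` N.
Proof. by move=> Ff PM MN fid; have := im_normaliser Ff PM MN; rewrite (im_agree_id fid). Qed.

Lemma fixed_at_bullet M M' : subgroup M' -> P `<=` M -> M `<=` M' -> M' `<=` bullet M ->
  fixed_at M' -> fixed_at M.
Proof.
move=> sM' PM MM' bM X' f c lf fid.
have [g Fg gf] := bullet_extend p_pr tT sF sM' MM' bM (lab_mor' lf).
apply: (X' g c); first exact: (lab_bullet p_pr tT sF hth sM' MM' bM lf Fg gf).
by move=> x Px; rewrite gf ?fid //; apply: PM.
Qed.

Section Step.
Variable M : set S.
Hypotheses (sM : subgroup M) (MN : M `<=` N) (PM : P `<=` M) (MP : ~ M `<=` P).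
Hypothesis Mcl : forall M', subgroup M' -> M' `<=` N -> M `<=` M' -> ~ M' `<=` M ->
  (mu M' < mu M)%N.
Hypothesis IHM : forall M', subgroup M' -> M' `<=` N -> (mu M' < mu M)%N ->
  P `<=` M' -> ~ M' `<=` P -> fixed_at M'.

(** The subgroup D comes under the induction hypothesis: if its measure were that of M, it would lie
    in the closure of k(M), and the inverse of k would extend to D and map it to a strictly larger
    overgroup of M of the same measure. *)
Lemma fixed_over k D : mor F M k -> agree P k id -> subgroup D -> D `<=` N ->
  k @` M `<=` D -> ~ D `<=` k @` M -> fixed_at D.
Proof.
move=> Fk kid sD DN kD Dk; have hk := mor_inj_hom fF Fk.
have Pk : P `<=` k @` M by move=> x Px; exists x; [exact: PM|exact: kid].
have PD := subset_trans Pk kD.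
have skM := hom_im hk.
apply: (IHM sD DN) => //; last first.
  by move=> DP; apply: Dk; apply: subset_trans DP Pk.
have [le h] := hmu2 skM sD kD; rewrite hmu1 // in le h.
rewrite ltn_neqAle le andbT; apply/eqP => e.
have [g Fg gk] := bullet_extend p_pr tT sF sD kD (h e) (mor_inv fF Fk).
have hg := mor_inj_hom fF Fg.
have gid : agree P g id.
  move=> x Px; rewrite gk; last exact: Pk.
  by rewrite -{1}(kid x Px) (inv_on_f hk) //; apply: PM.
have : (mu (g @` D) < mu M)%N.
  apply: Mcl; [exact: hom_im hg|exact: fix_normaliser| |].
    move=> x Mx; exists (k x); first by apply: kD; exists x.
    by rewrite gk ?(inv_on_f hk) //; exists x.
  move=> gM; apply: Dk => y Dy.
  have My : M (g y) by apply: gM; exists y.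
  have Dk' : D (k (g y)) by apply: kD; exists (g y).
  exists (g y) => //; apply: (hom_inj hg) => //.
  by rewrite gk ?(inv_on_f hk) //; exists (g y).
by rewrite hmu1 // e ltnn.
Qed.

Lemma mul_cent Q D : subgroup Q -> subgroup D -> D `<=` normaliser Q ->
  subgroup (mul_set D (centraliser Q)).
Proof.
move=> sQ sD DN; apply: (subgroup_mul sD (@subgroup_centraliser _ _)) => x Dx.
exact/normaliser_cent/DN.
Qed.

Section Adjust.
Variable f : S -> S.
Hypothesis Ff : mor F M f.
Let M2 := f @` M.
Let P2 := f @` P.
Let G1 : set (sym S) := [set a | Aut F M2 a /\ agree P2 a id].
Let B1 : set (sym S) := G1 `&` Aut (homS (S:=S)) M2.
Hypotheses (nM2 : fully_normalized p F M2) (pG : pidx p G1 B1).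
Variables (g : S -> S) (d : coset_type (Out0 p F)).
Hypotheses (lg : lab (mul_set M2 (centraliser P2)) g d) (gf : forall x, P x -> g (f x) = x).

Let hf := mor_inj_hom fF Ff.
Let sM2 : subgroup M2 := hom_im hf.
Let PM2 : P2 `<=` M2 := @image_subset _ _ f _ _ PM.

Lemma subgroup_fix : subgroup G1.
Proof.
have sA2 := subgroup_Aut fF sM2; apply: mk_subgroup.
- by split; [exact: subgroup1|move=> x _].
- move=> x y [Ax xi] [Ay yi]; split; first exact: (subgroupM sA2).
  by move=> z Pz; rewrite symM yi // xi.
- move=> x [Ax xi]; split; first exact: (subgroupV sA2).
  by move=> z Pz; rewrite -{1}(xi z Pz) symK.
Qed.

Let K2 := mul_set M2 (centraliser P2).

Lemma g_normaliser : g @` K2 `<=` N.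
Proof.
have hg := mor_inj_hom fF (lab_mor' lg); have sP2 : subgroup P2 := hom_im_sub hf sP PM.
have M2K : M2 `<=` K2 by apply/mul_setl/subgroup_centraliser.
have K2N x : K2 x -> normaliser P2 x.
  move=> [y My [z cz <-]]; apply: normaliserM; first exact: (im_normaliser Ff PM MN).
  exact: centraliser_normaliser.
have h x : K2 x -> forall y, P y -> P (cj (g x) y).
  move=> Kx y Py; have Pf : P2 (f y) by exists y.
  have [z Pz e] : P2 (cj x (f y)) by apply: normaliser_cj (K2N _ Kx) Pf.
  rewrite -{1}(gf Py) -(hom_cj hg) //; last exact/M2K/PM2.
  by rewrite -e gf.
move=> _ [x Kx <-]; apply/normaliserP; split; first exact: h.
by rewrite -(homV hg Kx); apply/h/(subgroupV (hom_sub hg)).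
Qed.

(* [k @` M] and [M2] are isomorphic over [P], and the isomorphism may be chosen to
   extend to the normaliser of [k @` M] in [C_S(P)]. *)
Lemma adjust k f1 : mor F M k -> agree P k id -> mor F (k @` M) f1 ->
  f1 @` (k @` M) = M2 -> agree P f1 f -> ~ C `<=` k @` M ->
  exists f2 c, [/\ lab (k @` M) f2 c, f2 @` (k @` M) = M2, agree P f2 f, rclab P (d * c) &
    exists y, [/\ centraliser P2 y, normaliser M2 y & ~ M2 y]].
Proof.
move=> Fk kid Ff1 f1M f1P CM; have hk := mor_inj_hom fF Fk.
pose M1 := k @` M; rewrite -/M1 in Ff1 f1M CM *.
have sM1 : subgroup M1 := hom_im hk.
have PM1 : P `<=` M1 by move=> x Px; exists x; [exact: PM|exact: kid].
have M1N : M1 `<=` N by apply: fix_normaliser.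
have h1 := mor_inj_hom fF Ff1.
pose Y := C `&` normaliser M1.
have sY : subgroup Y by apply: subgroupI; [exact: subgroup_centraliser|exact: subgroup_normaliser].
have YN : Y `<=` normaliser M1 by move=> x [].
have sG1 := subgroup_fix.
have G1A : G1 `<=` Aut F (f1 @` M1) by rewrite f1M => x [].
have sB1 : subgroup B1 by apply: subgroupI => //; apply: subgroup_AutS.
have B1S : B1 `<=` Aut (homS (S:=S)) (f1 @` M1) by rewrite f1M => x [].
have B1G : B1 `<=` G1 by move=> x [].
have [a Ga al] : exists2 a, G1 a & forall s, Y s -> liftable M1 (a \o f1) s.
  apply: (receptive_core p_pr tT sF Ff1 sY YN sG1 G1A sB1 B1G B1S pG) => b s Ab [cs Ns] bs.
  split; first by rewrite -f1M.
  move=> _ [x Px <-]; rewrite -f1P // bs; last exact: PM1.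
  by rewrite ((centraliserP _ _).1 cs).
have [Aa ai] := Ga; have [aN Fa aM2] := (AutP fF _ _).1 Aa.
have Fa1 : mor F M1 (a \o f1).
  by apply: (mor_comp fF Ff1 Fa) => x M1x; rewrite -f1M; exists x.
have ha1 := mor_inj_hom fF Fa1.
have a1M : (a \o f1) @` M1 = M2 by rewrite -image_comp f1M.
have a1P : agree P (a \o f1) f by move=> x Px; rewrite /= f1P // ai //; exists x.
(* Normalisers grow in k(M) C; dividing the new normalising element by its factor in k(M) gives one
   in C. *)
have [w0 [Yc0 nc0]] : exists w0, Y w0 /\ ~ M1 w0.
  have sMC : subgroup (mul_set M1 C) by apply: mul_cent.
  have MMC : M1 `<=` mul_set M1 C by apply/mul_setl/subgroup_centraliser.
  have [|y [[m Mm [w0 cc0 <-]] ny Ny]] := normalizer_grows p_pr tT sM1 sMC MMC.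
    by move=> h; apply: CM => x Cx; apply: h; apply: mul_setr.
  exists w0; split; last by move=> Mc; apply: ny; apply: (subgroupM sM1).
  split=> //; rewrite -(mulKg m w0); apply: normaliserM => //.
  exact/normaliserV/(sub_normaliser sM1).
pose D := mul_set M1 Y.
have M1D : M1 `<=` D by apply: mul_setl.
have YD : Y `<=` D by apply: mul_setr.
have YNY : M1 `<=` normaliser Y.
  move=> x Mx; have Nx := sub_normaliser sM1 Mx; have Cx := normaliser_cent (M1N _ Mx).
  by apply/normaliserP; split=> y [cy ny]; split; try exact: normaliser_cj Cx cy;
     try exact: normaliser_cj (normaliserV Cx) cy;
     apply: (subgroup_cj (@subgroup_normaliser _ M1)) => //; apply: normaliserV.
have sD : subgroup D := subgroup_mul sM1 sY YNY.
have DN1 : D `<=` normaliser M1.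
  move=> _ [x Mx [y Yy <-]]; apply: normaliserM; last by case: Yy.
  exact: sub_normaliser.
have DN : D `<=` N.
  move=> _ [x Mx [y [cy _] <-]]; apply: normaliserM; first exact: M1N.
  exact: centraliser_normaliser.
have [h Fh ha] : exists2 h, mor F D h & agree M1 h (a \o f1).
  apply: (mor_extend sF Fa1) => //; first by rewrite a1M; apply: fn_fc.
  move=> _ [m Mm [y Yy <-]]; have [t tE] := al y Yy; exists ((a \o f1) m * t) => x Mx.
  have Myx : M1 (cj y x) by apply: normaliser_cj (YN _ Yy) Mx.
  by rewrite !cjM (hom_cj ha1) // tE.
have hh := mor_inj_hom fF Fh.
have [c lh] := lab_ex p_pr tT sF hth Fh.
have hP : h @` P = P2 by apply: eq_imagel => x Px; rewrite ha ?a1P //; apply: PM1.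
have hM1 : h @` M1 = M2 by rewrite -a1M; apply: eq_imagel.
have PD := subset_trans PM1 M1D.
have hY y : Y y -> centraliser P2 (h y).
  by move=> Yy; rewrite -hP; apply: (mor_cent sF Fh PD (YD _ Yy)); case: Yy.
have lc : lab M1 (a \o f1) c.
  by apply: (lab_agree' ha); apply: lab_sub' lh.
exists (a \o f1), c; split=> //; last first.
  exists (h w0); split; first exact: hY.
    have [_ Nc0] := Yc0; have Dc0 := YD _ Yc0; rewrite -hM1.
    have hn z : D z -> normaliser M1 z -> forall y, (h @` M1) y -> (h @` M1) (cj (h z) y).
      move=> Dz Nz _ [x Mx <-]; rewrite -(hom_cj hh) //; last exact: M1D.
      by exists (cj z x) => //; apply: normaliser_cj Nz Mx.
    apply/normaliserP; split; first exact: hn.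
    by rewrite -(homV hh Dc0); apply: hn; [exact: (subgroupV sD)|exact: normaliserV].
  rewrite -hM1 => -[x Mx e]; apply: nc0.
  by rewrite -(hom_inj hh (M1D _ Mx) (YD _ Yc0) e).
have DK x : D x -> K2 (h x).
  move=> [m Mm [y Yy <-]]; rewrite (homM hh); [|exact: M1D|exact: YD].
  exists (h m); first by rewrite -hM1; exists m.
  by exists (h y) => //; apply: hY.
(* The composite of h and g is trivial on P, has label d c and is defined on D, strictly above k(M),
   so d c lies in K by induction. *)
apply: (fixed_over Fk kid sD DN M1D) (lab_comp' lh lg DK) _.
  by move=> DM; apply: nc0; apply: DM; apply: YD.
by move=> x Px; rewrite /= ha ?a1P ?gf //; apply: PM1.
Qed.

End Adjust.

(** If C lies in M or in b(M), restricting b or its inverse gives c in K. Otherwise [adjust] yields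
    isomorphisms f1 and f2 from M and b(M) to M2 with labels c1 and c2 such that d c1 and d c2 are
    in K. The automorphism a = f2 b f1^-1 of M2 is trivial on P2; a Frattini factor v of the same
    label extends to a strictly larger D. Carried back by g it has label d c2 c c1^-1 d^-1, which is
    in K by induction, and c is recovered from the three elements of K. *)
Lemma fixed_step : fixed_at M.
Proof.
move=> b c lb bid; have Fb := lab_mor' lb; have hb := mor_inj_hom fF Fb.
have Fid := mor_id fF sM.
have idM : id @` M = M by rewrite image_id.
have bM2 : b @` M `<=` N by apply: fix_normaliser.
have rc_in M' g e : C `<=` M' -> P `<=` M' -> lab M' g e -> agree P g id -> rclab P e.
  move=> CM' PM' lg gid; exists g => //; apply: (lab_sub' (subgroup_RC sP) _ lg).
  move=> _ [x Px [y Cy <-]]; apply: (subgroupM (mor_subgroup fF (lab_mor' lg))).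
    exact: PM'.
  exact: CM'.
have [CM|CM] := pselect (C `<=` M); first exact: rc_in CM PM lb bid.
have PbM : P `<=` b @` M by move=> x Px; exists x; [exact: PM|exact: bid].
have invid : agree P (inv_on M b) id.
  by move=> x Px; rewrite -{1}(bid x Px) (inv_on_f hb) //; apply: PM.
have [CbM|CbM] := pselect (C `<=` b @` M).
  by rewrite -[c]invgK; apply: rclabV => //; apply: (rc_in _ _ _ CbM PbM (lab_inv' lb)).
pose G : set (sym S) := [set a | Aut F M a /\ agree P a id].
have GA : G `<=` Aut F M by move=> x [].
have sA := subgroup_Aut fF sM.
have sG : subgroup G.
  apply: mk_subgroup.
  - by split; [exact: subgroup1|move=> x _].
  - move=> x y [Ax xi] [Ay yi]; split; first exact: (subgroupM sA).
    by move=> z Pz; rewrite symM yi // xi.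
  - move=> x [Ax xi]; split; first exact: (subgroupV sA).
    by move=> z Pz; rewrite -{1}(xi z Pz) symK.
have [f [Ff nM2 pG]] := exists_fn_meet p_pr tT sF sM sG GA.
have hf := mor_inj_hom fF Ff; have sM2 := hom_im hf.
set M2 := f @` M in nM2 pG sM2; pose P2 := f @` P.
have Fi := mor_inv fF Ff.
have PM2 : P2 `<=` M2 by apply: image_subset.
have sP2 : subgroup P2 := hom_im_sub hf sP PM.
pose G1 : set (sym S) := [set a | Aut F M2 a /\ agree P2 a id].
have GE : transport F M f G = G1.
  apply/seteqP; split=> [x [Ax [a [Aa ai] xa]]|x [Ax xi]].
    by split=> // _ [z Pz <-]; rewrite xa ?ai //; apply: PM.
  split=> //; have xM z : M2 z -> M2 (x z) := @Aut_in _ _ fF _ _ _ Ax.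
  have Fx : mor F M (inv_on M f \o ((x : S -> S) \o f)).
    apply: (mor_comp fF (mor_comp fF Ff (Aut_mor fF Ax) _) Fi) => z Mz; first by exists z.
    by apply: xM; exists z.
  have imx : (inv_on M f \o ((x : S -> S) \o f)) @` M = M.
    rewrite -image_comp -image_comp.
    have [_ _ ->] := (AutP fF _ _).1 Ax; exact: im_inv_on.
  have [a Aa aE] := Aut_of fF Fx imx; exists a; first split=> //.
    move=> z Pz; rewrite aE ?xi /=; last exact: PM.
    by rewrite xi ?(inv_on_f hf) //; [exact: PM|exists z].
  by move=> z Mz; rewrite aE //= inv_onK //; apply: xM; exists z.
have sG1 : subgroup G1 by rewrite -GE; apply: (subgroup_transport sF Ff sG GA).
rewrite GE in pG; set B1 := _ `&` _ in pG.
have sB1 : subgroup B1 by apply: subgroupI => //; apply: subgroup_AutS.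
have B1G : B1 `<=` G1 by move=> x [].
have G1A : G1 `<=` Aut F M2 by move=> x [].
have M2N := im_normaliser Ff PM MN.
pose K2 := mul_set M2 (centraliser P2).
have sK2 : subgroup K2 by apply: mul_cent.
have K2N : K2 `<=` normaliser P2.
  move=> _ [x Mx [y cy <-]]; apply: normaliserM; first exact: M2N.
  exact: centraliser_normaliser.
have M2K : M2 `<=` K2 by apply/mul_setl/subgroup_centraliser.
have CK2 : centraliser P2 `<=` K2 by apply: mul_setr.
have [g Fg gE] : exists2 g, mor F K2 g & agree P2 g (inv_on M f).
  apply: (mor_extend sF) => //; first exact: (mor_sub fF sP2 PM2 Fi).
    by rewrite (im_inv_on hf PM).
  move=> _ [_ [m Mm <-] [y cy <-]]; exists m => _ [x Px <-].
  rewrite cjM ((centraliserP _ _).1 cy); last by exists x.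
  have Mx := PM Px; have Mmx : M (cj m x) := subgroup_cj sM Mm Mx.
  by rewrite -(hom_cj hf) // !(inv_on_f hf).
have gf x : P x -> g (f x) = x.
  by move=> Px; rewrite gE ?(inv_on_f hf) //; [exact: PM|exists x].
have hg := mor_inj_hom fF Fg.
have [d lg] := lab_ex p_pr tT sF hth Fg.
have idid : agree P id id by [].
have [f1 [c1 [lf1 f1M f1P rc1 [y [cy Ny ny]]]]] : exists f1 c1, [/\ lab (id @` M) f1 c1,
    f1 @` (id @` M) = M2, agree P f1 f, rclab P (d * c1) &
    exists y, [/\ centraliser P2 y, normaliser M2 y & ~ M2 y]].
  by apply: (adjust Ff nM2 pG lg gf Fid idid (f1 := f)); rewrite ?idM.
rewrite idM in lf1 f1M.
have [f2 [c2 [lf2 f2M f2P rc2 _]]] : exists f2 c2, [/\ lab (b @` M) f2 c2,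
    f2 @` (b @` M) = M2, agree P f2 f, rclab P (d * c2) &
    exists y, [/\ centraliser P2 y, normaliser M2 y & ~ M2 y]].
  apply: (adjust Ff nM2 pG lg gf Fb bid (f1 := f \o inv_on M b)) => //.
  - by apply: (mor_comp fF (mor_inv fF Fb) Ff) => x; apply: inv_on_in.
  - by rewrite -image_comp (im_inv_on hb).
  - by move=> x Px; rewrite /= invid.
have hf1 := mor_inj_hom fF (lab_mor' lf1).
have la1 : lab M2 (b \o inv_on M f1) (c * c1^-1).
  have := lab_inv' lf1; rewrite f1M => li; apply: (lab_comp' li lb) => x.
  by rewrite -f1M; apply: inv_on_in.
have la : lab M2 (f2 \o (b \o inv_on M f1)) (c2 * (c * c1^-1)).
  apply: (lab_comp' la1 lf2) => x; rewrite -f1M => hx.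
  by exists (inv_on M f1 x) => //; apply: inv_on_in.
have aM2 : (f2 \o (b \o inv_on M f1)) @` M2 = M2.
  by rewrite -image_comp -image_comp -{1}f1M (im_inv_on hf1) //.
have [a Aa aE] := Aut_of fF (lab_mor' la) aM2.
have aid : agree P2 a id.
  move=> _ [x Px <-]; rewrite aE; last by apply: PM2; exists x.
  by rewrite /= -{1}f1P // (inv_on_f hf1) ?bid ?f2P //; apply: PM.
have Ga : G1 a by [].
have tB1 : ptorsion p B1.
  by move=> x [_ Bx]; apply: (AutS_ptorsion fF sM2 (toral_p tT) Bx).
have [u [v [Ou Gv uv vB]]] := frattini p_pr sG1 sB1 B1G pG tB1 Ga.
have Gu := nclosure_sub sG1 B1G Ou.
have lu : lab M2 u 1.
  apply: (lab_nclosure p_pr tT sF hth sM2 sG1 G1A B1G _ Ou) => x [_ /AutSP -/(_ sM2)[_ [s Ns xs]]].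
  apply: (lab_agree' _ (lab_cj p_pr tT sF hth s sM2)) => z Mz; by rewrite xs.
have laa : lab M2 a (c2 * (c * c1^-1)) by apply: (lab_agree' _ la) => x Mx; rewrite aE.
have AuV := subgroupV (subgroup_Aut fF sM2) (G1A _ Gu).
have lv : lab M2 v (c2 * (c * c1^-1)).
  have := lab_symM p_pr tT sF hth AuV Aa (lab_symV p_pr tT sF hth (G1A _ Gu) lu) laa.
  by rewrite invg1 mul1g uv mulgA mulVg mul1g.
have [Av vid] := Gv; have [_ _ vM2] := (AutP fF _ _).1 Av.
pose Y := centraliser P2 `&` normaliser M2.
have sY : subgroup Y by apply: subgroupI; [exact: subgroup_centraliser|exact: subgroup_normaliser].
pose D := K2 `&` normaliser M2.
have sD : subgroup D by apply: subgroupI => //; apply: subgroup_normaliser.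
have M2D : M2 `<=` D by move=> x Mx; split; [exact: M2K|exact: sub_normaliser].
have DM2 : D `<=` normaliser M2 by move=> x [].
have [h lh hv] : exists2 h, lab D h (c2 * (c * c1^-1)) & agree M2 h v.
  apply: (lab_extend _ lv _ sD DM2); first 1 last.
  - by rewrite vM2; apply: fn_fc.
  - move=> _ [[m Mm [z cz <-]] Nmz].
    have Nz : normaliser M2 z.
      by rewrite -(mulKg m z); apply: normaliserM => //; apply/normaliserV/(sub_normaliser sM2).
    have [w Bw wz] := AutS_of sM2 Nz.
    have B1w : B1 w.
      split=> //; split; first exact: (AutS_Aut fF sM2).
      by move=> x Px; rewrite wz; [apply: (centraliserP _ _).1 cz _ Px|exact: PM2].
    have [_ /AutSP -/(_ sM2)[_ [t Nt tE]]] := vB _ B1w.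
    exists (v m * t) => x Mx; have Mzx : M2 (cj z x) by apply: normaliser_cj Nz Mx.
    have Mvx : M2 (v x) by apply: (Aut_in fF Av).
    have hv := mor_inj_hom fF (Aut_mor fF Av).
    by rewrite !cjM (hom_cj hv) // -tE // cjE !symM symK wz.
  - apply: IH => //; rewrite /M2 hmu1 //; exact: Pcl.
have Fh := lab_mor' lh; have hh := mor_inj_hom fF Fh.
have hP : h @` P2 = P2.
  by apply: im_agree_id => x Px; rewrite hv ?vid //; apply: PM2.
have DK x : D x -> K2 x by case.
have P2D := subset_trans PM2 M2D.
have hDK x : D x -> K2 (h x).
  move=> Dx; have [[m Mm [z cz e]] _] := Dx; rewrite -e in Dx *.
  have Dm := M2D _ Mm; have Dz : D z by apply: (subgroup_divl sD Dm Dx).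
  rewrite (homM hh) //; exists (h m); first by rewrite hv //; apply: (Aut_in fF Av).
  by exists (h z) => //; rewrite -hP; apply: (mor_cent sF Fh P2D Dz cz).
pose M3 := g @` D.
have sM3 : subgroup M3 by apply: (hom_im_sub hg).
have lgD : lab D g d by apply: (lab_sub' sD _ lg).
have lM3 : lab M3 (g \o (h \o inv_on D g)) (d * (c2 * (c * c1^-1) * d^-1)).
  have h1 := lab_comp' (lab_inv' lgD) lh (fun x hx => inv_on_in hx).
  by apply: (lab_comp' h1 lg) => x hx; apply: hDK; apply: inv_on_in hx.
have hgD := mor_inj_hom fF (lab_mor' lgD).
have : rclab P (d * (c2 * (c * c1^-1) * d^-1)).
  have Fk : mor F M (g \o f).
    by apply: (mor_comp fF Ff Fg) => x Mx; apply: M2K; exists x.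
  have kid : agree P (g \o f) id by move=> x Px; apply: gf.
  apply: (fixed_over Fk kid sM3 _ _ _ lM3).
  - move=> _ [x /DK Kx <-]; apply: (g_normaliser Ff lg gf); by exists x.
  - by rewrite -image_comp; apply: image_subset.
  - rewrite -image_comp => MM; apply: ny.
    have Dy : D y by split=> //; apply: CK2.
    have [z Mz e] : (g @` M2) (g y) by apply: MM; exists y.
    by rewrite -(hom_inj hg (M2K _ Mz) (CK2 _ cy) e).
  - move=> x Px; have Pf : P2 (f x) by exists x.
    rewrite /= -{1}(gf x Px) (inv_on_f hgD (P2D _ Pf)) hv; last exact: PM2.
    by rewrite vid // gf.
move=> rc; have := rclabM sP (rclabM sP (rclabV sP rc2) rc) rc1.
by rewrite invgM -!mulgA mulKg mulKg mulKg mulVg mulg1.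
Qed.

End Step.

(** The induction stays inside N_S(P): closures are intersected with it. *)
Lemma rclab_fix M f c : subgroup M -> P `<=` M -> ~ M `<=` P -> M `<=` N ->
  lab M f c -> agree P f id -> rclab P c.
Proof.
move=> sM PM MP MN; move: f c; rewrite -/(fixed_at M).
have sN : subgroup N := @subgroup_normaliser _ P.
pose X M := P `<=` M -> ~ M `<=` P -> fixed_at M.
apply: (bullet_ind p_pr tT sF (X := X) sN hmu2 _ _ sM MN PM MP) => {sM PM MP MN}M.
  move=> sM MN XM PM MP; have sB := subgroup_bullet p_pr tT sF sM.
  have sM' : subgroup (bullet M `&` N) by apply: subgroupI.
  have MM' : M `<=` bullet M `&` N.
    by move=> x Mx; split; [exact: (sub_bullet tT sF Mx)|exact: MN].
  have bM : bullet M `&` N `<=` bullet M by move=> x [].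
  apply: (fixed_at_bullet sM' PM MM' bM (XM (subset_trans PM MM') _)).
  by move=> M'P; apply: MP; apply: subset_trans MM' M'P.
move=> sM MN Mcl IHM PM MP.
exact: (fixed_step sM MN PM MP Mcl IHM).
Qed.

End Fix.
End LabelledFixators.

(** * Axiom (II) with labels *)

Section LabelledExtension.
Variables (p : nat) (S : groupType) (T : set S) (q : nat) (F : homsets S)
  (theta : set S -> set S -> (S -> S) -> coset_type (Out0 p F)).
Hypotheses (p_pr : prime p) (tT : toral p T q) (sF : saturated p F)
  (hth : theta_hat theta).
Implicit Types (P Q R M Z D : set S) (f g h k : S -> S) (a b u v : sym S) (s t x y z : S)
  (c d e : coset_type (Out0 p F)).

Let fF := saturated_fusion sF.
Let fE1 : fusion_system (E1 theta) := E1_fusion theta sF.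
Local Notation bullet := (bullet p T q F).
Local Notation lab := (lab theta).
Local Notation ext_at := (ext_at theta).
Local Notation rclab := (rclab theta).
Let lab_mor' := @lab_mor p S F theta sF.
Let lab_sub' := @lab_sub p S F theta sF.
Let lab_agree' := @lab_agree p S F theta sF.
Let lab_comp' := lab_comp p_pr tT sF hth.
Let lab_inv' := lab_inv p_pr tT sF hth.

Lemma ext_at_centric Q : centric F Q -> ext_at Q.
Proof.
move=> cQ f c lf cf; have Ff := lab_mor' lf.
have [g Fg gf] := saturated_extend sF Ff cf; exists g => //.
have [d ld] := lab_ex p_pr tT sF hth Fg.
have QE : Q `<=` extender Q f by move=> x Qx; apply: (sub_extender fF Ff Qx).
have lf' : lab Q g c by apply: (lab_agree' _ lf) => x Qx; rewrite gf.
have lg' := lab_sub' cQ.1 QE ld.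
by rewrite (lab_th p_pr tT sF hth cQ lf') -(lab_th p_pr tT sF hth cQ lg').
Qed.

(** Let f1 extend f to the closure. The image of f1 has the same centraliser as f(Q), hence is fully
    centralized, and an element lifted through f is lifted through f1 by uniqueness of extensions;
    so N_f lies in the extender of f1. *)
Lemma ext_at_bullet Q : subgroup Q -> ext_at (bullet Q) -> ext_at Q.
Proof.
move=> sQ eB f c lf cf; have Ff := lab_mor' lf.
have sB := subgroup_bullet p_pr tT sF sQ; have QB := @sub_bullet p S T q F tT sF Q.
have [f1 Ff1 f1f] := bullet_extend p_pr tT sF sB QB (@subset_refl _ _) Ff.
have lf1 := lab_bullet p_pr tT sF hth sB QB (@subset_refl _ _) lf Ff1 f1f.
have hf := mor_inj_hom fF Ff; have sfQ := hom_im hf.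
have fQB : f @` Q `<=` f1 @` bullet Q.
  by move=> _ [x Qx <-]; exists x; [exact: QB|exact: f1f].
have bE := bullet_im p_pr tT sF sQ Ff1 f1f Ff.
have cf1 : fully_centralized p F (f1 @` bullet Q).
  move=> _ /(isoclassP fF)[k Fk <-].
  have fB : f1 @` bullet Q `<=` bullet (f @` Q) by rewrite bE.
  rewrite (centraliser_bullet_im p_pr tT sF fQB fB sfQ Fk).
  have := centraliser_bullet_im p_pr tT sF fQB fB sfQ (mor_id fF (mor_subgroup fF Fk)).
  by rewrite !image_id => ->; apply/cf/isoclass_im/(mor_sub fF sfQ fQB Fk).
have [g lg gf1] := eB f1 c lf1 cf1.
have sE : subgroup (extender Q f).
  by have [g1 /(mor_subgroup fF)] := saturated_extend sF Ff cf.
exists g; last by move=> x Qx; rewrite gf1 ?f1f //; apply: QB.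
apply: (lab_sub' sE _ lg) => s /(extenderP fF _ Ff)[Ns [t tE]].
have NB : normaliser (bullet Q) s.
  have Fs := mor_cj fF s sB.
  by have := bullet_im p_pr tT sF sQ Fs (fun x _ => erefl) (mor_cj fF s sQ); rewrite Ns.
apply/(extenderP fF _ Ff1); split=> //; exists t.
have F1 : mor F (bullet Q) (f1 \o cj s).
  by apply: (mor_comp fF (mor_cj fF s sB) Ff1) => x; apply: normaliser_cj.
have F2 : mor F (bullet Q) (cj t \o f1).
  by apply: (mor_comp fF Ff1 (mor_cj fF t (subgroupT S))).
apply: (bullet_uniq p_pr tT sF QB (@subset_refl _ _) sQ F1 F2) => x Qx.
by rewrite /= !f1f ?tE //; apply: normaliser_cj Ns Qx.
Qed.

(** * The conjugacy class of a non-centric subgroup P *)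

Section Class.
Variables (mu : set S -> nat) (P : set S).
Hypotheses (hmu1 : forall Q f, mor F Q f -> mu (f @` Q) = mu Q)
  (hmu2 : forall Q R, subgroup Q -> subgroup R -> Q `<=` R ->
     (mu R <= mu Q)%N /\ (mu R = mu Q -> R `<=` bullet Q))
  (sP : subgroup P) (nP : fully_normalized p F P)
  (Pcl : forall M, subgroup M -> P `<=` M -> ~ M `<=` P -> (mu M < mu P)%N)
  (IH : forall M, subgroup M -> (mu M < mu P)%N -> ext_at M)
  (nc : ~ centric F P).

Let N := normaliser P.
Let cP : fully_centralized p F P := fn_fc sF sP nP.

Variables (hq : set S -> S -> S) (gq : set S -> coset_type (Out0 p F)).
Hypothesis hqP : forall Q, isoclass F P Q ->
  lab (normaliser Q) (hq Q) (gq Q) /\ hq Q @` Q = P.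

(* [f] and [c] are realised, through the isomorphisms [hq], by an automorphism of
   P C_S(P). *)
Definition realised Q f c := exists2 k, lab (RC P) k (gq (f @` Q) * (c * (gq Q)^-1)) &
  forall x, Q x -> k (hq Q x) = hq (f @` Q) (f x).

Lemma class_im Q f : isoclass F P Q -> mor F Q f -> isoclass F P (f @` Q).
Proof. by move=> iQ Ff; apply: (isoclass_trans fF iQ); apply: isoclass_im. Qed.

Lemma realised_agree Q f g c : agree Q f g -> realised Q f c -> realised Q g c.
Proof.
move=> fg [k lk kE]; have e : f @` Q = g @` Q by apply: eq_imagel.
by exists k; rewrite -e // => x Qx; rewrite kE ?fg.
Qed.

Lemma hq_in Q x : isoclass F P Q -> Q x -> P (hq Q x).
Proof. by move=> /hqP[_ hQ] Qx; rewrite -hQ; exists x. Qed.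

Lemma realised_RC Q f k : isoclass F P Q -> mor F Q f -> mor F (RC P) k ->
  (forall x, Q x -> k (hq Q x) = hq (f @` Q) (f x)) -> k @` P = P /\ k @` RC P = RC P.
Proof.
move=> iQ Ff Fk kE; suff kP : k @` P = P by split=> //; apply: (RC_onto p_pr tT sF sP Fk kP).
have [_ h1] := hqP iQ; have [_ h2] := hqP (class_im iQ Ff).
by rewrite -{1}h1 -h2 !image_comp; apply: eq_imagel => x Qx; apply: kE.
Qed.

Lemma realised_comp Q f g c d : isoclass F P Q -> mor F Q f -> mor F (f @` Q) g ->
  realised Q f c -> realised (f @` Q) g d -> realised Q (g \o f) (d * c).
Proof.
move=> iQ Ff Fg [k lk kE] [l ll lE]; rewrite /realised -image_comp.
have [_ kR] := realised_RC iQ Ff (lab_mor' lk) kE.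
exists (l \o k); last by move=> x Qx; rewrite /= kE // lE //; exists x.
have kRC x : RC P x -> RC P (k x) by move=> Rx; rewrite -kR; exists x.
by have := lab_comp' lk ll kRC; rewrite -!mulgA mulKg.
Qed.

Lemma realised_inv Q f c : isoclass F P Q -> mor F Q f -> realised Q f c ->
  realised (f @` Q) (inv_on Q f) c^-1.
Proof.
move=> iQ Ff [k lk kE]; have hf := mor_inj_hom fF Ff.
have [_ kR] := realised_RC iQ Ff (lab_mor' lk) kE.
rewrite /realised (im_inv_on hf) //; exists (inv_on (RC P) k).
  by have := lab_inv' lk; rewrite kR !invgM invgK mulgA.
move=> _ [x Qx <-]; rewrite (inv_on_f hf) // -kE // (inv_on_f (mor_inj_hom fF (lab_mor' lk))) //.
exact/sub_RC/hq_in.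
Qed.

(** Let g be f transported to M1 = hq(M), of label e. Axiom (II) extends g on P to a map a defined
    on M1 and on [RC P], whose label d may differ from e. Both agree on P and M1 is strictly larger
    than P, so e d^-1 is in K by [rclab_fix], and an automorphism r of that label corrects a. *)
Lemma realised_over Q M f c : isoclass F P Q -> subgroup M -> Q `<=` M -> ~ M `<=` Q ->
  M `<=` normaliser Q -> lab M f c -> realised Q f c.
Proof.
move=> iQ sM QM MQ MN lf; have Ff := lab_mor' lf; have hf := mor_inj_hom fF Ff.
have [_ sQ] := isoclass_subgroup fF iQ.
have iQ' := class_im iQ (mor_sub fF sQ QM Ff).
have [lh1 h1Q] := hqP iQ; have [lh2 h2Q] := hqP iQ'.
have lh1M := lab_sub' sM MN lh1.
set h1 := hq Q in lh1 h1Q lh1M *; set h2 := hq (f @` Q) in lh2 h2Q *.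
have Fh1 := lab_mor' lh1M; have hh1 := mor_inj_hom fF Fh1.
pose M1 := h1 @` M; have sM1 : subgroup M1 := hom_im hh1.
have PM1 : P `<=` M1 by rewrite -h1Q; apply: image_subset.
have M1N : M1 `<=` N by have := im_normaliser sF Fh1 QM MN; rewrite h1Q.
have fMN := im_normaliser sF Ff QM MN.
have lf1 := lab_comp' (lab_inv' lh1M) lf (fun y hy => inv_on_in hy).
have f1N y : M1 y -> normaliser (f @` Q) ((f \o inv_on M h1) y).
  by move=> hy; apply: fMN; exists (inv_on M h1 y) => //; apply: inv_on_in.
have lg := lab_comp' lf1 lh2 f1N.
set g := h2 \o _ in lg; set e := _ * _ in lg.
have gE x : M x -> g (h1 x) = h2 (f x) by move=> Mx; rewrite /g /= (inv_on_f hh1).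
have gP : g @` P = P.
  rewrite -{1}h1Q image_comp -h2Q image_comp; apply: eq_imagel => x Qx.
  by rewrite /= -gE //; apply: QM.
have Fg := lab_mor' lg; have hg := mor_inj_hom fF Fg.
have FgP := mor_sub fF sP PM1 Fg.
have [a Fa aE] : exists2 a, F (extender P g) [set: S] a & agree P a g.
  by apply: (saturated_extend sF FgP); rewrite gP.
have RE : RC P `<=` extender P g.
  move=> x Rx; apply/(extenderP fF _ FgP); split; first exact: (RC_normaliser sP).
  exact: (RC_liftable (mor_inj_hom fF FgP)).
have ME : M1 `<=` extender P g.
  move=> y My; apply/(extenderP fF _ FgP); split; first exact: M1N.
  by exists (g y) => x Px; rewrite (hom_cj hg) //; apply: PM1.
have [d la] := lab_ex p_pr tT sF hth Fa.
have laM := lab_sub' sM1 ME la; have laR := lab_sub' (subgroup_RC sP) RE la.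
have lr := lab_comp' (lab_inv' lg) laM (fun y hy => inv_on_in hy).
have gM1 : g @` M1 `<=` N by have := im_normaliser sF Fg PM1 M1N; rewrite gP.
have PgM : P `<=` g @` M1 by rewrite -{1}gP; apply: image_subset.
have [r lr' rid] : rclab P (e * d^-1).
  rewrite -[e]invgK -invgM; apply: (rclabV p_pr tT sF hth sP).
  apply: (rclab_fix p_pr tT sF hth hmu1 hmu2 sP nP Pcl IH (hom_im hg) PgM _ gM1 lr).
    move=> MP; apply: MQ => x Mx.
    have : P (g (h1 x)) by apply: MP; exists (h1 x) => //; exists x.
    rewrite -{1}gP -{1}h1Q => -[_ [y Qy <-]].
    have M1h z : M z -> M1 (h1 z) by move=> Mz; exists z.
    move=> /(hom_inj hg (M1h _ (QM _ Qy)) (M1h _ Mx)) /(hom_inj hh1 (QM _ Qy) Mx).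
    by move=> <-.
  move=> y; rewrite -{1}gP => -[x Px <-]; have M1x := PM1 _ Px.
  by rewrite /= (inv_on_f hg) // aE.
have aP : a @` P = P by rewrite -[RHS]gP; apply: eq_imagel.
have aR := RC_onto p_pr tT sF sP (lab_mor' laR) aP.
exists (r \o a).
  have -> : gq (f @` Q) * (c * (gq Q)^-1) = e * d^-1 * d by rewrite mulgVK.
  by apply: (lab_comp' laR lr') => x Rx; rewrite -aR; exists x.
move=> x Qx; have Px : P (h1 x) by rewrite -h1Q; exists x.
rewrite /= aE // rid; first by rewrite gE //; apply: QM.
by rewrite -gP; exists (h1 x).
Qed.

Lemma class_normaliser Q : isoclass F P Q -> ~ normaliser Q `<=` Q.
Proof.
move=> iQ NQ; have [_ sQ] := isoclass_subgroup fF iQ.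
apply: nc; have [f Ff <-] := (isoclassP fF _ _).1 (isoclass_sym fF iQ).
apply: (centric_im sF _ Ff); suff -> : Q = [set: S] by apply: (centric_setT p_pr tT sF).
apply/seteqP; split=> // x _; apply: contrapT => nx.
have [|y [_ ny Ny]] := normalizer_grows p_pr tT sQ (subgroupT S) (fun x _ => Logic.I).
  by move=> h; apply: nx; apply: h.
by apply: ny; apply: NQ.
Qed.

Lemma realised_norm Q f c : isoclass F P Q -> lab (normaliser Q) f c -> realised Q f c.
Proof.
move=> iQ lf; have [_ sQ] := isoclass_subgroup fF iQ.
apply: (realised_over iQ _ _ (class_normaliser iQ) _ lf) => //.
  exact: subgroup_normaliser.
exact: sub_normaliser.
Qed.

(** A generator has a centric source, which strictly contains the non-centric Q, so [realised_over]
    applies to the normaliser of Q in it. Quantifying over all Q in the source makes the property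
    stable under the operations of [mk_fusion]. *)
Lemma realised_E1 R f : mor (E1 theta) R f ->
  forall Q, Q `<=` R -> isoclass F P Q -> realised Q f 1.
Proof.
pose M R f := mor (E1 theta) R f /\
  forall Q, Q `<=` R -> isoclass F P Q -> realised Q f 1.
have EF R0 g : mor (E1 theta) R0 g -> mor F R0 g by apply: E1_sub.
suff fM : fusion_system (of_mor M).
  move=> Ef; suff : of_mor M R [set: S] f by case=> -[].
  apply: (fusion_gen_min fM _ Ef) => {Ef R f} R R' f [cR cR' Ff f1].
  have /(F_mor fF)[Mf sR' fRR'] := Ff; split=> //.
  rewrite (th_theta p_pr tT sF hth cR cR' Ff) in f1.
  have Ef := fusion_of_th p_pr tT sF cR Mf f1; split=> // Q QR iQ.
  have [_ sQ] := isoclass_subgroup fF iQ.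
  have nQ : ~ R `<=` Q.
    move=> RQ; apply: nc; have e : Q = R by apply/seteqP.
    have [g Fg <-] := (isoclassP fF _ _).1 (isoclass_sym fF iQ).
    by apply: (centric_im sF _ Fg); rewrite e.
  pose D := R `&` normaliser Q.
  have [y [Ry ny Ny]] := normalizer_grows p_pr tT sQ cR.1 QR nQ.
  have sD : subgroup D by apply: subgroupI; [case: cR|exact: subgroup_normaliser].
  have QD : Q `<=` D by move=> x Qx; split; [exact: QR|exact: sub_normaliser].
  apply: (realised_over iQ sD QD) => [h|x []//|]; first by apply: ny; apply: h.
  apply: (lab_sub' sD (Q := R)); first by move=> x [].
  by have := th_lab p_pr tT sF hth cR Mf; rewrite f1.
apply: mk_fusion.
- by move=> R0 g [/(mor_inj_hom fE1)].
- move=> R0 g h gh [Eg Mg]; split; first exact: (mor_agree fE1 gh Eg).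
  move=> Q QR iQ; apply: (realised_agree _ (Mg Q QR iQ)) => x Qx.
  exact/gh/QR.
- move=> R0 R1 g h [Eg Mg] [Eh Mh] gR; split; first exact: (mor_comp fE1 Eg Eh).
  move=> Q QR iQ; have [_ sQ] := isoclass_subgroup fF iQ.
  have Fg := mor_sub fF sQ QR (EF _ _ Eg).
  have gQ : g @` Q `<=` R1 by move=> _ [x Qx <-]; apply/gR/QR.
  have sgQ := hom_im (mor_inj_hom fF Fg).
  rewrite -[1]mulg1; apply: (realised_comp iQ Fg (mor_sub fF sgQ gQ (EF _ _ Eh))).
    exact: Mg.
  by apply: Mh => //; apply: class_im.
- move=> R0 s sR; split; first exact: (mor_cj fE1).
  move=> Q QR iQ; apply: realised_norm => //.
  exact/(lab_cj p_pr tT sF hth)/subgroup_normaliser.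
- move=> R0 g [Eg Mg]; split; first exact: (mor_inv fE1).
  have hg := mor_inj_hom fE1 Eg.
  move=> Q QR iQ; have [_ sQ] := isoclass_subgroup fF iQ.
  have Fi := mor_sub fF sQ QR (EF _ _ (mor_inv fE1 Eg)).
  have iQ' := class_im iQ Fi; set Q' := _ @` Q in iQ'.
  have Q'R : Q' `<=` R0 by move=> _ [x /QR Rx <-]; apply: inv_on_in.
  have sQ' := (isoclass_subgroup fF iQ').2.
  have gQ' : g @` Q' = Q.
    rewrite image_comp -[RHS]image_id; apply: eq_imagel => x /QR Rx.
    exact: (inv_onK Rx).
  have Fg := mor_sub fF sQ' Q'R (EF _ _ Eg); have hg' := mor_inj_hom fF Fg.
  have := realised_inv iQ' Fg (Mg Q' Q'R iQ'); rewrite gQ' invg1.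
  apply: realised_agree => x Qx.
  have Qx' : Q' (inv_on R0 g x) by exists x.
  by rewrite -{1}(inv_onK (QR _ Qx)) (inv_on_f hg').
Qed.

Lemma realised_lab Q f c : isoclass F P Q -> lab Q f c -> realised Q f c.
Proof.
move=> iQ [a [Aa <- Ef]]; have Ff := E1_sub sF Ef; have hf := mor_inj_hom fF Ff.
have sfQ := hom_im hf.
have r1 := realised_E1 Ef (@subset_refl _ _) iQ.
have iQ' := class_im iQ Ff.
have r2 : realised (twist a f @` Q) a (ta theta a).
  by apply: (realised_norm iQ'); exact: (@lab_A p S F theta sF a _ Aa (subgroup_normaliser _)).
have := realised_comp iQ Ff (A_mor sF Aa sfQ) r1 r2; rewrite mulg1.
by apply: realised_agree => x _; rewrite /= /twist symKV.
Qed.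

(** An arbitrary extension g of f to N_f has some label d. Let k and l realise f with the labels c
    and d. Then k l^-1 is trivial on P and, carried to f(Q), gives an automorphism of [RC (f Q)] of
    label c d^-1 that is trivial on f(Q). By [lab_normaliser] there is such a morphism m on
    N_S(f(Q)), and [m \o g] has label c. *)
Lemma ext_at_class Q : isoclass F P Q -> ext_at Q.
Proof.
move=> iQ f c lf cf; have Ff := lab_mor' lf; have hf := mor_inj_hom fF Ff.
have [_ sQ] := isoclass_subgroup fF iQ.
have [g Fg gf] := saturated_extend sF Ff cf.
have [d lg] := lab_ex p_pr tT sF hth Fg.
have sE := mor_subgroup fF Fg.
have QE : Q `<=` extender Q f by move=> x Qx; apply: (sub_extender fF Ff Qx).
have lgQ : lab Q f d by apply: (lab_agree' gf); apply: (lab_sub' sQ QE lg).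
have [k lk kE] := realised_lab iQ lf; have [l ll lE] := realised_lab iQ lgQ.
have [lP lR] := realised_RC iQ Ff (lab_mor' ll) lE.
have [kP kR] := realised_RC iQ Ff (lab_mor' lk) kE.
have iQ' := class_im iQ Ff; have sQ' := hom_im hf.
pose Q' := f @` Q; rewrite -/Q' in cf lk ll kE lE iQ' sQ'.
have hl := mor_inj_hom fF (lab_mor' ll).
have lli := lab_inv' ll; rewrite lR in lli.
have lRC y : RC P y -> RC P (inv_on (RC P) l y).
  by rewrite -{1}lR; apply: inv_on_in.
pose r := k \o inv_on (RC P) l.
have lr : lab (RC P) r (gq Q' * (c * d^-1) * (gq Q')^-1).
  by have := lab_comp' lli lk lRC; rewrite !invgM invgK -!mulgA mulKg.
have rid : agree P r id.
  move=> y; rewrite -(hqP iQ').2 => -[_ [x Qx <-] <-].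
  rewrite /r /= -{1}lE // (inv_on_f hl) ?kE //.
  exact/sub_RC/hq_in.
have [lh hQ'] := hqP iQ'; set h := hq Q' in lh hQ'.
have RN : RC Q' `<=` normaliser Q' := RC_normaliser sQ'.
have lhR := lab_sub' (subgroup_RC sQ') RN lh.
have hh := mor_inj_hom fF (lab_mor' lhR).
have QR := @sub_RC _ Q'.
have hR : h @` RC Q' = RC P.
  have Fi := mor_inv fF (mor_sub fF sQ' QR (lab_mor' lhR)); rewrite hQ' in Fi.
  have iP : inv_on Q' h @` P = Q'.
    by rewrite -{1}hQ' (im_inv_on (mor_inj_hom fF (mor_sub fF sQ' QR (lab_mor' lhR)))).
  have [m Fm mE] : exists2 m, mor F (RC P) m & agree P m (inv_on Q' h).
    by apply: (extend_RC sF Fi); rewrite iP.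
  have mP : m @` P = Q' by rewrite -iP; apply: eq_imagel.
  have mR x : RC P x -> RC Q' (m x).
    by move=> Rx; rewrite -mP; apply: (mor_RC sF Fm sP (@sub_RC _ P) Rx Rx).
  have Fhm := mor_comp fF Fm (lab_mor' lhR) mR.
  have hmP : (h \o m) @` P = P by rewrite -image_comp mP.
  have e := RC_onto p_pr tT sF sP Fhm hmP.
  apply/seteqP; split=> [_ [x Rx <-]|x]; last first.
    by rewrite -{1}e => -[y Ry <-]; exists (m y) => //; apply: mR.
  by rewrite -{1}hQ'; apply: (mor_RC sF (lab_mor' lhR) sQ' QR Rx Rx).
have rR := RC_onto p_pr tT sF sP (lab_mor' lr) (im_agree_id rid).
have hRx x : RC Q' x -> RC P (h x) by move=> Rx; rewrite -hR; exists x.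
have l1 := lab_comp' lhR lr hRx.
have lhi := lab_inv' lhR; rewrite hR in lhi.
have rRC x : RC Q' x -> RC P (r (h x)).
  by move=> Rx; rewrite -rR; exists (h x) => //; apply: hRx.
have l2 : lab (RC Q') (inv_on (RC Q') h \o (r \o h)) (c * d^-1).
  by have := lab_comp' l1 lhi rRC; rewrite -!mulgA mulVg mulg1 mulKg.
have [m lm mid] : exists2 m, lab (normaliser Q') m (c * d^-1) & agree Q' m id.
  apply: (lab_normaliser p_pr tT sF hth sQ' cf l2) => x Qx.
  have Rx := QR _ Qx; rewrite /= rid ?(inv_on_f hh) // -hQ'; by exists x.
exists (m \o g); last by move=> x Qx; rewrite /= gf // mid //; exists x.
rewrite -[c](mulgVK d); apply: (lab_comp' lg lm) => s Es.
have EN : extender Q f `<=` normaliser Q by move=> x /(extenderP fF _ Ff)[].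
have := im_normaliser sF Fg QE EN.
have -> : g @` Q = Q' by apply: eq_imagel.
by apply; exists s.
Qed.

End Class.

(** The induction treats whole F-classes, since the non-centric case passes to a fully normalized
    member. *)
Theorem lab_extender Q f c : lab Q f c -> fully_centralized p F (f @` Q) ->
  exists2 g, lab (extender Q f) g c & agree Q g f.
Proof.
move=> lf; have sQ := mor_subgroup fF (lab_mor' lf); move: f c lf; rewrite -/(ext_at Q).
have [mu [hmu1 hmu2]] := exists_measure p_pr tT sF.
pose X M := forall R, isoclass F M R -> ext_at R.
suff : X Q by apply; apply: isoclass_refl.
apply: (bullet_ind p_pr tT sF (mu := mu) (Z := [set: S]) (X := X)) => //.
- exact: subgroupT.
- move=> {sQ Q}M sM _; rewrite setIT => XB R /(isoclassP fF)[f Ff <-].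
  have MB := @sub_bullet p S T q F tT sF M.
  have [g Fg gf] := bullet_extend p_pr tT sF (subgroup_bullet p_pr tT sF sM) MB
    (@subset_refl _ _) Ff.
  apply: (ext_at_bullet (hom_im (mor_inj_hom fF Ff))).
  by apply: XB; rewrite -(bullet_im p_pr tT sF sM Fg gf Ff); apply: isoclass_im.
move=> {sQ Q}M sM _ cl XM R iR.
have [cM|ncM] := pselect (centric F M).
  by apply: ext_at_centric; have [f Ff <-] := (isoclassP fF _ _).1 iR; apply: (centric_im sF).
have [k Fk nP] := exists_fn_conj p_pr tT sF sM; set P := k @` M in nP.
have sP : subgroup P := hom_im (mor_inj_hom fF Fk).
have iP := isoclass_im fF Fk; have eP : mu P = mu M by apply: hmu1.
have Pcl M' : subgroup M' -> P `<=` M' -> ~ M' `<=` P -> (mu M' < mu P)%N.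
  rewrite eP; apply: (closed_im p_pr tT sF hmu1 hmu2 _ Fk) => M0 sM0 h1 h2; exact: cl.
have IH M' : subgroup M' -> (mu M' < mu P)%N -> ext_at M'.
  by rewrite eP => sM' lt; apply: (XM M') => //; apply: isoclass_refl.
have ncP : ~ centric F P.
  move=> cP; apply: ncM; have [f Ff <-] := (isoclassP fF _ _).1 (isoclass_sym fF iP).
  exact: (centric_im sF).
have iPR := isoclass_trans fF (isoclass_sym fF iP) iR.
have ex Q : exists hg : (S -> S) * coset_type (Out0 p F), isoclass F P Q ->
    lab (normaliser Q) hg.1 hg.2 /\ hg.1 @` Q = P.
  have [iQ|nQ] := pselect (isoclass F P Q); last by exists (id, 1).
  have [f Ff fQ] := (isoclassP fF _ _).1 (isoclass_sym fF iQ).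
  have nf : fully_normalized p F (f @` Q) by rewrite fQ.
  have [h Fh hQ] := fn_receptive p_pr tT sF Ff nf.
  have [c lc] := lab_ex p_pr tT sF hth Fh.
  by exists (h, c); split=> //; rewrite hQ.
have [hg hgP] := choice ex.
exact: (ext_at_class hmu1 hmu2 sP nP Pcl IH ncP (hq := fun Q => (hg Q).1) (gq := fun Q => (hg Q).2) hgP iPR).
Qed.

End LabelledExtension.

(** * The correspondence *)

Section SaturationOfSubsystems.
Variables (p : nat) (S : groupType) (T : set S) (q : nat) (F : homsets S)
  (theta : set S -> set S -> (S -> S) -> coset_type (Out0 p F)).
Hypotheses (p_pr : prime p) (tT : toral p T q) (sF : saturated p F)
  (hth : theta_hat theta).
Implicit Types (P Q R M Z D : set S) (f g h k : S -> S) (a b u v : sym S) (s t x y z : S)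
  (c d e : coset_type (Out0 p F)).

Let fF := saturated_fusion sF.
Let A := Aut F [set: S].
Local Notation bullet := (bullet p T q F).
Local Notation lab := (lab theta).
Let lab_mor' := @lab_mor p S F theta sF.
Let lab_agree' := @lab_agree p S F theta sF.
Let lab_comp' := lab_comp p_pr tT sF hth.
Let lab_inv' := lab_inv p_pr tT sF hth.

Lemma A_normaliser a Q : A a -> normaliser (a @` Q) = a @` normaliser Q.
Proof.
have h b R x : A b -> normaliser R x -> normaliser (b @` R) (b x).
  move=> Ab Nx; have hb := A_hom sF Ab.
  have k y z : normaliser R y -> (b @` R) z -> (b @` R) (cj (b y) z).
    by move=> Ny [r Rr <-]; rewrite -(hom_cj hb) //; exists (cj y r) => //; apply: normaliser_cj Ny Rr.
  apply/normaliserP; split=> z; first exact: k.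
  by rewrite -(homV hb) //; apply/k/normaliserV.
move=> Aa; have AaV := subgroupV (subgroup_Aut fF (subgroupT S)) Aa.
apply/seteqP; split=> [x Nx|_ [x Nx <-]]; last exact: h.
by exists (a^-1 x); [rewrite -(im_symV a Q); apply: h|apply: symKV].
Qed.

Lemma A_centraliser a Q : A a -> centraliser (a @` Q) = a @` centraliser Q.
Proof.
have h b R x : A b -> centraliser R x -> centraliser (b @` R) (b x).
  by move=> Ab cx; apply: (mor_cent sF (Aut_mor fF Ab)).
move=> Aa; have AaV := subgroupV (subgroup_Aut fF (subgroupT S)) Aa.
apply/seteqP; split=> [x Nx|_ [x Nx <-]]; last exact: h.
by exists (a^-1 x); [rewrite -(im_symV a Q); apply: h|apply: symKV].
Qed.

Lemma im_twist a f P : a @` (twist a f @` P) = f @` P.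
Proof. by rewrite image_comp; apply: eq_imagel => x Px; rewrite /= /twist symKV. Qed.

(** The automorphisms of label 1 form a normal subgroup. On a fully normalized conjugate it contains
    Aut_S and so has index prime to p; the isomorphism r carries coset representatives back to P,
    since its own label cancels. *)
Lemma Opprime_lab P : subgroup P -> Opprime p (Aut F P) `<=` [set a | Aut F P a /\ lab P a 1].
Proof.
move=> sP; have sAP := subgroup_Aut fF sP; pose N0 := [set a : sym S | Aut F P a /\ lab P a 1].
have sN0 : subgroup N0.
  apply: mk_subgroup.
  - split; first exact: subgroup1.
    by apply: (lab_E1 p_pr tT sF hth); apply: (mor_id (E1_fusion theta sF)).
  - move=> a b [Aa la] [Ab lb]; split; first exact: subgroupM.
    by have := lab_symM p_pr tT sF hth Aa Ab la lb; rewrite mulg1.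
  - move=> a [Aa la]; split; first exact: subgroupV.
    by have := lab_symV p_pr tT sF hth Aa la; rewrite invg1.
have cjN0 a b : Aut F P a -> N0 b -> N0 (cj a b).
  move=> Aa [Ab lb]; have [c lc] := lab_ex p_pr tT sF hth (Aut_mor fF Aa).
  have AaV := subgroupV sAP Aa; split; first exact: subgroup_cj.
  have := lab_symM p_pr tT sF hth (subgroupM sAP Aa Ab) AaV
    (lab_symM p_pr tT sF hth Aa Ab lc lb) (lab_symV p_pr tT sF hth Aa lc).
  by rewrite mulg1 mulgV.
move=> a; apply; split.
  split=> //; first by move=> b [].
  move=> b Ab; apply/normaliserP; split=> v; apply: cjN0 => //; exact: subgroupV.
have [r Fr nr] := exists_fn_conj p_pr tT sF sP; have hr := mor_inj_hom fF Fr.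
have sP2 := hom_im hr; set P2 := r @` P in nr sP2.
have sA2 := subgroup_Aut fF sP2.
pose N2 := [set b : sym S | Aut F P2 b /\ lab P2 b 1].
have [c lr] := lab_ex p_pr tT sF hth Fr.
have li := lab_inv' lr.
have rP y : P2 y -> P (inv_on P r y) by apply: inv_on_in.
have Pr x : P x -> P2 (r x) by move=> Px; exists x.
pose tr a b := forall x, P x -> r (a x) = b (r x).
have AP b x : Aut F P b -> P x -> P (b x) := fun Ab => @Aut_in _ _ fF _ _ _ Ab.
have tr_lab b v : Aut F P b -> Aut F P2 v -> tr b v -> lab P b 1 <-> lab P2 v 1.
  move=> Ab Av bv; split=> l1.
    have := lab_comp' (lab_comp' li l1 rP) lr (fun y hy => AP _ _ Ab (rP _ hy)).
    rewrite mul1g mulgV; apply: lab_agree' => y hy.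
    by rewrite /= bv ?inv_onK //; apply: rP.
  have := lab_comp' (lab_comp' lr l1 Pr) li (fun x hx => @Aut_in _ _ fF _ _ _ Av (Pr _ hx)).
  rewrite mul1g mulVg; apply: lab_agree' => x hx.
  by rewrite /= -bv // (inv_on_f hr) //; apply: AP.
have sN2 : subgroup N2.
  apply: mk_subgroup.
  - split; first exact: subgroup1.
    by apply: (lab_E1 p_pr tT sF hth); apply: (mor_id (E1_fusion theta sF)).
  - move=> b v [Ab lb] [Av lv]; split; first exact: subgroupM.
    by have := lab_symM p_pr tT sF hth Ab Av lb lv; rewrite mulg1.
  - move=> b [Ab lb]; split; first exact: subgroupV.
    by have := lab_symV p_pr tT sF hth Ab lb; rewrite invg1.
have BN : Aut (homS (S:=S)) P2 `<=` N2.
  move=> b Bb; split; first exact: (AutS_Aut fF sP2).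
  have [_ [s Ns bs]] := (AutSP _ sP2).1 Bb.
  by apply: (lab_agree' _ (lab_cj p_pr tT sF hth s sP2)) => x Px; rewrite bs.
have N2A : N2 `<=` Aut F P2 by move=> b [].
have [[n iN pn] _] := pidx_trans sA2 (subgroup_AutS sP2) (AutS_Aut fF sP2) sN2 BN N2A
  (fn_sylow p_pr sF sP2 nr).
exists n => //; apply/(has_index_reps _ _ sN0).
have [w [wA wS wI]] := (has_index_reps _ _ sN2).1 iN.
have trA b : Aut F P b -> exists2 v, Aut F P2 v & tr b v.
  move=> Ab; have [v [Av _] vE] := transport_of sF Fr (@subset_refl _ (Aut F P)) Ab.
  by exists v => // x Px; rewrite vE.
have trB v : Aut F P2 v -> exists b, Aut F P b /\ tr b v.
  move=> Av; have vP x (hx : P x) : P2 (v (r x)) := @Aut_in _ _ fF _ _ _ Av (Pr _ hx).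
  have Fx : mor F P (inv_on P r \o ((v : S -> S) \o r)).
    exact: (mor_comp fF (mor_comp fF Fr (Aut_mor fF Av) Pr) (mor_inv fF Fr)).
  have imx : (inv_on P r \o ((v : S -> S) \o r)) @` P = P.
    rewrite -image_comp -image_comp.
    have [_ _ ->] := (AutP fF _ _).1 Av; exact: im_inv_on.
  have [b Ab bE] := Aut_of fF Fx imx; exists b; split=> // x Px.
  by rewrite bE //= inv_onK //; apply: vP.
have trVM b b' v v' : Aut F P b -> Aut F P b' -> tr b v -> tr b' v' -> tr (b^-1 * b')%g (v^-1 * v')%g.
  move=> Ab Ab' bv bv' x Px; have Px' := AP _ _ Ab' Px.
  have Px2 : P (b^-1 (b' x)) := AP _ _ (subgroupV sAP Ab) Px'.
  by rewrite !symM -bv' // -{2}(symKV b (b' x)) bv // symK.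
have [e eP] := choice (fun i => trB _ (wA i)).
have VM b v : Aut F P b -> Aut F P v -> Aut F P (b^-1 * v)%g.
  by move=> Ab Av; apply: subgroupM => //; apply: subgroupV.
have VM2 b v : Aut F P2 b -> Aut F P2 v -> Aut F P2 (b^-1 * v)%g.
  by move=> Ab Av; apply: subgroupM => //; apply: subgroupV.
exists e; split=> [i|b Ab|i j [Aij lij]]; first by case: (eP i).
  have [v Av bv] := trA b Ab; have [i [_ li']] := wS v Av; have [Ae te] := eP i.
  exists i; split; first exact: VM.
  by apply/(tr_lab _ _ (VM _ _ Ae Ab) (VM2 _ _ (wA i) Av)) => //; apply: trVM.
have [Ai ti] := eP i; have [Aj tj] := eP j; apply: wI; split; first exact: VM2.
by apply/(tr_lab _ _ Aij (VM2 _ _ (wA i) (wA j))) => //; apply: trVM.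
Qed.

Section Subgroup.
Variable H : set (coset_type (Out0 p F)).
Hypotheses (sH : subgroup H) (HG : H `<=` Gamma p F).
Let E := fusion_of theta H.
Let fE : fusion_system E := @fusion_of_fusion p S F theta sF H.
Let EF : subsystem E F := @fusion_of_sub p S F theta sF H.
Let morE P f := @fusion_ofP p S T q F theta p_pr tT sF hth H P f sH HG.

Lemma E_class_sub P Q : isoclass E P Q -> isoclass F P Q.
Proof. by move=> /(isoclassP fE)[f Ff <-]; apply: (isoclass_im fF (EF Ff)). Qed.

(** Write the isomorphism as a k with k in E and a in Aut_F(S). As a carries normalisers and
    centralisers to isomorphic ones, the E-class of P realises all the orders that occur in its
    F-class. *)
Lemma class_factor P Q : isoclass F P Q -> exists Q1, [/\ isoclass E P Q1,
  pt_order p (normaliser Q) = pt_order p (normaliser Q1) &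
  pt_order p (centraliser Q) = pt_order p (centraliser Q1)].
Proof.
move=> /(isoclassP fF)[f Ff <-]; have [c [a [Aa _ Ef]]] := lab_ex p_pr tT sF hth Ff.
have Eg : mor E P (twist a f).
  by apply/morE; exists 1; [exact: (subgroup1 sH)|exact: (lab_E1 p_pr tT sF hth)].
exists (twist a f @` P); split; first exact: isoclass_im.
  rewrite -(pt_order_im p (inj_hom_sub (A_hom sF Aa) (@subgroup_normaliser _ (twist a f @` P)) (fun x _ => Logic.I))).
  by rewrite -A_normaliser // im_twist.
rewrite -(pt_order_im p (inj_hom_sub (A_hom sF Aa) (@subgroup_centraliser _ (twist a f @` P)) (fun x _ => Logic.I))).
by rewrite -A_centraliser // im_twist.
Qed.

Lemma E_fn P : fully_normalized p E P -> fully_normalized p F P.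
Proof. by move=> nP Q /class_factor[Q1 [/nP h e _]]; rewrite /order_le e. Qed.

Lemma E_fc P : fully_centralized p E P -> fully_centralized p F P.
Proof. by move=> nP Q /class_factor[Q1 [/nP h _ e]]; rewrite /order_le e. Qed.

Lemma saturated_fusion_of : saturated p E.
Proof.
split; first exact: fE.
- move=> P sP /E_fn nP; have [cP fO sy] := saturated_sylow sF sP nP.
  have AEF : Aut E P `<=` Aut F P.
    by move=> a /(AutP fE)[h1 /EF h2 h3]; apply/(AutP fF).
  split.
  + by move=> Q /E_class_sub; apply: cP.
  + by apply: sub_finite_set fO; apply: image_subset => a [/AEF].
  have sI := subgroup_Inn sP.
  by have [] := Sylow_quotient p_pr sI (subgroup_Aut fF sP) (subgroup_AutS sP)
    (subgroup_Aut fE sP) (Inn_AutS sP) (AutS_Aut fE sP) AEF (Aut_normInn fF sP) sy.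
- move=> P f /morE[c Hc lf] /E_fc cf.
  have [g lg gf] := lab_extender p_pr tT sF hth lf cf.
  by exists g => //; apply/morE; exists c.
move=> P_ f sP PS hf Ef; have Fu := saturated_union sF sP PS hf (fun n => EF (Ef n)).
have [mu [_ hmu]] := exists_measure p_pr tT sF.
have Pmon i j : (i <= j)%N -> P_ i `<=` P_ j.
  elim: j => [|j IH]; first by rewrite leqn0 => /eqP->.
  rewrite leq_eqVlt => /orP[/eqP-> //|]; rewrite ltnS => /IH h; exact: subset_trans h (PS j).
(* For n minimising the measure, later members of the sequence have the measure of P_n and so stay
   in its closure. *)
have ex : exists m, `[< exists n, mu (P_ n) = m >] by exists (mu (P_ 0)); apply/asboolP; exists 0%N.
have [m /asboolP[n nm] mmin] := ex_minnP ex.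
have Ub : \bigcup_i P_ i `<=` bullet (P_ n).
  move=> x [i _ Px]; have h1 := Pmon _ _ (leq_maxl n i).
  have [le eq] := hmu _ _ (sP n) (sP (maxn n i)) h1.
  apply: eq; last exact: (Pmon _ _ (leq_maxr n i)).
  apply/eqP; rewrite eqn_leq le nm /=; apply: mmin; apply/asboolP; by exists (maxn n i).
have [c Hc lc] := (morE _ _).1 (Ef n); apply/morE; exists c => //.
have PU : P_ n `<=` \bigcup_i P_ i by move=> x Px; exists n.
exact: (lab_bullet p_pr tT sF hth (mor_subgroup fF Fu) PU Ub lc Fu).
Qed.

Lemma index_prime_fusion_of : index_prime_to_p p F E.
Proof.
split; [exact: saturated_fusion_of|exact: EF|].
move=> P sP a /(Opprime_lab sP)[/(AutP fF)[h1 _ h3] la]; apply/(AutP fE); split=> //.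
by apply/morE; exists 1; [exact: (subgroup1 sH)|].
Qed.

End Subgroup.

(** H is recovered as the set of classes of the automorphisms of S in F_H. *)
Lemma fusion_of_inj H1 H2 : subgroup H1 -> H1 `<=` Gamma p F -> subgroup H2 ->
  fusion_of theta H1 = fusion_of theta H2 -> H1 `<=` H2.
Proof.
move=> s1 G1 s2 e c H1c; have [a Aa ac] := Gamma_ta hth (G1 _ H1c).
have cS := centric_setT p_pr tT sF.
have : mor (fusion_of theta H1) [set: S] a.
  by apply: (fusion_of_th p_pr tT sF cS (Aut_mor fF Aa)); rewrite -ac in H1c.
rewrite e => /(th_fusion_of p_pr tT sF hth s2 cS).
by rewrite -ac.
Qed.

End SaturationOfSubsystems.

(** * Every subsystem of index prime to p comes from a subgroup *)

Section Surjectivity.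
Variables (p : nat) (S : groupType) (T : set S) (q : nat) (F : homsets S)
  (theta : set S -> set S -> (S -> S) -> coset_type (Out0 p F)).
Hypotheses (p_pr : prime p) (tT : toral p T q) (sF : saturated p F)
  (hth : theta_hat theta).
Implicit Types (P Q R M Z D : set S) (f g h k : S -> S) (a b u v : sym S) (s t x y z : S)
  (c d e : coset_type (Out0 p F)).

Let fF := saturated_fusion sF.
Let A := Aut F [set: S].
Let sA : subgroup A := subgroup_Aut fF (subgroupT S).
Let cS := centric_setT p_pr tT sF.

(** As f is trivial on R, conjugation by y and by f(y) agree on R. *)
Lemma fix_centric R Z f : centric F R -> R `<=` Z -> Z `<=` normaliser R -> mor F Z f ->
  agree R f id -> forall y, Z y -> R (y^-1 * f y) /\ centraliser R (y^-1 * f y).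
Proof.
move=> [sR cR] RZ ZN Ff fid y Zy; have hf := mor_inj_hom fF Ff.
suff cy : centraliser R (y^-1 * f y).
  by split=> //; apply: (centralP R).1 cy; apply: cR; apply: isoclass_refl.
apply/centraliserP => x Rx; have Rxy := normaliser_cj (ZN _ Zy) Rx.
rewrite cjM -{1}(fid x Rx) -(hom_cj hf) //; last exact: RZ.
by rewrite fid // cjK.
Qed.

Lemma fix_centric_onto R Z f : centric F R -> R `<=` Z -> Z `<=` normaliser R ->
  mor F Z f -> agree R f id -> f @` Z = Z.
Proof.
move=> cR RZ ZN Ff fid; have hf := mor_inj_hom fF Ff; have sZ := hom_sub hf.
have fZ x : Z x -> Z (f x).
  move=> Zx; rewrite -(mulVKg x (f x)); apply: (subgroupM sZ) => //.
  by apply: (RZ); have [] := fix_centric cR RZ ZN Ff fid Zx.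
apply/seteqP; split=> [_ [x Zx <-]|y Zy]; first exact: fZ.
have [x Zx xy] := coHopf p_pr tT sZ fZ (fun x y hx hy => homM hf hx hy)
  (fun x y hx hy => hom_inj hf hx hy) Zy.
by exists x.
Qed.

(* On an automorphism a of Z that is trivial on R, the cocycle y^-1 a(y) only depends
   on the class of y in Out_S(R), and Out_S(R) is finite. *)
Lemma fix_centric_ptorsion R Z a : centric F R -> R `<=` Z -> Z `<=` normaliser R ->
  Aut F Z a -> agree R a id -> exists n, a ^+ (p ^ n) = 1.
Proof.
move=> cR RZ ZN Aa aid; have Fa := Aut_mor fF Aa; have ha := mor_inj_hom fF Fa.
have sZ := hom_sub ha; have [sR _] := cR.
pose z (y : S) : S := y^-1 * a y.
have zc y : Z y -> R (z y) /\ centraliser R (z y) by apply: fix_centric cR RZ ZN Fa aid y.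
have az n y : Z y -> (a ^+ n) y = y * z y ^+ n.
  move=> Zy; elim: n => [|n IH]; first by rewrite expg0 mulg1.
  have Rzn : R (z y ^+ n) by apply: subgroupX => //; case: (zc y Zy).
  rewrite expgS symM IH (homM ha) //; last exact: RZ.
  by rewrite (aid _ Rzn) expgS mulgA {2}/z mulVKg.
(* Axiom (I) gives the finiteness of Out only for a fully normalized subgroup, so R is moved to
   R2. *)
have [r Fr nr] := exists_fn_conj p_pr tT sF sR.
have [h Fh hR] := fn_receptive p_pr tT sF Fr nr; rewrite -hR in nr.
have RN : R `<=` normaliser R by apply: sub_normaliser.
have hh := mor_inj_hom fF Fh; have FhR := mor_sub fF sR RN Fh.
have cR2 := centric_im sF cR FhR; set R2 := h @` R in nr cR2.
have sR2 := cR2.1; have hN := im_normaliser sF Fh RN (@subset_refl _ _).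
have [_ fO _] := saturated_sylow sF sR2 nr.
have sI := subgroup_Inn sR2.
have NI := subset_trans (AutS_Aut fF sR2) (Aut_normInn fF sR2).
have zeq y y' b b' : Z y -> Z y' -> Aut (homS (S:=S)) R2 b -> agree R2 b (cj (h y)) ->
    Aut (homS (S:=S)) R2 b' -> agree R2 b' (cj (h y')) ->
    coset_class (Inn R2) b = coset_class (Inn R2) b' -> z y = z y'.
  move=> Zy Zy' Bb bE Bb' bE' /(coset_class_eq sI (NI _ Bb) (NI _ Bb'))[_ [_ [s Rs <-] sE]].
  have Ny := ZN _ Zy; have Ny' := ZN _ Zy'; have Ns := RN _ Rs.
  pose w := (y * s)^-1 * y'.
  have sN := @subgroup_normaliser _ R.
  have Nys : normaliser R (y * s) by apply: (subgroupM sN).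
  have Nw : normaliser R w by apply: (subgroupM sN) => //; apply: subgroupV.
  have Rw : R w.
    have : centraliser R2 (h w).
      apply/centraliserP => x Rx.
      rewrite (homM hh) ?(homV hh) ?(homM hh) //; last exact: (subgroupV sN).
      have R2s : R2 (cj (h s) x) by apply: (subgroup_cj sR2) => //; exists s.
      have e : cj (h y') x = cj (h y * h s) x.
        by rewrite cjM -bE' // -(bE _ R2s) -(sE x Rx) symM symKV.
      by rewrite cjM e cjK.
    move=> /(centralP R2).1; rewrite (cR2.2 _ (isoclass_refl fF sR2)) => -[//|x Rx e].
    by rewrite -(hom_inj hh (RN _ Rx) Nw e).
  have -> : y' = y * (s * w) by rewrite mulgA /w mulVKg.
  have Rsw : R (s * w) by apply: (subgroupM sR).
  rewrite -[z (y * _)]/((y * (s * w))^-1 * a (y * (s * w))).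
  rewrite (homM ha Zy (RZ _ Rsw)) (aid _ Rsw) invgM -mulgA (mulgA y^-1).
  rewrite -[y^-1 * a y]/(z y); have [_ /(_ _ Rsw)] := zc y Zy.
  by rewrite /commute => ->; rewrite mulKg.
have exk (C : coset_type (Inn R2)) : exists n, forall y b, Z y ->
    Aut (homS (S:=S)) R2 b -> agree R2 b (cj (h y)) -> coset_class (Inn R2) b = C ->
    z y ^+ (p ^ n) = 1.
  have [[y [b [Zy Bb bE bC]]]|nex] := pselect (exists y b, [/\ Z y,
      Aut (homS (S:=S)) R2 b, agree R2 b (cj (h y)) & coset_class (Inn R2) b = C]).
    have [k kz] := toral_p tT (z y); exists k => y' b' Zy' Bb' bE' bC'.
    by rewrite -(zeq y y' b b') // bC.
  by exists 0%N => y b Zy Bb bE bC; case: nex; exists y, b.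
have [K hK] := choice exk.
have [k kK] := finite_bound K fO; exists k.
apply: (Aut_eq fF (subgroupX _ (subgroup_Aut fF sZ) Aa) (subgroup1 (subgroup_Aut fF sZ))).
move=> y Zy; rewrite az //.
have Nhy : normaliser R2 (h y) by apply: hN; exists y => //; apply: ZN.
have [b Bb bE] := AutS_of sR2 Nhy.
have Ob : Out F R2 (coset_class (Inn R2) b).
  rewrite /Out (quotientE sI (Aut_normInn fF sR2)); exists b => //.
  exact: (AutS_Aut fF sR2).
rewrite -(subnK (kK _ Ob)) addnC expnD expgnA (hK _ y b Zy Bb bE erefl).
by rewrite expg1n mulg1.
Qed.

Variable E : homsets S.
Hypothesis iE : index_prime_to_p p F E.

Let sE : saturated p E. Proof. by case: iE. Qed.
Let EF : subsystem E F. Proof. by case: iE. Qed.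
Let fE := saturated_fusion sE.

Lemma E_Opprime P a : subgroup P -> Opprime p (Aut F P) a -> Aut E P a.
Proof. by case: iE => _ _ h sP; apply: h. Qed.

Lemma E_Opstar : subsystem (Opstar p F) E.
Proof.
apply: (fusion_gen_min fE) => P _ f [sP -> [a Oa ->]].
by have [_ []] := E_Opprime sP Oa.
Qed.

Lemma E_iso_sub P Q : isoclass E P Q -> isoclass F P Q.
Proof. by move=> /(isoclassP fE)[f Ff <-]; apply: (isoclass_im fF (EF Ff)). Qed.

Lemma E_centric P : centric F P -> centric E P.
Proof. by move=> [sP cP]; split=> // Q /E_iso_sub; apply: cP. Qed.

(** The domain on which a is in E grows from R to S by [mor_exhaust], with axiom (III) taken in
    E. *)
Lemma E_Aut a R : A a -> centric F R -> mor E R a -> Aut E [set: S] a.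
Proof.
move=> Aa cR Ea; have [h1 Fa h3] := (AutP fF _ _).1 Aa; apply/(AutP fE); split=> //.
have ha := A_hom sF Aa.
apply: (mor_exhaust p_pr tT sE ha.1 (@subsetT _ R) Ea) => Q RQ _ EQ nQ.
have sQ := mor_subgroup fE EQ; have cQ := centric_over sF cR sQ RQ.
have QN : Q `<=` normaliser Q by apply: sub_normaliser.
exists (normaliser Q); split=> //; last first.
  have [y [_ ny Ny]] := normalizer_grows p_pr tT sQ (subgroupT S) (@subsetT _ Q) nQ.
  by move=> h; apply: ny; apply: h.
have FQ := EF EQ; have caQ := centric_im sF cQ FQ.
have [g Eg gE] : exists2 g, mor E (normaliser Q) g & agree Q g a.
  apply: (mor_extend sE EQ) => //; first exact: centric_fc (E_centric caQ).
    exact: subgroup_normaliser.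
  by move=> s Ns; exists (a s) => x Qx; rewrite (hom_cj ha).
have Fg := EF Eg; have hg := mor_inj_hom fF Fg.
pose Z := g @` normaliser Q.
have gQ : g @` Q = a @` Q by apply: eq_imagel.
have ZN : Z `<=` normaliser (a @` Q).
  by rewrite -gQ; apply: (im_normaliser sF Fg QN).
have aZ : a @` Q `<=` Z by rewrite -gQ; apply: image_subset.
have FaN : mor F (normaliser Q) a by apply: (A_mor sF Aa); apply: subgroup_normaliser.
have Fk : mor F Z (a \o inv_on (normaliser Q) g).
  by apply: (mor_comp fF (mor_inv fF Fg) FaN) => y; apply: inv_on_in.
have kid : agree (a @` Q) (a \o inv_on (normaliser Q) g) id.
  by move=> _ [x Qx <-]; rewrite /= -{1}(gE x Qx) (inv_on_f hg) //; apply: QN.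
have [b Ab bE] := Aut_of fF Fk (fix_centric_onto caQ aZ ZN Fk kid).
have bid : agree (a @` Q) b id by move=> x aQx; rewrite bE ?kid //; apply: aZ.
have [k bk] := fix_centric_ptorsion caQ aZ ZN Ab bid.
have sZ := hom_im hg.
have Eb := E_Opprime sZ (Opprime_ptorsion p_pr (subgroup_Aut fF sZ) Ab bk).
have := mor_comp fE Eg (Aut_mor fE Eb) (fun x hx => ex_intro2 _ _ x hx erefl).
apply: (mor_agree fE) => x Nx; rewrite /= bE; last by exists x.
by rewrite /= (inv_on_f hg).
Qed.

Let I := Inn [set: S].
Let sI : subgroup I := subgroup_Inn (subgroupT S).
Let AI : A `<=` normaliser I := Aut_normInn fF (subgroupT S).
Let AE : Aut E [set: S] `<=` A.
Proof. by move=> a /(AutP fE)[h1 /EF h2 h3]; apply/(AutP fF). Qed.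

(** This keeps [coset_class (Out0 p F)] off its junk value, so that class 1 means membership in
    [Out0]. *)
Lemma Out0_normaliser a : A a -> normaliser (Out0 p F) (coset_class I a).
Proof.
have h b : A b -> forall C, Out0 p F C -> Out0 p F (cj (coset_class I b) C).
  move=> Ab; have sO : subgroup (Out0 p F) := subgroup_gen _.
  suff : Out0 p F `<=` [set C | Out0 p F (cj (coset_class I b) C)] by [].
  apply: gen_subset.
    apply: mk_subgroup.
    - by rewrite /= cjg1; apply: subgroup1.
    - by move=> C D OC OD; rewrite /= cjMr; apply: (subgroupM sO).
    - by move=> C OC; rewrite /= cjV; apply: (subgroupV sO).
  move=> _ [a0 [Aa0 [P cP Oa]] <-]; apply: sub_gen.
  have AbV := subgroupV sA Ab.
  exists (cj b a0).
    split; first exact: subgroup_cj.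
    exists (b @` P); first exact: (centric_im sF cP (A_mor sF Ab cP.1)).
    apply: (mor_agree (Opstar_fusion p_pr sF) _ (Opstar_norm p_pr sF Ab Oa)) => x _.
    by rewrite cjE !symM.
  by rewrite /cj !coset_classM ?coset_classV //; apply: AI => //; apply: (subgroupM sA).
move=> Aa; apply/normaliserP; split=> C; first exact: h.
rewrite -coset_classV //; last exact: AI.
exact: (h _ (subgroupV sA Aa)).
Qed.

(** The generators of [Out0] are classes of automorphisms to which [E_Aut] applies, because E
    contains [Opstar]; moreover E contains Inn(S). *)
Lemma E_ta1 b : A b -> ta theta b = 1 -> Aut E [set: S] b.
Proof.
move=> Ab; rewrite /ta (theta_Aut hth Ab).
have sO : subgroup (Out0 p F) := subgroup_gen _.
rewrite -(coset_class1 sO) => /esym/(coset_class_eq sO (normaliser1 _) (Out0_normaliser Ab)).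
rewrite invg1 mul1g => Ob.
have sAE := subgroup_Aut fE (subgroupT S).
have EI := subset_trans AE AI.
have : quotient (Aut E [set: S]) I (coset_class I b).
  apply: (gen_subset _ _ Ob); first exact: subgroup_quotient.
  move=> _ [a [Aa [P cP Oa]] <-]; rewrite quotientE //; exists a => //.
  by apply: (E_Aut Aa cP); apply: E_Opstar.
rewrite quotientE // => -[a Ea /(coset_class_eq sI (EI _ Ea) (AI Ab)) ab].
rewrite -(mulVKg a b); apply: (subgroupM sAE) => //.
exact: (Inn_Aut fE (subgroupT S) ab).
Qed.

Definition labels_of : set (coset_type (Out0 p F)) := [set ta theta a | a in Aut E [set: S]].

Lemma subgroup_labels : subgroup labels_of.
Proof.
have sAE := subgroup_Aut fE (subgroupT S); apply: mk_subgroup.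
- by exists 1; [exact: (subgroup1 sAE)|exact: (ta1 p_pr tT sF hth)].
- move=> _ _ [a Ea <-] [b Eb <-]; exists (a * b); first exact: (subgroupM sAE).
  by apply: (taM p_pr tT sF hth); apply: AE.
- move=> _ [a Ea <-]; exists a^-1; first exact: (subgroupV sAE).
  by apply: (taV p_pr tT sF hth); apply: AE.
Qed.

Lemma labels_Gamma : labels_of `<=` Gamma p F.
Proof. by move=> _ [a Ea <-]; apply: (ta_Gamma p_pr tT sF hth); apply: AE. Qed.

Lemma E_labels a : A a -> labels_of (ta theta a) -> Aut E [set: S] a.
Proof.
move=> Aa [b Eb ba]; have Ab := AE Eb; have sAE := subgroup_Aut fE (subgroupT S).
have AbV := subgroupV sA Ab.
rewrite -(mulVKg b a); apply: (subgroupM sAE) => //; apply: E_ta1.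
  exact: (subgroupM sA).
by rewrite (taM p_pr tT sF hth AbV Aa) (taV p_pr tT sF hth Ab) ba mulVg.
Qed.

Lemma Opstar_alperin P f : mor F P f -> factors F (Opstar p F) P f.
Proof.
apply: (alperin p_pr tT sF (Opstar_fusion p_pr sF) (Opstar_sub p_pr sF)).
  by move=> a Q g; apply: (Opstar_norm p_pr sF).
by move=> Q cQ a b; apply: (Opstar_centric p_pr tT sF).
Qed.

Lemma fusion_of_labels_sub : subsystem (fusion_of theta labels_of) E.
Proof.
apply: (fusion_gen_min fE) => P Q f [cP cQ Ff Hf].
have /(F_mor fF)[Mf sQ fPQ] := Ff; apply/(F_mor fE); split=> //.
rewrite (th_theta p_pr tT sF hth cP cQ Ff) in Hf.
have [a Aa Of] := Opstar_alperin Mf.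
have fE' : mor E P ((a : S -> S) \o twist a f) -> mor E P f.
  by apply: (mor_agree fE) => x _; rewrite /= /twist symKV.
apply: fE'; apply: (mor_comp fE (E_Opstar Of) (Q := [set: S])) => //.
apply: (Aut_mor fE); apply: (E_labels Aa); move: Hf.
have FO := Opstar_sub p_pr sF Of.
have -> : th theta P f = th theta P ((a : S -> S) \o twist a f).
  by apply: (th_agree p_pr tT sF hth cP Mf) => x _; rewrite /= /twist symKV.
rewrite (th_comp p_pr tT sF hth cP FO (Aut_mor fF Aa)) //.
by rewrite (th_Opstar p_pr tT sF hth cP Of) mulg1.
Qed.

(** An F-conjugate of P is a(P') with P' an E-conjugate and a in Aut_F(S), and a preserves the
    condition on centralisers. This connects Alperin's theorem in E, whose hypothesis concerns
    E-centric subgroups, with theta. *)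
Lemma F_centric P : centric E P -> centric F P.
Proof.
move=> [sP cP]; split=> // _ /(isoclassP fF)[f Ff <-].
have [a Aa Of] := Opstar_alperin Ff.
rewrite -(im_twist a f P) (A_centraliser sF _ Aa) /center (A_centraliser sF _ Aa).
have := cP _ (isoclass_im fE (E_Opstar Of)) => ->.
apply/seteqP; split=> [_ [x [Px cx] <-]|x [_ //]].
by split; exists x.
Qed.

(** The nontrivial inclusion is Alperin's theorem inside E, relative to F_H: a morphism of E is a k
    with k in F_H and a in Aut_E(S), and the class of a is in H by the choice of H. *)
Lemma fusion_of_labels : fusion_of theta labels_of = E.
Proof.
have sH := subgroup_labels; have EH := fusion_of_labels_sub.
have fH : fusion_system (fusion_of theta labels_of) by apply: fusion_of_fusion.
suff h P f : mor E P f -> mor (fusion_of theta labels_of) P f.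
  apply/funext => P; apply/funext => Q; apply/seteqP; split=> f; first exact: EH.
  move=> /(F_mor fE)[Ef sQ fPQ]; apply/(F_mor fH); split=> //; exact: h.
move=> Ef.
have [||a Ea Hf] := alperin p_pr tT sE fH EH _ _ Ef.
- move=> a R g Ea; apply: (fusion_of_norm p_pr tT sF hth (AE Ea)) => c Hc.
  by apply: (subgroup_cj sH) => //; exists a.
- move=> R cR a b Ea Bb; have cFR := F_centric cR.
  have Aa : Aut F R a by have [h1 /EF h2 h3] := (AutP fE _ _).1 Ea; apply/(AutP fF).
  apply: (fusion_of_th p_pr tT sF cFR).
    exact: (Opstar_sub p_pr sF (Opstar_centric p_pr tT sF cFR Aa Bb)).
  by rewrite (th_conj p_pr tT sF hth cFR Aa Bb); apply: subgroup1.
have Ha : mor (fusion_of theta labels_of) [set: S] a.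
  by apply: (fusion_of_th p_pr tT sF cS (Aut_mor fF (AE Ea))); exists a.
have := mor_comp fH Hf Ha (fun x _ => Logic.I).
by apply: (mor_agree fH) => x _; rewrite /= /twist symKV.
Qed.

End Surjectivity.

Theorem theoremA10 (p : nat) (S : groupType) (F : homsets S)
    (L : linking_system F)
    (theta : set S -> set S -> (S -> S) -> coset_type (Out0 p F)) :
  prime p ->
  p_local_compact_group p L ->
  theta_hat theta ->
  set_bij [set H : set (coset_type (Out0 p F)) |
             subgroup H /\ H `<=` Gamma p F]
          [set E : homsets S | index_prime_to_p p F E]
          (fusion_of theta).
Proof.
move=> p_pr [dS sF] hth; have [T [q tT]] := toral_of_discrete p_pr dS.
split.
- by move=> H [sH HG]; apply: (index_prime_fusion_of p_pr tT sF hth).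
- move=> H1 H2; rewrite !inE => -[s1 G1] [s2 G2] e.
  by apply/seteqP; split; [apply: (fusion_of_inj p_pr tT sF hth s1 G1 s2 e)|
    apply: (fusion_of_inj p_pr tT sF hth s2 G2 s1 (esym e))].
move=> E iE; exists (labels_of theta E); last exact: (fusion_of_labels p_pr tT sF hth iE).
split; first exact: (subgroup_labels p_pr tT sF hth iE).
exact: (labels_Gamma p_pr tT sF hth iE).
Qed.
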